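(* Let $\mathcal A$ be a unital C$^*$-algebra. Consider the maps $$\hat\varphi:\mathcal K_D\to\mathcal D,\ \hat\varphi\left(\begin{array}{c} x_1\\ x_2\end{array}\right)=x_2x_1^{-1};\qquad \tilde\varphi:\mathcal K_D\to\mathcal Q_{\rho_D},\ \tilde\varphi(\mathbf x)=2p_{\mathbf x}-1;$$ $$\Phi_D:\mathcal D\to\mathcal Q_{\rho_D},\quad \Phi_D(z)=2p_{\mathbf x}-1\ \text{ for any }\mathbf x\in\mathcal K_D\text{ with }\hat\varphi(\mathbf x)=z .$$ The diagram they form commutes, i.e. $\Phi_D\circ\hat\varphi=\tilde\varphi$. The maps $\hat\varphi:\mathcal K_D\to\mathcal D$ and $\tilde\varphi:\mathcal K_D\to\mathcal Q_{\rho_D}$ are $C^\infty$ submersions. The map $\Phi_D:\mathcal D\to\mathcal Q_{\rho_D}$ is a $C^\infty$ diffeomorphism. All these maps are equivariant under the action of $\mathcal U(\theta_D)$.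
   Context: $G$ is the group of invertible elements of $\mathcal A$ and $\mathcal D=\{z\in\mathcal A:\|z\|<1\}$. $M_2(\mathcal A)$ acts by left multiplication on column vectors in $\mathcal A^2$; $Gl_2(\mathcal A)$ is its group of invertible elements and $Gl_2(\mathcal A)^+$ the set of its positive invertible elements. $\rho_D=\left(\begin{array}{cc}1&0\\ 0&-1\end{array}\right)$. The $\mathcal A$-valued form $\theta_D$ on $\mathcal A^2$ is $\theta_D\left(\left(\begin{array}{c} x_1\\ x_2\end{array}\right),\left(\begin{array}{c} y_1\\ y_2\end{array}\right)\right)=x_1^*y_1-x_2^*y_2$, and $$\mathcal U(\theta_D)=\{\tilde a\in Gl_2(\mathcal A):\theta_D(\tilde a\mathbf x,\tilde a\mathbf y)=\theta_D(\mathbf x,\mathbf y)\ \text{for all }\mathbf x,\mathbf y\in\mathcal A^2\},$$ $$\mathcal K_D=\{\mathbf x=(x_1,x_2)^T\in\mathcal A^2:\theta_D(\mathbf x,\mathbf x)=1,\ x_1\in G\},$$ $$\mathcal Q_{\rho_D}=\{\epsilon\in M_2(\mathcal A):\epsilon^2=1,\ \rho_D\epsilon\in Gl_2(\mathcal A)^+\}.$$ $\mathcal K_D$ is a $C^\infty$ submanifold of $\mathcal A^2$ and $\mathcal Q_{\rho_D}$ is a $C^\infty$ submanifold of $M_2(\mathcal A)$. For $\mathbf x\in\mathcal K_D$, $$p_{\mathbf x}=\left(\begin{array}{c} x_1\\ x_2\end{array}\right)\left(\begin{array}{cc} x_1^*&x_2^*\end{array}\right)\rho_D=\left(\begin{array}{cc}x_1x_1^*&-x_1x_2^*\\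 x_2x_1^*&-x_2x_2^*\end{array}\right)\in M_2(\mathcal A).$$ The map $\Phi_D$ does not depend on the choice of $\mathbf x$. $\mathcal U(\theta_D)$ acts on $\mathcal K_D$ by left multiplication, on $\mathcal D$ by $\left(\begin{array}{cc}a_{11}&a_{12}\\ a_{21}&a_{22}\end{array}\right)\cdot z=(a_{21}+a_{22}z)(a_{11}+a_{12}z)^{-1}$, and on $\mathcal Q_{\rho_D}$ by $\tilde g\cdot\epsilon=\tilde g\epsilon\tilde g^{-1}$. Manifolds are real $C^\infty$ Banach manifolds. *)

(* Defs.v *)
From HB Require Import structures.
From mathcomp Require Import all_boot all_order all_algebra.
From mathcomp Require Import complex.
From mathcomp Require Import all_classical all_reals.
From mathcomp Require Import topology normedtype derive.

Set Implicit Arguments.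
Unset Strict Implicit.
Unset Printing Implicit Defensive.

Import Order.TTheory GRing.Theory Num.Theory.
Import numFieldNormedType.Exports.

Local Open Scope classical_set_scope.
Local Open Scope ring_scope.

Record blin (R : realType) (V W : normedModType R) := Blin {
  blin_fun :> V -> W ;
  blin_is_linear : linear blin_fun ;
  blin_continuous : continuous blin_fun
}.

Section BoundedLinear.
Context {R : realType} {V W : normedModType R}.
Implicit Types f g h : blin V W.

HB.instance Definition _ f :=
  GRing.isLinear.Build R V W _ (blin_fun f) (blin_is_linear f).

HB.instance Definition _ := gen_eqMixin (blin V W).
HB.instance Definition _ := gen_choiceMixin (blin V W).

Lemma blinP f g : (forall x, f x = g x) -> f = g.
Proof.
case: f g => [f fl fc] [g gl gc] /= /funext fg.
by case: _ / fg gl gc => gl gc; congr Blin; exact: Prop_irrelevance.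
Qed.

Fact blin0_is_linear : linear (fun _ : V => 0 : W).
Proof. by move=> a x y; rewrite scaler0 addr0. Qed.
Definition blin0 : blin V W := Blin blin0_is_linear (fun=> cvg_cst _).

Fact blinN_is_linear f : linear (fun x => - f x).
Proof. by move=> a x y; rewrite linearP scalerN opprD. Qed.
Fact blinN_continuous f : continuous (fun x => - f x).
Proof. by move=> x; apply: cvgN; exact: blin_continuous. Qed.
Definition blinN f : blin V W :=
  Blin (blinN_is_linear f) (@blinN_continuous f).

Fact blinD_is_linear f g : linear (fun x => f x + g x).
Proof. by move=> a x y; rewrite !linearP scalerDr addrACA. Qed.
Fact blinD_continuous f g : continuous (fun x => f x + g x).
Proof. by move=> x; apply: cvgD; exact: blin_continuous. Qed.
Definition blinD f g : blin V W :=
  Blin (blinD_is_linear f g) (@blinD_continuous f g).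

Fact blinZ_is_linear (a : R) f : linear (fun x => a *: f x).
Proof. by move=> b x y; rewrite linearP scalerDr !scalerA mulrC. Qed.
Fact blinZ_continuous (a : R) f : continuous (fun x => a *: f x).
Proof. by move=> x; apply: cvgZl_tmp; exact: blin_continuous. Qed.
Definition blinZ (a : R) f : blin V W :=
  Blin (blinZ_is_linear a f) (@blinZ_continuous a f).

Fact blinDA : associative blinD.
Proof. by move=> f g h; apply: blinP => x /=; rewrite addrA. Qed.
Fact blinDC : commutative blinD.
Proof. by move=> f g; apply: blinP => x /=; rewrite addrC. Qed.
Fact blin0D : left_id blin0 blinD.
Proof. by move=> f; apply: blinP => x /=; rewrite add0r. Qed.
Fact blinND : left_inverse blin0 blinN blinD.
Proof. by move=> f; apply: blinP => x /=; rewrite addNr. Qed.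

HB.instance Definition _ :=
  GRing.isZmodule.Build (blin V W) blinDA blinDC blin0D blinND.

Fact blinZA (a b : R) f : blinZ a (blinZ b f) = blinZ (a * b) f.
Proof. by apply: blinP => x /=; rewrite scalerA. Qed.
Fact blin1Z : left_id 1 blinZ.
Proof. by move=> f; apply: blinP => x /=; rewrite scale1r. Qed.
Fact blinZDr : right_distributive blinZ +%R.
Proof. by move=> a f g; apply: blinP => x /=; rewrite scalerDr. Qed.
Fact blinZDl f : {morph blinZ^~ f : a b / a + b}.
Proof. by move=> a b; apply: blinP => x /=; rewrite scalerDl. Qed.

HB.instance Definition _ :=
  GRing.Zmodule_isLmodule.Build R (blin V W) blinZA blin1Z blinZDr blinZDl.

Definition blin_norm f : R := sup [set `|f x| | x in [set x : V | `|x| <= 1]].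

Fact blin_norm_has_sup f : has_sup [set `|f x| | x in [set x : V | `|x| <= 1]].
Proof.
split; first by exists `|f 0|, 0 => //=; rewrite normr0.
have /linear_boundedP/pinfty_ex_gt0 [r r0 fr] : bounded_near f (nbhs 0).
  by apply: continuous_linear_bounded; exact: blin_continuous.
exists r => _ [x /= x1 <-].
by rewrite (le_trans (fr x))// ler_piMr// ltW.
Qed.

Fact blin_norm_ub f x : `|x| <= 1 -> `|f x| <= blin_norm f.
Proof.
move=> x1; apply: sup_upper_bound; first exact: blin_norm_has_sup.
by exists x.
Qed.

Fact blin_norm_ge0 f : 0 <= blin_norm f.
Proof. by rewrite (le_trans (normr_ge0 (f 0)))// blin_norm_ub// normr0. Qed.

Fact blin_norm_lub f (M : R) :
  (forall x, `|x| <= 1 -> `|f x| <= M) -> blin_norm f <= M.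
Proof.
move=> fM; apply: sup_le_ub; first by case: (blin_norm_has_sup f).
by move=> _ [x /= x1 <-]; exact: fM.
Qed.

Fact blin_normD f g : blin_norm (f + g) <= blin_norm f + blin_norm g.
Proof.
apply: blin_norm_lub => x x1.
by rewrite (le_trans (ler_normD _ _))// lerD// blin_norm_ub.
Qed.

Fact blin_normZ_le (a : R) f : blin_norm (a *: f) <= `|a| * blin_norm f.
Proof.
apply: blin_norm_lub => x x1.
by rewrite normrZ ler_wpM2l// blin_norm_ub.
Qed.

Fact blin_norm_eq0 f : blin_norm f = 0 -> f = 0.
Proof.
move=> f0; apply: blinP => x /=; have [->|x0] := eqVneq x 0.
  by rewrite linear0.
have : `|f (`|x|^-1 *: x)| <= 0.
  rewrite -f0 blin_norm_ub// normrZ normfV normr_id mulVf//.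
  by rewrite normr_eq0.
rewrite linearZ normr_le0 scaler_eq0 invr_eq0 normr_eq0 (negPf x0).
by move/eqP.
Qed.

Fact blin_normZ (a : R) f : blin_norm (a *: f) = `|a| * blin_norm f.
Proof.
apply/eqP; rewrite eq_le blin_normZ_le /=.
have [->|a0] := eqVneq a 0.
  by rewrite normr0 mul0r blin_norm_ge0.
rewrite -[f in leLHS]scale1r -(mulVf a0) -scalerA.
rewrite (le_trans (ler_wpM2l _ (blin_normZ_le _ _)))//.
by rewrite normfV mulVKf// normr_eq0.
Qed.

HB.instance Definition _ := Lmodule_isNormed.Build R (blin V W)
  blin_normD blin_normZ blin_norm_eq0.

End BoundedLinear.

(* Class C^n on the open set U, the Frechet derivative being seen as a map into
   L(V, W) with the operator norm. *)
Fixpoint is_Ck (R : realType) (V W : normedModType R) (n : nat) (U : set V)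
    (f : V -> W) {struct n} : Prop :=
  match n with
  | 0%N => forall x, U x -> {for x, continuous f}
  | n'.+1 => exists Df : V -> blin V W,
      (forall x, U x -> is_diff x f (Df x)) /\ is_Ck n' U Df
  end.

Definition is_Cinfty (R : realType) (V W : normedModType R) (U : set V)
  (f : V -> W) : Prop := forall n, is_Ck n U f.

Section Submanifolds.
Context {R : realType}.
Definition open_diffeo (E : normedModType R)
    (U U' : set E) (psi psi' : E -> E) : Prop :=
  [/\ open U, open U',
      forall x, U x -> U' (psi x) /\ psi' (psi x) = x,
      forall y, U' y -> U (psi' y) /\ psi (psi' y) = y &
      is_Cinfty U psi /\ is_Cinfty U' psi'].

Definition closed_subspace (E : normedModType R) (F : set E) : Prop :=
  [/\ F 0, forall (a : R) x y, F x -> F y -> F (a *: x + y) & closed F].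

Definition complemented_in (E : normedModType R) (T F : set E) : Prop :=
  [/\ closed_subspace F, F `<=` T &
      exists N : set E, [/\ closed_subspace N, N `<=` T, F `&` N = [set 0] &
        forall v, T v -> exists a b, [/\ F a, N b & v = a + b]]].

(* Embedded C^infty submanifold: near each point a chart of the ambient space
   straightens X onto a complemented closed subspace. *)
Definition is_submanifold (E : normedModType R) (X : set E) : Prop :=
  forall x, X x -> exists (U U' : set E) (psi psi' : E -> E) (F : set E),
    [/\ U x, open_diffeo U U' psi psi', complemented_in setT F &
        forall y, U y -> (X y <-> F (psi y))].

(* Maps between submanifolds are total functions on the ambient spaces, of
   which only the values on X matter.  They are smooth when they extend
   locally to smooth maps of the ambient spaces. *)
Definition is_smooth_map (E E' : normedModType R)
    (X : set E) (Y : set E') (f : E -> E') : Prop :=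
  (forall x, X x -> Y (f x)) /\
  forall x, X x -> exists (U : set E) (g : E -> E'),
    [/\ open U, U x, is_Cinfty U g & forall y, U y -> X y -> g y = f y].

Definition curve_through (E : normedModType R)
    (X : set E) (x : E) (c : R -> E) : Prop :=
  c 0 = x /\ exists I : set R,
    [/\ open I, I 0, is_Cinfty I c & forall t, I t -> X (c t)].

Definition tangent_space (E : normedModType R) (X : set E) (x : E) : set E :=
  [set v | exists c, curve_through X x c /\ is_derive (0 : R) (1 : R) c v].

(* The graph of the tangent map T_x f : T_x X -> T_(f x) Y, which sends c'(0)
   to (f \o c)'(0). *)
Definition tangent_map (E E' : normedModType R)
    (X : set E) (f : E -> E') (x v : E) (w : E') : Prop :=
  exists c, [/\ curve_through X x c, is_derive (0 : R) (1 : R) c v &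
    is_derive (0 : R) (1 : R) (f \o c) w].

Definition is_submersion (E E' : normedModType R)
    (X : set E) (Y : set E') (f : E -> E') : Prop :=
  [/\ is_submanifold X, is_submanifold Y, is_smooth_map X Y f &
      forall x, X x ->
        (forall w, tangent_space Y (f x) w -> exists v, tangent_map X f x v w) /\
        complemented_in (tangent_space X x) [set v | tangent_map X f x v 0]].

Definition is_diffeomorphism (E E' : normedModType R)
    (X : set E) (Y : set E') (f : E -> E') : Prop :=
  [/\ is_submanifold X, is_submanifold Y, is_smooth_map X Y f &
      exists g : E' -> E, [/\ is_smooth_map Y X g,
        forall x, X x -> g (f x) = x & forall y, Y y -> f (g y) = y]].

End Submanifolds.

(* The norm and its completeness are part of the mixin because
   Hierarchy Builder does not allow joining the normed modules of the library
   with noncommutative rings.  [GRing.UnitAlgebra] only adds notation for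
   inverses: its [GRing.unit] is exactly the set of two-sided invertible
   elements. *)
HB.mixin Record isCStarAlgebra (R : realType) A & GRing.UnitAlgebra R[i] A := {
  cnorm : A -> R ;
  star : A -> A ;
  cnormD : forall x y : A, cnorm (x + y) <= cnorm x + cnorm y ;
  cnormZ : forall (c : R[i]) (x : A),
    cnorm (c *: x) = ComplexField.Normc.normc c * cnorm x ;
  cnorm_eq0 : forall x : A, cnorm x = 0 -> x = 0 ;
  cnormM : forall x y : A, cnorm (x * y) <= cnorm x * cnorm y ;
  cnorm_complete : forall u : nat -> A,
    (forall e : R, 0 < e -> exists N, forall m n, (N <= m)%N -> (N <= n)%N ->
      cnorm (u m - u n) < e) ->
    exists l : A, forall e : R, 0 < e -> exists N, forall n, (N <= n)%N ->
      cnorm (u n - l) < e ;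
  starK : involutive star ;
  starD : forall x y : A, star (x + y) = star x + star y ;
  starZ : forall (c : R[i]) (x : A), star (c *: x) = conjc c *: star x ;
  starM : forall x y : A, star (x * y) = star y * star x ;
  cnorm_starM : forall x : A, cnorm (star x * x) = cnorm x ^+ 2
}.

#[short(type="cstarAlgType")]
HB.structure Definition CStarAlgebra (R : realType) :=
  {A of GRing.UnitAlgebra R[i] A & isCStarAlgebra R A}.

Arguments cnorm {R A} x : rename.
Arguments star {R A} x : rename.

(* A and A^(m x n) as real normed spaces.  Only the topology of the latter
   matters for smoothness: the maximum norm is equivalent to the Hilbert module
   norm of A^2 and to the C*-norm of M_2(A). *)
Definition realify (R : realType) (A : cstarAlgType R) : Type := A.
Definition mx_realify (R : realType) (A : cstarAlgType R) (m n : nat) : Type :=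
  'M[A]_(m, n).

Section Realification.
Context {R : realType} (A : cstarAlgType R) (m n : nat).
Implicit Types M N : mx_realify A m n.

Fact normc_real (a : R) : ComplexField.Normc.normc (a%:C)%C = `|a|.
Proof. by rewrite /ComplexField.Normc.normc /= expr0n /= addr0 sqrtr_sqr. Qed.

HB.instance Definition _ := GRing.Zmodule.copy (realify A) A.

Definition rscale (a : R) (x : realify A) : realify A := (a%:C)%C *: (x : A).

Fact rscaleA (a b : R) x : rscale a (rscale b x) = rscale (a * b) x.
Proof. by rewrite /rscale scalerA rmorphM. Qed.
Fact rscale1 : left_id 1 rscale.
Proof. by move=> x; rewrite /rscale rmorph1 scale1r. Qed.
Fact rscaleDr : right_distributive rscale +%R.
Proof. by move=> a x y; rewrite /rscale scalerDr. Qed.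
Fact rscaleDl x : {morph rscale^~ x : a b / a + b}.
Proof. by move=> a b; rewrite /rscale rmorphD scalerDl. Qed.

HB.instance Definition _ := GRing.Zmodule_isLmodule.Build R (realify A)
  rscaleA rscale1 rscaleDr rscaleDl.

Fact rnormZ (a : R) (x : realify A) : cnorm (a *: x : A) = `|a| * cnorm (x : A).
Proof. by rewrite [LHS]cnormZ normc_real. Qed.

HB.instance Definition _ := Lmodule_isNormed.Build R (realify A)
  (@cnormD R A) rnormZ (@cnorm_eq0 R A).

HB.instance Definition _ :=
  GRing.Zmodule.copy (mx_realify A m n) 'M[A]_(m, n).

Definition mx_rscale (a : R) (M : mx_realify A m n) : mx_realify A m n :=
  \matrix_(i, j) ((a%:C)%C *: M i j).

Fact mx_rscaleA (a b : R) M :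
  mx_rscale a (mx_rscale b M) = mx_rscale (a * b) M.
Proof. by apply/matrixP => i j; rewrite !mxE scalerA rmorphM. Qed.
Fact mx_rscale1 : left_id 1 mx_rscale.
Proof. by move=> M; apply/matrixP => i j; rewrite !mxE rmorph1 scale1r. Qed.
Fact mx_rscaleDr : right_distributive mx_rscale +%R.
Proof. by move=> a M N; apply/matrixP => i j; rewrite !mxE scalerDr. Qed.
Fact mx_rscaleDl M : {morph mx_rscale^~ M : a b / a + b}.
Proof. by move=> a b; apply/matrixP => i j; rewrite !mxE rmorphD scalerDl. Qed.

HB.instance Definition _ := GRing.Zmodule_isLmodule.Build R (mx_realify A m n)
  mx_rscaleA mx_rscale1 mx_rscaleDr mx_rscaleDl.

Definition mx_rnorm (M : mx_realify A m n) : R :=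
  \big[Num.max/0]_(ij : 'I_m * 'I_n) cnorm (M ij.1 ij.2).

Fact cnorm_ge0 (x : A) : 0 <= cnorm x.
Proof. exact: (normr_ge0 (x : realify A)). Qed.

Fact mx_rnorm_ge0 M : 0 <= mx_rnorm M.
Proof.
by rewrite /mx_rnorm; elim/big_rec: _ => // i x _ x0; rewrite le_max x0 orbT.
Qed.

Fact le_mx_rnorm M i j : cnorm (M i j) <= mx_rnorm M.
Proof. exact: (le_bigmax 0 (fun ij => cnorm (M ij.1 ij.2)) (i, j)). Qed.

Fact mx_rnorm_le M (r : R) : 0 <= r ->
  (forall i j, cnorm (M i j) <= r) -> mx_rnorm M <= r.
Proof. by move=> r0 Mr; apply/bigmax_leP; split=> // -[i j] _; exact: Mr. Qed.

Fact mx_rnormD M N : mx_rnorm (M + N) <= mx_rnorm M + mx_rnorm N.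
Proof.
apply: mx_rnorm_le => [|i j]; first by rewrite addr_ge0 ?mx_rnorm_ge0.
by rewrite mxE (le_trans (cnormD _ _))// lerD// le_mx_rnorm.
Qed.

Fact mx_rnormZ_le (a : R) M : mx_rnorm (a *: M) <= `|a| * mx_rnorm M.
Proof.
apply: mx_rnorm_le => [|i j]; first by rewrite mulr_ge0 ?mx_rnorm_ge0.
by rewrite mxE cnormZ normc_real ler_wpM2l// le_mx_rnorm.
Qed.

Fact mx_rnormZ (a : R) M : mx_rnorm (a *: M) = `|a| * mx_rnorm M.
Proof.
apply/eqP; rewrite eq_le mx_rnormZ_le /=.
have [->|a0] := eqVneq a 0; first by rewrite normr0 mul0r mx_rnorm_ge0.
rewrite -[M in leLHS]scale1r -(mulVf a0) -scalerA.
rewrite (le_trans (ler_wpM2l _ (mx_rnormZ_le _ _)))//.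
by rewrite normfV mulVKf// normr_eq0.
Qed.

Fact mx_rnorm_eq0 M : mx_rnorm M = 0 -> M = 0.
Proof.
move=> M0; apply/matrixP => i j; rewrite mxE; apply: cnorm_eq0.
by apply/eqP; rewrite eq_le cnorm_ge0 -M0 le_mx_rnorm.
Qed.

HB.instance Definition _ := Lmodule_isNormed.Build R (mx_realify A m n)
  mx_rnormD mx_rnormZ mx_rnorm_eq0.

End Realification.

Section Diagram.
Context {R : realType} {A : cstarAlgType R}.
Implicit Types (x y : 'cV[A]_2) (a b g h eps : 'M[A]_2) (z : A).

Definition mx_star m n (M : 'M[A]_(m, n)) : 'M[A]_(n, m) :=
  \matrix_(i, j) star (M j i).

Definition mx_inverse a b : Prop := a *m b = 1%:M /\ b *m a = 1%:M.

Definition Gl2 : set 'M[A]_2 := [set a | exists b, mx_inverse a b].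

(* Only commutative entries give the library's inverse of matrices; the value
   is 0 when a is not invertible. *)
Definition inv2 a : 'M[A]_2 := xget 0 [set b | mx_inverse a b].

Definition spectrum2 a : set R[i] := [set c | ~ Gl2 (a - (c%:A)%:M)].

(* In R[i], 0 <= c means that c is real and nonnegative. *)
Definition positive2 a : Prop :=
  mx_star a = a /\ forall c, spectrum2 a c -> 0 <= c.

Definition Gl2_pos : set 'M[A]_2 := [set a | Gl2 a /\ positive2 a].

Definition rhoD : 'M[A]_2 := \matrix_(i, j) ((-1) ^+ i *+ (i == j)).

Definition thetaD x y : A :=
  star (x 0 0) * y 0 0 - star (x 1 0) * y 1 0.

Definition UthetaD : set 'M[A]_2 :=
  [set g | Gl2 g /\ forall x y, thetaD (g *m x) (g *m y) = thetaD x y].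

Definition disk : set A := [set z | cnorm z < 1].

Definition KD : set 'cV[A]_2 :=
  [set x | thetaD x x = 1 /\ x 0 0 \is a GRing.unit].

Definition QrhoD : set 'M[A]_2 :=
  [set eps | eps *m eps = 1%:M /\ Gl2_pos (rhoD *m eps)].

Definition proj x : 'M[A]_2 := x *m mx_star x *m rhoD.

Definition phi_hat x : A := x 1 0 * (x 0 0)^-1.

Definition phi_tilde x : 'M[A]_2 := proj x *+ 2 - 1%:M.

(* x is chosen in the fibre of phi_hat over z; the default 0 is used only when
   this fibre is empty, which does not happen on the disk. *)
Definition PhiD z : 'M[A]_2 :=
  phi_tilde (xget 0 [set x | KD x /\ phi_hat x = z]).

Definition mobius g z : A :=
  (g 1 0 + g 1 1 * z) * (g 0 0 + g 0 1 * z)^-1.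

Definition conj2 g eps : 'M[A]_2 := g *m eps *m inv2 g.

End Diagram.

(* Main.v *)
From HB Require Import structures.
Require Import Defs.
From Stdlib Require Import -(notations,coercions) Ncring Ncring_tac.
From mathcomp Require Import all_boot all_order all_algebra.
From mathcomp Require Import complex.
From mathcomp Require Import all_classical all_reals.
From mathcomp Require Import topology normedtype landau derive.
From mathcomp Require Import ring lra.

Set Implicit Arguments.
Unset Strict Implicit.
Unset Printing Implicit Defensive.
Import Order.TTheory GRing.Theory Num.Theory.
Import numFieldNormedType.Exports.
Local Open Scope classical_set_scope.
Local Open Scope ring_scope.

(** The fibre of [phi_hat] and of [phi_tilde] through [x] is [x] times the unitary
    group, so both maps have the same vertical tangent space [{x k | k^* = - k}],
    complemented in [T_x K = {v | Re theta(x, v) = 0}] by [{v | theta(x, v) = 0}];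
    tangent vectors lift explicitly.  [K] and [Q] are straightened by charts that
    are rational in the entries and their adjoints, so that smoothness reduces to
    that of products and inverses.  The point where C*-algebra theory enters is the
    description of [Q]: the spectral positivity of [rhoD eps] is turned into
    positivity of an [A]-valued quadratic form, whose diagonal entries and Schur
    complement are then bounded below.  This rests on the positivity of [y^* y],
    obtained from norm estimates and convergent iterations (inverse, square root)
    alone. *)

(** A section of [phi_hat] needs the square root of [1 - z^* z], whose smooth dependence on [z]
    would require functional calculus. That root is used only pointwise, to show that the fibres are
    nonempty; everything smooth goes through [disk_param], where only the inverse of [1 - z^* z]
    occurs. In the same spirit no inverse or implicit function theorem is invoked: each chart, and
    [PhiD] itself, comes with an explicit inverse, [disk_coord] in the case of [PhiD]. Tangent
    vectors are velocities of curves, so the two inclusions describing a tangent space differ in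
    cost. Differentiating the defining equations gives the easy one. The other is proved for [K]
    only, by an explicit curve; for [Q] the necessary linear conditions suffice, since each solution
    is hit by the derivative of [phi_tilde]. [M_2(A)] carries the maximum norm, which is not a
    C*-norm, so the norm criteria for positivity in [A] do not apply to it; hence the passage
    through forms with values in [A]. *)

#[local] Instance nc_ops (A : nzRingType) :
  @Ring_ops A 0 1 +%R *%R (fun x y => x - y) -%R eq := {}.
#[local] Instance nc_ring (A : nzRingType) : Ring (Ro := nc_ops A).
Proof.
constructor; try exact _; try (cbv; congruence).
all: rewrite /equality /addition /add_notation /multiplication /mul_notation
  /subtraction /sub_notation /opposite /opp_notation /zero /zero_notation
  /one /one_notation /eq_notation /=.
all: move=> *; rewrite ?(add0r,addrA,mul1r,mulr1,mulrDl,mulrDr,mulrA,subrr)//.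
by rewrite addrC.
Qed.

Definition rsc (R : realType) (A : cstarAlgType R) (t : R) : A := (t%:C)%C%:A.
Arguments rsc {R A} t.
Local Notation "t %:S" := (rsc t) (at level 1, format "t %:S").

(** * Norm, adjoint and scalars in a C*-algebra; inverses and square roots by iteration *)

Section CStar.
Context {R : realType} {A : cstarAlgType R}.
Implicit Types (x y z a b c : A) (t s d e : R) (u v : nat -> A).

Lemma cnorm0 : cnorm (0 : A) = 0.
Proof. exact: (@normr0 _ (realify A)). Qed.
Lemma cnormN x : cnorm (- x) = cnorm x.
Proof. exact: (@normrN _ (realify A)). Qed.
Lemma cnormB x y : cnorm (x - y) = cnorm (y - x).
Proof. by rewrite -cnormN opprB. Qed.

Lemma star0 : star (0 : A) = 0.
Proof. by apply: (addrI (star 0)); rewrite -starD !addr0. Qed.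
Lemma starN x : star (- x) = - star x.
Proof. by apply/eqP; rewrite -addr_eq0 -starD addNr star0. Qed.
Lemma starB x y : star (x - y) = star x - star y.
Proof. by rewrite starD starN. Qed.
Lemma star1 : star (1 : A) = 1.
Proof. by rewrite -[LHS]mulr1 -{2}(starK 1) -starM mulr1 starK. Qed.
Lemma star_unit x : x \is a GRing.unit -> star x \is a GRing.unit.
Proof.
by move=> xu; apply/unitrP; exists (star x^-1);
  rewrite -!starM divrr ?mulVr// star1.
Qed.
Lemma starV x : x \is a GRing.unit -> star x^-1 = (star x)^-1.
Proof.
move=> xu; apply: (mulrI (star_unit xu)).
by rewrite -starM mulVr// star1 divrr// star_unit.
Qed.

Lemma cnorm_star x : cnorm (star x) = cnorm x.
Proof.
have le y : cnorm y <= cnorm (star y).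
  have [->|y0] := eqVneq (cnorm y) 0; first exact: cnorm_ge0.
  have yp : 0 < cnorm y by rewrite lt_def y0 cnorm_ge0.
  by rewrite -(ler_pM2r yp) -expr2 -cnorm_starM cnormM.
by apply/eqP; rewrite eq_le le -{2}[x]starK le.
Qed.

Lemma cnorm1 : cnorm (1 : A) = 1.
Proof.
have n0 : cnorm (1 : A) != 0.
  by apply/eqP => /cnorm_eq0/eqP; rewrite oner_eq0.
apply: (mulIf n0); rewrite mul1r -expr2 -cnorm_starM star1 mulr1 //.
Qed.

Lemma cnorm_sa x : star x = x -> cnorm (x * x) = cnorm x ^+ 2.
Proof. by move=> xs; rewrite -cnorm_starM xs. Qed.

Lemma rscE t x : t%:S * x = (t%:C)%C *: x.
Proof. by rewrite /rsc -scalerAl mul1r. Qed.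
Lemma rscC t x : x * t%:S = t%:S * x.
Proof. by rewrite rscE /rsc -scalerAr mulr1. Qed.
Lemma rscD t s : (t + s)%:S = t%:S + s%:S :> A.
Proof. by rewrite /rsc rmorphD scalerDl. Qed.
Lemma rscN t : (- t)%:S = - t%:S :> A.
Proof. by rewrite /rsc rmorphN scaleNr. Qed.
Lemma rscB t s : (t - s)%:S = t%:S - s%:S :> A.
Proof. by rewrite rscD rscN. Qed.
Lemma rscM t s : (t * s)%:S = t%:S * s%:S :> A.
Proof. by rewrite rscE /rsc rmorphM scalerA. Qed.
Lemma rsc0 : 0%:S = 0 :> A.
Proof. by rewrite /rsc rmorph0 scale0r. Qed.
Lemma rsc1 : 1%:S = 1 :> A.
Proof. by rewrite /rsc rmorph1 scale1r. Qed.
Lemma rscV t : t != 0 -> t%:S * (t^-1)%:S = 1 :> A.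
Proof. by move=> t0; rewrite -rscM divff// rsc1. Qed.
Lemma star_rsc t : star t%:S = t%:S :> A.
Proof. by rewrite /rsc starZ star1 conjc_real. Qed.
Lemma cnorm_rscM t x : cnorm (t%:S * x) = `|t| * cnorm x.
Proof. by rewrite rscE cnormZ normc_real. Qed.
Lemma cnorm_rsc t : cnorm (t%:S : A) = `|t|.
Proof. by rewrite -[t%:S]mulr1 cnorm_rscM cnorm1 mulr1. Qed.
Lemma rsc_unit t : t != 0 -> (t%:S : A) \is a GRing.unit.
Proof.
move=> t0; apply/unitrP; exists (t^-1)%:S.
by rewrite -!rscM mulVf// divff// rsc1.
Qed.

Definition im1 : A := 'i%C%:A.
Lemma im1C x : x * im1 = im1 * x.
Proof. by rewrite /im1 -scalerAl -scalerAr mulr1 mul1r. Qed.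
Lemma im1_sqr : im1 * im1 = - 1.
Proof.
rewrite /im1 -scalerAl mul1r scalerA.
have -> : 'i%C * 'i%C = - 1 :> R[i] by rewrite -expr2 sqr_i.
by rewrite scaleN1r.
Qed.
Lemma star_im1 : star im1 = - im1.
Proof.
rewrite /im1 starZ star1 -scaleNr; congr (_ *: _).
by apply/eqP; rewrite eq_complex /= oppr0 !eqxx.
Qed.

Definition clim u x :=
  forall e, 0 < e -> exists N, forall n, (N <= n)%N -> cnorm (u n - x) < e.

Lemma clim_cst x : clim (fun=> x) x.
Proof. by move=> e e0; exists 0%N => n _; rewrite subrr cnorm0. Qed.

Lemma climS u x : clim u x -> clim (fun n => u n.+1) x.
Proof. by move=> ux e /ux[N Nu]; exists N => n /leqW; exact: Nu. Qed.

Lemma climD u v x y : clim u x -> clim v y -> clim (fun n => u n + v n) (x + y).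
Proof.
move=> ux vy e e0; have e2 : 0 < e / 2 by rewrite divr_gt0.
have [N Nu] := ux _ e2; have [M Mv] := vy _ e2; exists (maxn N M) => n.
rewrite geq_max => /andP[/Nu un /Mv vn].
rewrite opprD addrACA (le_lt_trans (cnormD _ _))//; lra.
Qed.

Lemma clim_star u x : clim u x -> clim (fun n => star (u n)) (star x).
Proof.
by move=> ux e /ux[N Nu]; exists N => n /Nu; rewrite -starB cnorm_star.
Qed.

Lemma climMl x u y : clim u y -> clim (fun n => x * u n) (x * y).
Proof.
move=> uy e e0; have M0 : 0 < cnorm x + 1 by rewrite ltr_wpDl// cnorm_ge0.
have [N Nu] := uy _ (divr_gt0 e0 M0); exists N => n /Nu.
rewrite ltr_pdivlMr// => /le_lt_trans; apply; rewrite -mulrBr.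
rewrite (le_trans (cnormM _ _))// mulrC ler_wpM2l ?cnorm_ge0//; lra.
Qed.

Lemma climMr x u y : clim u y -> clim (fun n => u n * x) (y * x).
Proof.
move=> /clim_star/(climMl (star x))/clim_star uy e /uy[N Nu].
by exists N => n /Nu; rewrite !starM !starK.
Qed.

Lemma clim_eq u x y : clim u x -> clim u y -> x = y.
Proof.
move=> ux uy; apply/eqP; rewrite -subr_eq0; apply/eqP/cnorm_eq0/eqP.
apply: contraT => n0; have n1 : 0 < cnorm (x - y) by rewrite lt_def n0 cnorm_ge0.
have n2 : 0 < cnorm (x - y) / 2 by rewrite divr_gt0.
have [N Nu] := ux _ n2; have [M Mv] := uy _ n2.
have /Nu := leq_maxl N M; have /Mv := leq_maxr N M.
have := cnormD (x - u (maxn N M)) (u (maxn N M) - y).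
rewrite addrA subrK (cnormB x); lra.
Qed.

(** The method of majorants: [s] is nondecreasing and bounded, so its tails, which dominate those of
    [u], are small once [s] is near its supremum. The limit of [s] need not be known. *)
Lemma majorant_cvg u (s : nat -> R) M : (forall n, s n <= M) ->
  (forall n, cnorm (u n.+1 - u n) <= s n.+1 - s n) -> exists x, clim u x.
Proof.
move=> sM us.
have tel m k : cnorm (u (m + k)%N - u m) <= s (m + k)%N - s m.
  elim: k => [|k IH]; first by rewrite addn0 !subrr cnorm0.
  rewrite addnS; have := us (m + k)%N.
  have := cnormD (u (m + k).+1 - u (m + k)%N) (u (m + k)%N - u m).
  rewrite addrA subrK; lra.
have smon m n : (m <= n)%N -> s m <= s n.
  move=> /subnKC <-; have := tel m (n - m)%N.
  have := cnorm_ge0 (u (m + (n - m))%N - u m); lra.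
have hs : has_sup (range s).
  by split; [exists (s 0%N), 0%N | exists M => _ [n _ <-]].
apply: cnorm_complete => e e0.
have [_ [N _ <-] sN] := sup_adherent e0 hs.
exists N => m n Nm Nn.
wlog mn : m n Nm Nn / (m <= n)%N.
  move=> H; have [|/ltnW] := leqP m n; first exact: H.
  by rewrite cnormB; exact: H.
have := tel m (n - m)%N; rewrite subnKC// cnormB.
have := smon _ _ Nm.
have : s n <= sup (range s) by apply: sup_upper_bound => //; exists n.
lra.
Qed.

(** The iteration [l -> 1 + a l] produces the partial sums of the Neumann series, majorized by those
    of the geometric series. Its limit is a right inverse, and a left one because it commutes with
    [a]. *)
Lemma neumann a : cnorm a < 1 -> 1 - a \is a GRing.unit.
Proof.
move=> a1; pose u := fix u n := if n is n'.+1 then 1 + a * u n' else 0.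
set r := cnorm a in a1; have r0 : 0 <= r := cnorm_ge0 _.
have r1 : 0 < 1 - r by lra.
pose s n := (1 - r ^+ n) / (1 - r).
have sM n : s n <= (1 - r)^-1.
  by rewrite ler_pdivrMr// mulVf ?gt_eqF// gerBl exprn_ge0.
have us n : cnorm (u n.+1 - u n) <= s n.+1 - s n.
  have -> : s n.+1 - s n = r ^+ n.
    rewrite -mulrBl exprS; apply: (mulIf (lt0r_neq0 r1)).
    rewrite divfK ?gt_eqF//; lra.
  elim: n => [|n IH]; first by rewrite /= mulr0 addr0 subr0 cnorm1 expr0.
  have -> : u n.+2 - u n.+1 = a * (u n.+1 - u n).
    by rewrite /=; non_commutative_ring.
  by rewrite (le_trans (cnormM _ _))// exprS ler_wpM2l.
have [l ul] := majorant_cvg sM us.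
have al : a * l = l * a.
  apply: clim_eq (climMl a ul) _; have := climMr a ul.
  suff /funext -> : (fun n => u n * a) =1 (fun n => a * u n) by [].
  elim=> [|n IH] /=; first by rewrite mul0r mulr0.
  by rewrite mulrDl mulrDr mul1r mulr1 -mulrA IH.
have le : l = 1 + a * l.
  exact: clim_eq (climS ul) (climD (clim_cst 1) (climMl a ul)).
apply/unitrP; exists l; rewrite mulrBr mulrBl mulr1 mul1r -al.
by rewrite {1 3}le addrK.
Qed.

Lemma unit_near a b : a \is a GRing.unit ->
  cnorm (b - a) * cnorm a^-1 < 1 -> b \is a GRing.unit.
Proof.
move=> au ba; have -> : b = (1 - (a - b) * a^-1) * a.
  by rewrite mulrBl mul1r mulrVK// opprB addrC subrK.
rewrite unitrMl// neumann// (le_lt_trans (cnormM _ _))//.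
by rewrite cnormB.
Qed.

(** With [y = 1 - l] the equation becomes the fixed point problem [l = (a + l^2) / 2], iterated from
    0. Replacing norms by their bounds gives the scalar iteration [s -> (1 + s^2) / 2], which stays
    below 1, so that [cnorm a = 1] is allowed. The last two clauses stand in for functional
    calculus: commutation passes to the limit, and the norm bound will give [y] a square root in
    turn. *)
Lemma sqrt_sub1 a : star a = a -> cnorm a <= 1 -> exists y,
  [/\ star y = y, y * y = 1 - a, cnorm (1 - y) <= 1 &
      forall x, x * a = a * x -> x * y = y * x].
Proof.
move=> asa a1.
pose u := fix u n := if n is n'.+1 then (2^-1)%:S * (a + u n' * u n') else 0.
pose s := fix s n : R := if n is n'.+1 then 2^-1 * (1 + s n' * s n') else 0.
have s01 n : 0 <= s n <= 1.
  elim: n => [|n /andP[s0 s1]] /=; first by rewrite lexx ler01.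
  apply/andP; split; nra.
have ns n : cnorm (u n) <= s n.
  elim: n => [|n IH] /=; first by rewrite cnorm0.
  rewrite cnorm_rscM ger0_norm ?invr_ge0// ler_wpM2l ?invr_ge0//.
  rewrite (le_trans (cnormD _ _))// lerD// (le_trans (cnormM _ _))//.
  by rewrite ler_pM ?cnorm_ge0.
have us n : cnorm (u n.+1 - u n) <= s n.+1 - s n.
  elim: n => [|n IH].
    by have := ns 1%N; rewrite /= !subr0.
  (* The difference of two squares is written [v (v - w) + (v - w) w], which requires no commutation
     and has the same scalar majorant. *)
  have -> : u n.+2 - u n.+1 =
      (2^-1)%:S * (u n.+1 * (u n.+1 - u n) + (u n.+1 - u n) * u n).
    rewrite -/(u n.+1) [u n.+2]/= -/(u n.+1).
    move: (u n.+1) (erefl : u n.+1 = (2^-1)%:S * (a + u n * u n)) => v vE.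
    by rewrite {3}vE; non_commutative_ring.
  rewrite cnorm_rscM ger0_norm ?invr_ge0//.
  have -> : s n.+2 - s n.+1 = 2^-1 * ((s n.+1 + s n) * (s n.+1 - s n)).
    move: (erefl : s n.+1 = 2^-1 * (1 + s n * s n)).
    move: (erefl : s n.+2 = 2^-1 * (1 + s n.+1 * s n.+1)).
    move: (s n) (s n.+1) (s n.+2) => p q r rE qE; lra.
  rewrite ler_wpM2l ?invr_ge0// (le_trans (cnormD _ _))//.
  rewrite (le_trans (lerD (cnormM _ _) (cnormM _ _)))//.
  have := ns n.+1; have := ns n; have := cnorm_ge0 (u n.+1 - u n).
  have := cnorm_ge0 (u n); have := cnorm_ge0 (u n.+1).
  move: IH; set p := cnorm (_ - _); set q := cnorm (u n.+1).
  set p' := cnorm (u n); set s1 := s n.+1; set s0 := s n; nra.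
have [l ul] : exists l, clim u l.
  by apply: (majorant_cvg _ us (M := 1)) => n; case/andP: (s01 n).
have ls : star l = l.
  apply: (clim_eq _ ul); have := clim_star ul.
  suff /funext -> : (fun n => star (u n)) =1 u by [].
  elim=> [|n IH] /=; first by rewrite star0.
  by rewrite starM star_rsc rscC starD asa starM IH.
have uc x : x * a = a * x -> forall n, x * u n = u n * x.
  move=> xa; elim=> [|n IH] /=; first by rewrite mul0r mulr0.
  rewrite mulrA rscC -!mulrA; congr (_ * _).
  by rewrite mulrDr mulrDl xa mulrA IH -mulrA IH mulrA.
have lc x : x * a = a * x -> x * l = l * x.
  move=> xa; apply: clim_eq (climMl x ul) _; have := climMr x ul.
  by rewrite (funext (uc x xa)).
have lu n : l * u n = u n * l.
  apply: uc; symmetry; exact: lc.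
have l1 : cnorm l <= 1.
  rewrite leNgt; apply/negP; rewrite -subr_gt0 => /ul[N /(_ _ (leqnn N))].
  have := ns N; have := s01 N; have := cnormD (l - u N) (u N).
  rewrite subrK cnormB; lra.
have sq : clim (fun n => u n * u n) (l * l).
  move=> e e0; have e2 : 0 < e / 2 by rewrite divr_gt0.
  have [N Nu] := ul _ e2; exists N => n /Nu un.
  have -> : u n * u n - l * l = (u n - l) * u n + l * (u n - l).
    by non_commutative_ring.
  rewrite (le_lt_trans (cnormD _ _))//.
  rewrite (le_lt_trans (lerD (cnormM _ _) (cnormM _ _)))//.
  have := ns n; have := s01 n; have := cnorm_ge0 (u n).
  have := cnorm_ge0 l; have := cnorm_ge0 (u n - l); nra.
have le : l = (2^-1)%:S * (a + l * l).
  by apply: clim_eq (climS ul) (climMl _ (climD (clim_cst a) sq)).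
have le2 : l + l = a + l * l.
  rewrite {1 2}le -mulrDl -rscD; suff -> : 2^-1 + 2^-1 = 1 :> R.
    by rewrite rsc1 mul1r.
  lra.
exists (1 - l); split.
- by rewrite starB star1 ls.
- have -> : (1 - l) * (1 - l) = 1 - (l + l) + l * l by non_commutative_ring.
  by rewrite le2; non_commutative_ring.
- by rewrite opprB addrC subrK.
- by move=> x /lc xl; rewrite mulrBr mulrBl mulr1 mul1r xl.
Qed.

End CStar.

(** * The cone of squares of self-adjoint elements *)

Section Positivity.
Context {R : realType} {A : cstarAlgType R}.
Implicit Types (x y z a b c w : A) (t s d e : R).

(* Squares of self-adjoint elements.  Since these are exactly the self-adjoint [a]
   with [|t - a| <= t] for some (equivalently every large) [t], they form a closed
   convex cone; no spectral theory of [A] is needed. *)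
Definition pos a := exists2 c, star c = c & a = c * c.

Lemma pos_sa a : pos a -> star a = a.
Proof. by case=> c cs ->; rewrite starM cs. Qed.

Lemma pos_sqr c : star c = c -> pos (c * c).
Proof. by exists c. Qed.

(* [b + i w] is a multiple of a unitary element, so its real part is bounded. *)
Lemma cnorm_circle b w t : 0 <= t -> star b = b -> star w = w -> b * w = w * b ->
  b * b + w * w = t%:S -> cnorm b ^+ 2 <= t.
Proof.
move=> t0 bs ws bw bwt; pose j : A := im1.
pose u := b + j * w.
have us : star u = b - j * w.
  by rewrite /u starD bs starM ws star_im1 mulrN im1C.
have uu : star u * u = t%:S.
  have -> : star u * u = b * b + (b * j * w - j * w * b) - j * (w * j) * w.
    by rewrite us /u; non_commutative_ring.
  by rewrite !im1C -[j * b * w]mulrA bw !mulrA subrr addr0 im1_sqr mulN1r mulNr opprK.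
have := cnormD u (star u); rewrite cnorm_star.
have -> : u + star u = 2%:S * b.
  by rewrite us /u [2]mulr2n rscD rsc1; non_commutative_ring.
rewrite cnorm_rscM ger0_norm//.
have := cnorm_starM u; rewrite uu cnorm_rsc ger0_norm// => ->.
have := cnorm_ge0 b; have := cnorm_ge0 u; nra.
Qed.

(** With [w] the root of [1 - b^2], the element [b + i w] is unitary; [cnorm_circle] is applied with
    the roles of [b] and [w] exchanged. *)
Lemma cnorm_sub1_sqr b : star b = b -> cnorm b <= 1 -> cnorm (1 - b * b) <= 1.
Proof.
move=> bs b1.
have [||w [ws ww _ wc]] := @sqrt_sub1 _ _ (b * b).
- by rewrite starM bs.
- by rewrite cnorm_sa// expr_le1// cnorm_ge0.
rewrite -ww cnorm_sa//; apply: (@cnorm_circle w b) => //.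
- by rewrite -wc// mulrA.
- by rewrite ww rsc1 subrK.
Qed.

(** Dividing [c] by the root of [t] brings the claim to [cnorm_sub1_sqr]. Together with
    [sqrt_of_norm] this is the norm test for positivity. *)
Lemma pos_norm a t : pos a -> cnorm a <= t -> cnorm (t%:S - a) <= t.
Proof.
case=> c cs ->{a} ct.
have t0 : 0 <= t := le_trans (cnorm_ge0 _) ct.
have [t00|tn0] := eqVneq t 0.
  by rewrite t00 rsc0 sub0r cnormN -t00.
have tp : 0 < t by rewrite lt_def tn0.
pose r := Num.sqrt t; have rr : r * r = t by rewrite -expr2 sqr_sqrtr.
have r0 : r != 0 by rewrite sqrtr_eq0 -ltNge.
pose b := (r^-1)%:S * c.
have bs : star b = b by rewrite starM cs star_rsc rscC.
have bc : c = r%:S * b by rewrite /b mulrA rscV// mul1r.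
clearbody b; have cc : c * c = t%:S * (b * b).
  rewrite bc -rr rscM -!mulrA; congr (_ * _).
  by rewrite [LHS]mulrA rscC mulrA.
have b1 : cnorm b <= 1.
  rewrite -(@expr_le1 _ 2) ?cnorm_ge0// -cnorm_sa//.
  by move: ct; rewrite cc cnorm_rscM ger0_norm// ger_pMr.
rewrite cc -{1}[t%:S]mulr1 -mulrBr cnorm_rscM ger0_norm// ger_pMr//.
exact: cnorm_sub1_sqr.
Qed.

(** Since [a = t (1 - b)] with [b = (t - a) / t] of norm at most 1, a root of [a] is the root of [t]
    times that of [1 - b]. *)
Lemma sqrt_of_norm a t : star a = a -> cnorm (t%:S - a) <= t ->
  exists c, [/\ star c = c, c * c = a & forall x, x * a = a * x -> x * c = c * x].
Proof.
move=> asa ct; have t0 : 0 <= t := le_trans (cnorm_ge0 _) ct.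
have [t00|tn0] := eqVneq t 0.
  have a0 : a = 0.
    apply: cnorm_eq0; apply/eqP; rewrite eq_le cnorm_ge0 andbT.
    by move: ct; rewrite t00 rsc0 sub0r cnormN.
  by exists 0; split; rewrite ?star0 ?mul0r// => x _; rewrite mulr0 mul0r.
have tp : 0 < t by rewrite lt_def tn0.
pose b := (t^-1)%:S * (t%:S - a).
have bE : 1 - b = (t^-1)%:S * a.
  by rewrite /b mulrBr -rscM mulVf// rsc1; non_commutative_ring.
have [||y [ys yy _ yc]] := @sqrt_sub1 _ _ b.
- by rewrite starM star_rsc starB star_rsc asa rscC.
- by rewrite cnorm_rscM ger0_norm ?invr_ge0// mulrC ler_pdivrMr// mul1r.
pose r := Num.sqrt t; have rr : r * r = t by rewrite -expr2 sqr_sqrtr.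
exists (r%:S * y); split.
- by rewrite starM ys star_rsc rscC.
- rewrite -mulrA [y * _]mulrA rscC !mulrA -rscM rr -mulrA yy bE mulrA.
  by rewrite rscV// mul1r.
- move=> x xa; rewrite mulrA rscC -!mulrA; congr (_ * _); apply: yc.
  have -> : b = 1 - (t^-1)%:S * a by rewrite -bE opprB addrC subrK.
  by rewrite mulrBr mulrBl mulr1 mul1r mulrA rscC -!mulrA xa.
Qed.

Lemma pos_of_norm a t : star a = a -> cnorm (t%:S - a) <= t -> pos a.
Proof. by move=> asa /(sqrt_of_norm asa)[c [cs <- _]]; exact: pos_sqr. Qed.

Lemma pos_sqrt a : pos a ->
  exists c, [/\ star c = c, c * c = a & forall x, x * a = a * x -> x * c = c * x].
Proof.
by move=> pa; apply: (sqrt_of_norm (pos_sa pa) (pos_norm pa (lexx _))).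
Qed.

(** A sum of squares is not visibly a square; the norm test with radius [cnorm a + cnorm b] reduces
    the claim to the triangle inequality. *)
Lemma posD a b : pos a -> pos b -> pos (a + b).
Proof.
move=> pa pb; apply: (@pos_of_norm _ (cnorm a + cnorm b)).
  by rewrite starD !pos_sa.
rewrite rscD opprD addrACA (le_trans (cnormD _ _))//.
by rewrite lerD// pos_norm.
Qed.

Lemma pos_rsc t : 0 <= t -> pos t%:S.
Proof.
move=> t0; apply: (@pos_of_norm _ t); first exact: star_rsc.
by rewrite subrr cnorm0.
Qed.

Lemma pos_rscM t a : 0 <= t -> pos a -> pos (t%:S * a).
Proof.
move=> t0 [c cs ->]; exists ((Num.sqrt t)%:S * c).
  by rewrite starM cs star_rsc rscC.
by rewrite -mulrA [c * (_ * c)]mulrA rscC !mulrA -rscM -expr2 sqr_sqrtr.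
Qed.

Lemma pos_closed a : (forall e, 0 < e -> pos (a + e%:S)) -> pos a.
Proof.
move=> ae; have asa : star a = a.
  by have := pos_sa (ae 1 ltr01); rewrite starD star_rsc => /addIr.
apply: (@pos_of_norm _ (cnorm a)) => //; apply/ler_addgt0Pr => e e0.
(* Shifting both the element and the radius by [e] leaves [cnorm a - a] unchanged; only the bound
   loosens, to [cnorm a + e]. *)
have := pos_norm (t := cnorm a + e) (ae _ e0).
rewrite rscD opprD addrACA subrr addr0.
by apply; rewrite (le_trans (cnormD _ _))// cnorm_rsc gtr0_norm.
Qed.

Lemma pos_rscB a t : star a = a -> cnorm a <= t -> pos (t%:S - a).
Proof.
move=> asa ct; apply: (@pos_of_norm _ t); first by rewrite starB asa star_rsc.
by rewrite opprB addrC subrK.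
Qed.

(** With [t] the norm of [a - d], the norm test puts [a] within [t] of the scalar [t + d], around
    which elements stay invertible up to the larger distance [t + d]. *)
Lemma pos_unit a d : 0 < d -> pos (a - d%:S) -> a \is a GRing.unit.
Proof.
move=> d0 pa; set b := a - d%:S in pa; set t := cnorm b.
have t0 : 0 <= t := cnorm_ge0 _.
have tdp : 0 < t + d by lra.
have td : t + d != 0 by rewrite gt_eqF.
apply: (@unit_near _ _ (t + d)%:S); first exact: rsc_unit.
have -> : (t + d)%:S^-1 = (t + d)^-1%:S :> A.
  by apply: (mulrI (rsc_unit td)); rewrite divrr ?rsc_unit// rscV.
rewrite cnorm_rsc ger0_norm ?invr_ge0 1?ltW// ltr_pdivrMr// mul1r.
have -> : a - (t + d)%:S = - (t%:S - b).
  by rewrite /b rscD; non_commutative_ring.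
by rewrite cnormN (le_lt_trans (pos_norm pa (lexx _)))// ltrDl.
Qed.

(** The roots of [a] and of [t - a] commute and their squares add up to [t], so [cnorm_circle]
    applies. *)
Lemma pos_le_norm a t : 0 <= t -> pos a -> pos (t%:S - a) -> cnorm a <= t.
Proof.
move=> t0 pa pta; have [c [cs ca _]] := pos_sqrt pa.
have [w [ws ww wc]] := pos_sqrt pta.
rewrite -ca cnorm_sa//; apply: (@cnorm_circle c w) => //; last first.
  by rewrite ww ca addrC subrK.
by apply: wc; rewrite mulrBr mulrBl rscC -ca mulrA.
Qed.

Lemma pos_anti a : pos a -> pos (- a) -> a = 0.
Proof.
move=> pa pna; apply: cnorm_eq0; apply/eqP; rewrite eq_le cnorm_ge0 andbT.
by apply: pos_le_norm => //; rewrite rsc0 sub0r.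
Qed.

(** The constant [T] bounds [a^-1], and [a - T^-1 = T^-1 a (T - a^-1)] is, up to the factor [T^-1],
    the square of the product of the commuting roots [c] of [a] and [e] of [T - a^-1]. *)
Lemma pos_unit_gap a : pos a -> a \is a GRing.unit ->
  exists2 d, 0 < d & pos (a - d%:S).
Proof.
move=> pa au; pose T := cnorm a^-1 + 1.
have T0 : 0 < T by rewrite ltr_wpDl// cnorm_ge0.
have [c [cs cc cC]] := pos_sqrt pa.
have ca : c * a = a * c by rewrite -cc mulrA.
have cV : c * a^-1 = a^-1 * c.
  by apply: (mulrI au); apply: (mulIr au); rewrite !mulrA mulrVK// divrr// mul1r ca.
have /pos_sqrt[e [es ee eC]] : pos (T%:S - a^-1).
  by apply: pos_rscB; [rewrite starV// pos_sa | rewrite lerDl].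
have ce : c * e = e * c by apply: eC; rewrite mulrBr mulrBl rscC cV.
exists T^-1; first by rewrite invr_gt0.
have -> : a - T^-1%:S = T^-1%:S * ((e * c) * (e * c)).
  have -> : e * c * (e * c) = c * (e * e) * c.
    by rewrite -{1}ce !mulrA.
  rewrite ee mulrBr mulrBl rscC -!mulrA cc -cV mulrA cc divrr//.
  by rewrite mulrBr mulr1 mulrA -rscM mulVf ?gt_eqF// rsc1 mul1r.
apply: pos_rscM; first by rewrite invr_ge0 ltW.
by apply: pos_sqr; rewrite starM es cs.
Qed.
End Positivity.

(* An open and closed condition that holds at large [t] descends to [t = 0]. *)
Lemma real_descent (R : realType) (P : R -> Prop) :
  (forall s t, s <= t -> P s -> P t) -> (exists t, P t) ->
  (forall t, (forall e, 0 < e -> P (t + e)) -> P t) ->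
  (forall t, 0 < t -> P t -> exists2 d, 0 < d & P (t - d)) -> P 0.
Proof.
move=> up [t1 Pt1] closedP openP; apply: contrapT => P0.
have Ppos t : P t -> 0 < t.
  by move=> Pt; rewrite ltNge; apply/negP => t0; apply: P0; exact: up Pt.
have hi : has_inf [set t | P t].
  by split; [exists t1 | exists 0 => t /Ppos/ltW].
have Pi : P (inf [set t | P t]).
  apply: closedP => e e0; have [s Ps /ltW si] := inf_adherent e0 hi.
  exact: up Ps.
have [d d0 Pd] := openP _ (Ppos _ Pi) Pi.
have : inf [set t | P t] <= inf [set t | P t] - d by apply: ge_inf => //; case: hi.
by rewrite lerBrDr gerDl leNgt d0.
Qed.

(** * Positivity of y^* y *)

Section SquaresPositive.
Context {R : realType} {A : cstarAlgType R}.
Implicit Types (x y z a b c w : A) (t s d e : R).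

(** Jacobson's formula: the inverse of [t - y x] is [t^-1 (1 + y w x)], where [w] inverts
    [t - x y]. *)
Lemma rscB_unitC t x y : t != 0 ->
  t%:S - x * y \is a GRing.unit -> t%:S - y * x \is a GRing.unit.
Proof.
move=> t0 /unitrP[w [wl wr]]; apply/unitrP.
exists (t^-1%:S * (1 + y * w * x)).
have tV : t^-1%:S * t%:S = 1 :> A by rewrite -rscM mulVf// rsc1.
split.
  rewrite -[LHS]mulrA.
  have -> : (1 + y * w * x) * (t%:S - y * x)
      = t%:S - y * x + y * w * (x * t%:S) - y * w * x * y * x.
    by non_commutative_ring.
  rewrite rscC [y * w * _]mulrA -[y * w * _]mulrA rscC.
  have -> : t%:S - y * x + y * (t%:S * w) * x - y * w * x * y * x
      = t%:S + y * (t%:S * w - w * x * y - 1) * x by non_commutative_ring.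
  by rewrite -[t%:S * w]rscC -[w * x * y]mulrA -mulrBr wl subrr mulr0 mul0r addr0.
rewrite -rscC mulrA.
have -> : (t%:S - y * x) * (1 + y * w * x)
      = t%:S - y * x + t%:S * y * w * x - y * x * y * w * x.
  by non_commutative_ring.
rewrite -[t%:S * y]rscC.
have -> : t%:S - y * x + y * t%:S * w * x - y * x * y * w * x
      = t%:S + y * ((t%:S - x * y) * w - 1) * x by non_commutative_ring.
by rewrite wr subrr mulr0 mul0r addr0 rscC.
Qed.

(** The relation [t - a >= 0] holds at [t = cnorm a] and is carried down to [t = 0] by
    [real_descent]: where [t - a] is positive and invertible, [pos_unit_gap] leaves room below.
    Hence [- a] is positive as well. *)
Lemma pos_quasinilpotent a : pos a ->
  (forall t, 0 < t -> t%:S - a \is a GRing.unit) -> a = 0.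
Proof.
move=> pa au; apply: pos_anti => //; rewrite -sub0r -rsc0.
apply: (@real_descent _ (fun t => pos (t%:S - a))).
- move=> s t st ps; have -> : t%:S - a = (t - s)%:S + (s%:S - a).
    by rewrite rscB addrA subrK.
  by apply: posD => //; apply: pos_rsc; rewrite subr_ge0.
- by exists (cnorm a); apply: pos_rscB => //; exact: pos_sa.
- move=> t H; apply: pos_closed => e /H.
  by rewrite rscD addrAC.
- move=> t t0 pta; have [d d0 pd] := pos_unit_gap pta (au _ t0).
  by exists d => //; rewrite rscB addrAC.
Qed.

(* With [r = sqrt (b^2)] and [v = y (r - b)], one has [v^* v <= 0], whereas
   [v v^* + v^* v >= 0] and [v v^*], [v^* v] have the same nonzero spectrum. *)
Lemma pos_starM_le1 y : cnorm (star y * y) <= 1 -> pos (star y * y).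
Proof.
set b := star y * y => b1.
have bs : star b = b by rewrite starM starK.
have [||r [rs rr r1 rC]] := @sqrt_sub1 _ _ (1 - b * b).
- by rewrite starB star1 starM bs.
- exact: cnorm_sub1_sqr.
have {}rr : r * r = b * b by rewrite rr opprB addrC subrK.
have br : b * r = r * b by apply: rC; rewrite mulrBr mulrBl mulr1 mul1r mulrA.
(* The element [r] is itself positive, because [sqrt_sub1] also bounds [1 - r]; its root [s]
   exhibits [r c^2] as the square of [s c]. *)
have [|s [ss sr sC]] := @sqrt_of_norm _ _ r 1 rs.
  by rewrite rsc1.
have bsC : b * s = s * b by apply: sC.
pose c := r - b; have cs : star c = c by rewrite starB rs bs.
have sc : s * c = c * s.
  by rewrite mulrBr mulrBl bsC -sr mulrA.
have rc : r * c = c * r by rewrite mulrBr mulrBl br.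
have cb : c * b = - (r * c).
  by rewrite mulrBl mulrBr rr opprB.
pose p := (s * c) * (s * c).
have pE : p = r * c * c.
  have -> : p = s * (c * s) * c by rewrite /p !mulrA.
  by rewrite -sc -sr !mulrA.
pose v := y * c.
have vv : star v * v = - p.
  rewrite starM cs pE.
  have -> : c * star y * v = c * b * c by rewrite /v /b !mulrA.
  by rewrite cb mulNr.
have pp : pos p by apply: pos_sqr; rewrite starM ss cs sc.
pose j : A := im1.
have pq : pos (v * star v).
  (* The real and imaginary parts of [v] give [v v^* + v^* v] as half a sum of two squares, and
     [v^* v = - p]. *)
  have -> : v * star v = (2^-1)%:S * ((v + star v) * (v + star v)
      + (j * (v - star v)) * (j * (v - star v))) + p.
    have -> : (j * (v - star v)) * (j * (v - star v)) =
        (j * j) * ((v - star v) * (v - star v)).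
      by rewrite -!mulrA [(v - star v) * (j * _)]mulrA im1C !mulrA.
    rewrite im1_sqr; have -> : (v + star v) * (v + star v) +
      -1 * ((v - star v) * (v - star v)) = (1 + 1) * (v * star v + star v * v).
      by non_commutative_ring.
    have -> : 1 + 1 = 2%:S :> A by rewrite -rsc1 -rscD.
    by rewrite mulrA -rscM mulVf ?pnatr_eq0// rsc1 mul1r vv subrK.
  apply: posD => //; apply: pos_rscM; first by rewrite invr_ge0.
  apply: posD; apply: pos_sqr; first by rewrite starD starK addrC.
  by rewrite starM star_im1 starB starK mulrN -mulNr opprB im1C.
have q0 : v * star v = 0.
  (* For [t > 0] the element [t - v^* v = t + p] is invertible, hence so is [t - v v^*]. *)
  apply: pos_quasinilpotent => // t t0; apply: rscB_unitC; first by rewrite gt_eqF.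
  rewrite vv opprK; apply: (pos_unit t0).
  by rewrite addrAC subrr add0r.
have v0 : v = 0.
  apply: cnorm_eq0; apply/eqP; rewrite -cnorm_star -sqrf_eq0 -cnorm_starM starK.
  by rewrite q0 cnorm0.
have sc0 : s * c = 0.
  apply: cnorm_eq0; apply/eqP; rewrite -sqrf_eq0 -cnorm_sa.
    2: by rewrite starM ss cs sc.
  by rewrite -/p -[p]opprK -vv v0 mulr0 oppr0 cnorm0.
have c0 : c = 0.
  apply: cnorm_eq0; apply/eqP; rewrite -sqrf_eq0 -cnorm_sa//.
  (* The identity [b c = - r c] turns [c^2 = (r - b) c] into [2 r c], which vanishes with [s c]. *)
  have -> : c * c = r * c + r * c.
    have bc : b * c = - (r * c) by rewrite !mulrBr br rr opprB.
    by rewrite {1}/c mulrBl bc opprK.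
  by rewrite -sr -mulrA sc0 mulr0 addr0 cnorm0.
have -> : b = r by apply/esym/eqP; rewrite -subr_eq0; apply/eqP.
by rewrite -sr; exact: pos_sqr.
Qed.

Lemma pos_starM y : pos (star y * y).
Proof.
pose t := cnorm y + 1; have t0 : 0 < t by rewrite ltr_wpDl// cnorm_ge0.
pose y' := t^-1%:S * y.
have yy' : star y * y = (t * t)%:S * (star y' * y').
  have -> : star y' * y' = (t^-1 * t^-1)%:S * (star y * y).
    rewrite starM star_rsc rscM rscC -!mulrA; congr (_ * _).
    by rewrite [LHS]mulrA rscC -mulrA.
  by rewrite mulrA -rscM mulrACA divff ?gt_eqF// mulr1 rsc1 mul1r.
rewrite yy'; apply: pos_rscM; first by rewrite mulr_ge0// ltW.
apply: pos_starM_le1; rewrite cnorm_starM expr_le1// ?cnorm_ge0//.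
rewrite cnorm_rscM ger0_norm ?invr_ge0 ?(ltW t0)// ler_pdivrMl// mulr1.
by rewrite lerDl.
Qed.

Lemma pos_conj a x : pos a -> pos (star x * a * x).
Proof.
case=> c cs ->.
have -> : star x * (c * c) * x = star (c * x) * (c * x) by rewrite starM cs !mulrA.
exact: pos_starM.
Qed.

Lemma cnorm_lt1 a d : 0 < d -> pos (1 - star a * a - d%:S) -> cnorm a < 1.
Proof.
move=> d0 pa; rewrite -(@expr_lt1 _ 2) ?cnorm_ge0// -cnorm_starM.
(* The maximum with 0 keeps the bound nonnegative, as [pos_le_norm] requires, also for [d > 1]. *)
have : cnorm (star a * a) <= Num.max 0 (1 - d).
  apply: pos_le_norm; first by rewrite le_max lexx.
    exact: pos_starM.
  have -> : (Num.max 0 (1 - d))%:S - star a * a =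
      (1 - star a * a - d%:S) + (Num.max 0 (1 - d) - (1 - d))%:S.
    rewrite !rscB rsc1; non_commutative_ring.
  by apply: posD => //; apply: pos_rsc; rewrite subr_ge0 le_max lexx orbT.
move=> /le_lt_trans; apply; rewrite gt_max ltr01/=; lra.
Qed.

Lemma pos_sub1_starM a : cnorm a <= 1 -> pos (1 - star a * a).
Proof.
move=> a1; rewrite -rsc1; apply: pos_rscB; first by rewrite starM starK.
by rewrite cnorm_starM expr_le1// cnorm_ge0.
Qed.

Lemma pos_starM_unit a : a \is a GRing.unit ->
  exists2 d, 0 < d & pos (star a * a - d%:S).
Proof.
by move=> au; apply: pos_unit_gap; [exact: pos_starM | rewrite unitrMl// star_unit].
Qed.

End SquaresPositive.

(** * Matrices over A: adjoints and two-by-two entries *)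

Section MatrixStar.
Context {R : realType} {A : cstarAlgType R}.

Lemma mx_starK m n (M : 'M[A]_(m, n)) : mx_star (mx_star M) = M.
Proof. by apply/matrixP => i j; rewrite !mxE starK. Qed.
Lemma mx_starD m n (M N : 'M[A]_(m, n)) : mx_star (M + N) = mx_star M + mx_star N.
Proof. by apply/matrixP => i j; rewrite !mxE starD. Qed.
Lemma mx_starN m n (M : 'M[A]_(m, n)) : mx_star (- M) = - mx_star M.
Proof. by apply/matrixP => i j; rewrite !mxE starN. Qed.
Lemma star_sum I (r : seq I) (P : pred I) (F : I -> A) :
  star (\sum_(i <- r | P i) F i) = \sum_(i <- r | P i) star (F i).
Proof.
by elim/big_rec2: _ => [|i y1 y2 _ <-]; rewrite ?star0 ?starD.
Qed.
Lemma mx_starM m n p (M : 'M[A]_(m, n)) (N : 'M[A]_(n, p)) :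
  mx_star (M *m N) = mx_star N *m mx_star M.
Proof.
apply/matrixP => i j; rewrite !mxE star_sum; apply: eq_bigr => k _.
by rewrite !mxE starM.
Qed.
Lemma mx_star_scalar n (a : A) : mx_star (a%:M : 'M[A]_n) = (star a)%:M.
Proof.
apply/matrixP => i j; rewrite !mxE eq_sym.
by case: eqP; rewrite ?mulr1n ?mulr0n ?star0.
Qed.
Lemma scale1_mxC n (c : R[i]) (M : 'M[A]_n) : M *m (c%:A)%:M = (c%:A)%:M *m M.
Proof.
apply/matrixP => i j; rewrite mul_scalar_mx !mxE (bigD1 j)//= big1 ?addr0.
  by rewrite mxE eqxx mulr1n -scalerAl -scalerAr mulr1 mul1r.
by move=> k kj; rewrite mxE (negPf kj) mulr0n mulr0.
Qed.
Lemma rsc_mxC n (t : R) (M : 'M[A]_n) : M *m (t%:S)%:M = (t%:S)%:M *m M.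
Proof. exact: scale1_mxC. Qed.

Lemma sum_ord2 (V : nmodType) (F : 'I_2 -> V) : \sum_(i < 2) F i = F 0 + F 1.
Proof. by rewrite big_ord_recl big_ord1; congr (_ + F _); apply: val_inj. Qed.

Lemma ord2P (P : 'I_2 -> Prop) : P 0 -> P 1 -> forall i, P i.
Proof.
move=> P0 P1 [[|[|//]] ilt].
  by rewrite (_ : Ordinal ilt = 0)//; apply: val_inj.
by rewrite (_ : Ordinal ilt = 1)//; apply: val_inj.
Qed.

Definition mx2 (a b c d : A) : 'M[A]_2 :=
  \matrix_(i, j) if i == 0 then (if j == 0 then a else b)
                 else (if j == 0 then c else d).
Definition cv2 (a b : A) : 'cV[A]_2 := \col_i if i == 0 then a else b.

Lemma mx2E a b c d : (mx2 a b c d 0 0 = a) * (mx2 a b c d 0 1 = b) *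
  (mx2 a b c d 1 0 = c) * (mx2 a b c d 1 1 = d).
Proof. by rewrite !mxE. Qed.
Lemma cv2E a b : (cv2 a b 0 0 = a) * (cv2 a b 1 0 = b).
Proof. by rewrite !mxE. Qed.

Lemma mx2P (M N : 'M[A]_2) : M 0 0 = N 0 0 -> M 0 1 = N 0 1 ->
  M 1 0 = N 1 0 -> M 1 1 = N 1 1 -> M = N.
Proof. by move=> *; apply/matrixP; do 2!apply: ord2P. Qed.
Lemma cv2P (x y : 'cV[A]_2) : x 0 0 = y 0 0 -> x 1 0 = y 1 0 -> x = y.
Proof. by move=> *; apply/matrixP; apply: ord2P => j; rewrite !ord1. Qed.

Lemma mul2E n p (M : 'M[A]_(n, 2)) (N : 'M[A]_(2, p)) i j :
  (M *m N) i j = M i 0 * N 0 j + M i 1 * N 1 j.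
Proof. by rewrite mxE sum_ord2. Qed.
Lemma mx_starE m n (M : 'M[A]_(m, n)) i j : mx_star M i j = star (M j i).
Proof. by rewrite mxE. Qed.

End MatrixStar.

(** * Positive two-by-two matrices as A-valued quadratic forms *)

Section MatrixPositivity.
Context {R : realType} {A : cstarAlgType R}.
Implicit Types (m n : 'M[A]_2) (x y : 'cV[A]_2) (t s d e : R).

Local Notation "t %:S2" := ((rsc t)%:M : 'M[A]_2) (at level 1, format "t %:S2").

Definition qform m x : A := (mx_star x *m m *m x) 0 0.
Definition mpos m := mx_star m = m /\ forall x, pos (qform m x).

Lemma qformE m x : qform m x =
  star (x 0 0) * m 0 0 * x 0 0 + star (x 1 0) * m 1 0 * x 0 0 +
  (star (x 0 0) * m 0 1 * x 1 0 + star (x 1 0) * m 1 1 * x 1 0).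
Proof. by rewrite /qform !mul2E !mx_starE !mulrDl. Qed.

Lemma qformD m n x : qform (m + n) x = qform m x + qform n x.
Proof. by rewrite /qform mulmxDr mulmxDl mxE. Qed.

Lemma qform_scalar t x :
  qform t%:S2 x = t%:S * (star (x 0 0) * x 0 0 + star (x 1 0) * x 1 0).
Proof.
rewrite qformE !mxE /= !mulr0n !mulr1n !mulr0 !mul0r addr0 add0r.
by rewrite mulrDr !mulrA -!(rscC t (star _)).
Qed.

Lemma mposD m n : mpos m -> mpos n -> mpos (m + n).
Proof.
move=> [ms mp] [ns np]; split; first by rewrite mx_starD ms ns.
by move=> x; rewrite qformD; exact: posD.
Qed.

Lemma mpos_conj m n : mpos m -> mpos (mx_star n *m m *m n).
Proof.
move=> [ms mp]; split; first by rewrite !mx_starM mx_starK ms mulmxA.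
move=> x; have := mp (n *m x); congr (pos (_ 0 0)).
by rewrite mx_starM !mulmxA.
Qed.

Lemma mpos_rsc t : 0 <= t -> mpos t%:S2.
Proof.
move=> t0; split; first by rewrite mx_star_scalar star_rsc.
move=> x; rewrite qform_scalar; apply: pos_rscM => //.
by apply: posD; exact: pos_starM.
Qed.

Lemma mpos_sqr n : mpos (mx_star n *m n).
Proof.
have := mpos_conj n (mpos_rsc ler01).
by rewrite rsc1 mulmx1.
Qed.

Lemma mpos_rscM t m : 0 <= t -> mpos m -> mpos (t%:S2 *m m).
Proof.
move=> t0 /(mpos_conj (Num.sqrt t)%:S2).
rewrite mx_star_scalar star_rsc rsc_mxC mulmxA -scalar_mxM -rscM -expr2.
by rewrite sqr_sqrtr.
Qed.

Lemma mpos_bounded m : mx_star m = m -> exists2 t, 0 < t & mpos (t%:S2 - m).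
Proof.
move=> ms.
have s00 : star (m 0 0) = m 0 0 by rewrite -{2}ms mx_starE.
have s11 : star (m 1 1) = m 1 1 by rewrite -{2}ms mx_starE.
have s10 : m 1 0 = star (m 0 1) by rewrite -{1}ms mx_starE.
(* The cross terms in [b = m 0 1] are completed to the square of [x0 - b x1], at the cost of 1 on
   [x0] and [cnorm b ^+ 2] on [x1]; the norms of the diagonal entries take care of the diagonal. *)
pose t := cnorm (m 0 0) + cnorm (m 1 1) + cnorm (m 0 1) ^+ 2 + 1.
have t0 : 0 < t by rewrite ltr_wpDl// addr_ge0 ?exprn_ge0 ?addr_ge0 ?cnorm_ge0.
exists t => //; split.
  by rewrite mx_starD mx_starN mx_star_scalar star_rsc ms.
move=> x; rewrite qformE !mxE /= !(mulr1n, mulr0n) s10.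
set a := m 0 0 in s00 t t0 *; set b := m 0 1 in t t0 *; set c := m 1 1 in s11 t t0 *.
have tE : t%:S = (cnorm a)%:S + (cnorm c)%:S + (cnorm b ^+ 2)%:S + 1 :> A.
  by rewrite !rscD rsc1.
set x0 := x 0 0; set x1 := x 1 0; set a' : A := (cnorm a)%:S; set c' : A := (cnorm c)%:S.
set b' : A := (cnorm b ^+ 2)%:S.
have -> : star x0 * (t%:S - a) * x0 + star x1 * (0 - star b) * x0 +
    (star x0 * (0 - b) * x1 + star x1 * (t%:S - c) * x1) =
    star x0 * (a' - a) * x0 + star x1 * (c' - c) * x1
    + star x1 * (b' - star b * b) * x1 + star (x0 - b * x1) * (x0 - b * x1)
    + star x0 * (c' + b') * x0 + star x1 * (a' + 1) * x1.
  by rewrite tE -/a' -/b' -/c' starB starM; non_commutative_ring.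
have pa : pos (a' - a) by apply: pos_rscB.
have pc : pos (c' - c) by apply: pos_rscB.
have pb : pos (b' - star b * b).
  by apply: pos_rscB; rewrite ?cnorm_starM// starM starK.
by do !apply: posD; try exact: pos_conj; try exact: pos_starM;
  apply: pos_conj; rewrite /a' /b' /c' -?rsc1 -rscD;
  apply: pos_rsc; rewrite addr_ge0 ?cnorm_ge0 ?exprn_ge0 ?cnorm_ge0.
Qed.

(** For [n] the inverse of [m] and [c] a scalar bound of [n], the right-hand side is a congruence of
    [m] plus [c - n], both positive. This yields for matrices the lower bound of [pos_unit_gap]
    without square roots of matrices. *)
Lemma inverse_gap_id (B : nzRingType) (m n c : B) : m * n = 1 -> n * m = 1 ->
  c * n = n * c -> c * c * m - c = (c - n) * m * (c - n) + (c - n).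
Proof.
move=> mn nm cn.
have cm : m * c = c * m.
  have : m * (c * n) * m = m * (n * c) * m by rewrite cn.
  by rewrite !mulrA mn mul1r -!mulrA nm mulr1.
have -> : (c - n) * m * (c - n) = c * (m * c) - c * (m * n) - n * m * c + n * m * n.
  by non_commutative_ring.
by rewrite mn nm cm mul1r; non_commutative_ring.
Qed.

Lemma mpos_inverse_gap m n : mpos m -> mx_inverse m n ->
  exists2 d, 0 < d & mpos (m - d%:S2).
Proof.
move=> pm [mn nm].
have ns : mx_star n = n.
  have : mx_star (m *m n) *m n = n by rewrite mn mx_star_scalar star1 mul1mx.
  by rewrite mx_starM (proj1 pm) -mulmxA mn mulmx1.
have [t t0 pt] := mpos_bounded ns.
exists t^-1; first by rewrite invr_gt0.
have := @inverse_gap_id 'M[A]_2 m n t%:S2 mn nm (esym (rsc_mxC t n)).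
rewrite -![_ * _]/(_ *m _) => E.
have -> : m - t^-1%:S2 = (t^-1 * t^-1)%:S2 *m (t%:S2 *m t%:S2 *m m - t%:S2).
  rewrite mulmxBr !mulmxA -!scalar_mxM -!rscM.
  by rewrite !divfK ?gt_eqF// mulVf ?gt_eqF// rsc1 mul1mx.
rewrite E; apply: mpos_rscM; first by rewrite mulr_ge0 ?invr_ge0 ?(ltW t0).
apply: mposD => //; have := mpos_conj (t%:S2 - n) pm.
by rewrite {1}mx_starD mx_starN mx_star_scalar star_rsc ns.
Qed.

Lemma Gl2M m n : Gl2 m -> Gl2 n -> Gl2 (m *m n).
Proof.
move=> [m' [mm mm']] [n' [nn nn']]; exists (n' *m m'); split.
  by rewrite mulmxA -(mulmxA m) nn mulmx1.
by rewrite mulmxA -(mulmxA n') mm' mulmx1.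
Qed.

Lemma Gl2_factor m n : m *m n = n *m m -> Gl2 (m *m n) -> Gl2 m.
Proof.
move=> mn [w [mw wm]].
have E : w *m n = n *m w.
  have nq : n *m (m *m n) = m *m n *m n by rewrite mulmxA -mn.
  rewrite -[LHS]mulmx1 -mw mulmxA -(mulmxA w n (m *m n)) nq.
  by rewrite (mulmxA w (m *m n)) wm mul1mx.
exists (n *m w); split; first by rewrite mulmxA.
by rewrite -E -mulmxA -mn.
Qed.

(** The LDU factorization with pivot [m 0 0]; the middle factor carries the Schur complement. *)
Lemma Gl2_schur m : m 0 0 \is a GRing.unit ->
  m 1 1 - m 1 0 * (m 0 0)^-1 * m 0 1 \is a GRing.unit -> Gl2 m.
Proof.
set a := m 0 0; set b := m 0 1; set c := m 1 0; set s := _ - _ => au su.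
have -> : m = mx2 1 0 (c * a^-1) 1 *m mx2 a 0 0 s *m mx2 1 (a^-1 * b) 0 1.
  apply: mx2P; rewrite !mul2E !mx2E ?(mul0r, mulr0, mul1r, mulr1, addr0, add0r)//.
  - by rewrite mulrA divrr// mul1r.
  - by rewrite mulrVK.
  - by rewrite mulrVK// addrC mulrA subrK.
have I1 : (1%:M : 'M[A]_2) = mx2 1 0 0 1.
  by apply: mx2P; rewrite mx2E mxE.
apply: Gl2M; first apply: Gl2M.
- exists (mx2 1 0 (- (c * a^-1)) 1); rewrite /mx_inverse I1.
  by split; apply: mx2P;
    rewrite !mul2E !mx2E ?(mul0r, mulr0, mul1r, mulr1, addr0, add0r) ?subrr ?addNr.
- exists (mx2 a^-1 0 0 s^-1); rewrite /mx_inverse I1.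
  by split; apply: mx2P;
    rewrite !mul2E !mx2E ?(mul0r, mulr0, mul1r, mulr1, addr0, add0r) ?divrr ?mulVr.
- exists (mx2 1 (- (a^-1 * b)) 0 1); rewrite /mx_inverse I1.
  by split; apply: mx2P;
    rewrite !mul2E !mx2E ?(mul0r, mulr0, mul1r, mulr1, addr0, add0r) ?subrr ?addNr.
Qed.

Lemma mpos_gap_diag m d : mpos (m - d%:S2) ->
  pos (m 0 0 - d%:S) /\ pos (m 1 1 - d%:S).
Proof.
move=> [_ p]; split.
  have := p (cv2 1 0); rewrite qformE !cv2E !mxE star1 star0.
  by rewrite !(mul1r, mulr1, mulr0, mul0r, addr0, add0r).
have := p (cv2 0 1); rewrite qformE !cv2E !mxE star1 star0.
by rewrite !(mul1r, mulr1, mulr0, mul0r, addr0, add0r).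
Qed.

Lemma mpos_gap_Gl2 m d : mx_star m = m -> 0 < d -> mpos (m - d%:S2) -> Gl2 m.
Proof.
move=> ms d0 pm; have [p0 _] := mpos_gap_diag pm.
have s10 : m 1 0 = star (m 0 1) by rewrite -{1}ms mx_starE.
have s00 : star (m 0 0) = m 0 0 by rewrite -{2}ms mx_starE.
have au := pos_unit d0 p0.
(* On this column, which the first row of [m] annihilates, the form of [m] takes the Schur
   complement as its value. *)
have := (proj2 pm) (cv2 (- ((m 0 0)^-1 * m 0 1)) 1).
set a := m 0 0 in s00 au *; set b := m 0 1.
rewrite qformE !cv2E !mxE /= !(mulr1n, mulr0n) star1 s10 -/a -/b starN starM starV// s00.
move=> p; apply: Gl2_schur => //; apply: (@pos_unit _ _ _ d) => //.
rewrite s10 -/a -/b; set w := a^-1 * b; set c := star b * a^-1 in p *.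
have aw : a * w = b by rewrite mulrA divrr// mul1r.
have ca : c * a = star b by rewrite mulrVK.
have cw : star b * w = c * b by rewrite mulrA.
have -> : m 1 1 - c * b - d%:S = (m 1 1 - d%:S - c * b - c * d%:S * w) + c * d%:S * w.
  by rewrite subrK addrAC.
(* As [c] is the adjoint of [w], the term [c d w] lost to the shift by [d] is positive and can be
   added back. *)
apply: posD; last first.
  rewrite -[c]starK /c starM starK starV// s00.
  by apply: pos_conj; exact/pos_rsc/ltW.
move: p; congr pos.
have -> : - c * (a - d%:S) * - w + 1 * (star b - 0) * - w +
  (- c * (b - 0) * 1 + 1 * (m 1 1 - d%:S) * 1) =
  c * (a * w) - c * d%:S * w - star b * w - c * b + m 1 1 - d%:S.
  by non_commutative_ring.
by rewrite aw cw; non_commutative_ring.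
Qed.

Lemma mpos_closed m : (forall e, 0 < e -> mpos (m + e%:S2)) -> mpos m.
Proof.
move=> me; split.
  have := proj1 (me 1 ltr01).
  by rewrite mx_starD mx_star_scalar star_rsc => /addIr.
move=> x; apply: pos_closed => e e0.
set k := star (x 0 0) * x 0 0 + star (x 1 0) * x 1 0.
have pk : pos k by apply: posD; exact: pos_starM.
(* A scalar matrix [e] contributes [e k], with [k] depending on [x]; testing with [e / T], where [T]
   bounds [k], keeps the contribution below [e]. *)
pose T := cnorm k + 1; have T0 : 0 < T by rewrite ltr_wpDl// cnorm_ge0.
have := proj2 (me _ (divr_gt0 e0 T0)) x; rewrite qformD qform_scalar -/k => p.
have -> : qform m x + e%:S = qform m x + (e / T)%:S * k + (e / T)%:S * (T%:S - k).
  by rewrite mulrBr -rscM divfK ?gt_eqF// addrA addrAC addrK.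
apply: posD => //; apply: pos_rscM; first by rewrite divr_ge0 ?ltW.
by apply: pos_rscB; [exact: pos_sa | rewrite lerDl].
Qed.

(** Completes the square for conjugate scalars [a], [b] with real part [p] and squared imaginary
    part [q]. The abstract ring brings it within reach of [non_commutative_ring]. *)
Lemma mulBB_comm (B : nzRingType) (m a b p q : B) :
  a + b = p + p -> a * b = p * p + q -> m * a = a * m -> m * p = p * m ->
  (m - a) * (m - b) = (m - p) * (m - p) + q.
Proof.
move=> ab1 ab2 ma mp.
have -> : (m - a) * (m - b) = m * m - m * (a + b) + (m * a - a * m) + a * b.
  by non_commutative_ring.
by rewrite ab1 ab2 ma subrr mulrDr {2}mp; non_commutative_ring.
Qed.

Lemma scalar_conj_mul m (r i : R) :
  (m - ((r +i* i)%C%:A)%:M) *m (m - ((r +i* - i)%C%:A)%:M) =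
  (m - r%:S2) *m (m - r%:S2) + (i ^+ 2)%:S2.
Proof.
apply: (@mulBB_comm 'M[A]_2); rewrite -?[_ * _]/(_ *m _).
- rewrite /rsc -!(raddfD (@scalar_mx A 2)) -!scalerDl; congr ((_ *: _)%:M).
  by apply/eqP; rewrite eq_complex /=; apply/andP; split; apply/eqP; ring.
- rewrite -!scalar_mxM -(raddfD (@scalar_mx A 2)) /rsc -!scalerAl !mul1r.
  rewrite !scalerA -scalerDl; congr ((_ *: _)%:M).
  by apply/eqP; rewrite eq_complex /=; apply/andP; split; apply/eqP; ring.
- exact: scale1_mxC.
- exact: rsc_mxC.
Qed.

(* The spectral condition defining [Gl2_pos] is used only to decrease [t] from
   infinity to [0] in [m + t >= 0]: where [m + t] is both positive and invertible,
   it is bounded below. *)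
Lemma Gl2_posP m : Gl2_pos m <->
  mx_star m = m /\ exists2 d, 0 < d & mpos (m - d%:S2).
Proof.
split=> [[[n mn] [ms sp]]|[ms [d d0 pm]]].
  split=> //; apply: mpos_inverse_gap mn.
  rewrite -[m]addr0 -(raddf0 (@scalar_mx A 2)) -rsc0.
  apply: (@real_descent _ (fun t => mpos (m + t%:S2))).
  - move=> s t st ps; have -> : m + t%:S2 = (m + s%:S2) + (t - s)%:S2.
      by rewrite rscB (raddfB (@scalar_mx A 2)) addrACA subrr addr0.
    by apply: mposD => //; apply: mpos_rsc; rewrite subr_ge0.
  - have [|t _ pt] := @mpos_bounded (- m); first by rewrite mx_starN ms.
    by exists t; rewrite addrC -[m]opprK.
  - move=> t H; apply: mpos_closed => e /H.
    by rewrite rscD (raddfD (@scalar_mx A 2)) addrA.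
  - move=> t t0 pt; have [k kE] : Gl2 (m + t%:S2).
      apply: contrapT => nG; have := sp (- t)%:C%C.
      rewrite /spectrum2 /= -[_%:A]/(rsc (- t)) rscN (raddfN (@scalar_mx A 2)).
      rewrite opprK => /(_ nG).
      by rewrite lecR oppr_ge0 leNgt t0.
    have [d d0 pd] := mpos_inverse_gap pt kE; exists d => //.
    by rewrite rscB (raddfB (@scalar_mx A 2)) addrA.
have mG := mpos_gap_Gl2 ms d0 pm.
split=> //; split=> // -[r i] nG; apply: contrapT => c0; apply: nG.
have [i0|i0] := eqVneq i 0.
  rewrite i0 -[X in X%:M]/(r%:S).
  have r0 : 0 < - r.
    by rewrite oppr_gt0 ltNge; apply/negP => r0; apply: c0; rewrite i0 lecE /= eqxx.
  apply: (@mpos_gap_Gl2 _ (d - r)); last 2 first.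
  - by rewrite addr_gt0.
  - by rewrite rscB (raddfB (@scalar_mx A 2)) opprB addrA subrK.
  - by rewrite mx_starD mx_starN mx_star_scalar star_rsc ms.
(* For a nonreal scalar the product of [m - c] with [m] minus the conjugate of [c] is [h^2] plus the
   square of the imaginary part, hence bounded below. *)
apply: (@Gl2_factor _ (m - ((r +i* - i)%C%:A)%:M)).
  rewrite scalar_conj_mul; have := scalar_conj_mul m r (- i).
  by rewrite opprK sqrrN => ->.
rewrite scalar_conj_mul; set h := m - r%:S2.
have hs : mx_star h = h.
  by rewrite mx_starD mx_starN mx_star_scalar star_rsc ms.
apply: (@mpos_gap_Gl2 _ (i ^+ 2)).
- by rewrite mx_starD mx_starM hs mx_star_scalar star_rsc.
- by rewrite exprn_even_gt0.
- by rewrite addrK -{1}hs; exact: mpos_sqr.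
Qed.

End MatrixPositivity.

(** * Differential calculus: bounded bilinear maps and class C^n *)

Section Calculus.
Context {R : realType}.
Implicit Types (U V W X : normedModType R).

Lemma near0_norm_le V (e : R) : 0 < e -> \forall x \near (0 : V), `|x| <= e.
Proof. exact: nbhs0_le. Qed.

Lemma blin_le V W (f : blin V W) x : `|f x| <= `|f| * `|x|.
Proof.
have [->|x0] := eqVneq x 0; first by rewrite linear0 !normr0 mulr0.
have xp : 0 < `|x| by rewrite normr_gt0.
rewrite -ler_pdivrMr//.
have -> : `|f x| / `|x| = `|f (`|x|^-1 *: x)|.
  by rewrite linearZ normrZ normfV normr_id mulrC.
by apply: blin_norm_ub; rewrite normrZ normfV normr_id mulVf ?gt_eqF.
Qed.

Lemma bounded_continuous V W (f : V -> W) M : linear f ->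
  (forall x, `|f x| <= M * `|x|) -> continuous f.
Proof.
move=> fl fM; pose F : {linear V -> W} := HB.pack f (GRing.isLinear.Build _ _ _ _ f fl).
apply: (proj1 (linear_bounded_continuous F)); apply/linear_boundedP.
near=> r => x; rewrite (le_trans (fM x))// ler_wpM2r//.
Unshelve. all: by end_near. Qed.

Definition mk_blin V W (f : V -> W) M (fl : linear f)
  (fM : forall x, `|f x| <= M * `|x|) : blin V W :=
  Blin fl (bounded_continuous fl fM).

Lemma blin_norm_le V W (f : blin V W) M : 0 <= M ->
  (forall x, `|f x| <= M * `|x|) -> `|f| <= M.
Proof.
move=> M0 fM; apply: blin_norm_lub => x x1.
by rewrite (le_trans (fM x))// ler_piMr.
Qed.

(** Products, scalings, the form [thetaD] and the evaluation of operators are all of this kind, so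
    that one product rule serves for everything. *)
Record bounded_bilinear U V W (B : U -> V -> W) : Prop := BoundedBilinear {
  bbil_l : forall y, linear (B^~ y) ;
  bbil_r : forall x, linear (B x) ;
  bbil_bound : exists2 M, 0 <= M & forall x y, `|B x y| <= M * `|x| * `|y|
}.

Lemma is_diff_blin V W (L : blin V W) x : is_diff x L L.
Proof.
have Lc : continuous L := @blin_continuous _ _ _ L.
by apply: DiffDef; [exact: linear_differentiable | rewrite diff_lin].
Qed.

Lemma is_diff_of_le V W (f : V -> W) (L : blin V W) x :
  (forall e, 0 < e -> \forall h \near (0 : V), `|f (h + x) - f x - L h| <= e * `|h|) ->
  is_diff x f L.
Proof.
move=> fL; have Lc : continuous L := @blin_continuous _ _ _ L.
have E : f \o shift x = cst (f x) + L +o_ 0 id.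
  apply/eqaddoP => e e0; have := fL _ e0; apply: filterS => h /=.
  by rewrite !fctE opprD addrA.
have dE := diff_unique Lc E.
apply: DiffDef => //; apply/diff_locallyP; rewrite dE; split => //.
Qed.

Lemma is_diff_le V W (f : V -> W) (L : V -> W) x : is_diff x f L ->
  forall e, 0 < e -> \forall h \near (0 : V), `|f (h + x) - f x - L h| <= e * `|h|.
Proof.
move=> [/diff_locallyP[_ E] <-] e e0; have /eqaddoP/(_ _ e0) := E.
by apply: filterS => h /=; rewrite !fctE opprD addrA.
Qed.

Section BilinearCalculus.
Context {U V W : normedModType R} {B : U -> V -> W}.
Hypothesis Bb : bounded_bilinear B.

Lemma bbilDl x x' y : B (x + x') y = B x y + B x' y.
Proof. by have := bbil_l Bb y 1 x x'; rewrite !scale1r. Qed.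
Lemma bbilDr x y y' : B x (y + y') = B x y + B x y'.
Proof. by have := bbil_r Bb x 1 y y'; rewrite !scale1r. Qed.
Lemma bbilBl x x' y : B (x - x') y = B x y - B x' y.
Proof. by apply/eqP; rewrite eq_sym subr_eq -bbilDl subrK. Qed.
Lemma bbilBr x y y' : B x (y - y') = B x y - B x y'.
Proof. by apply/eqP; rewrite eq_sym subr_eq -bbilDr subrK. Qed.

Fact bbil_pairl_linear X (T : blin X U) y : linear (fun h => B (T h) y).
Proof. by move=> a h k; rewrite linearP (bbil_l Bb). Qed.
Fact bbil_pairr_linear X (T : blin X V) x : linear (fun h => B x (T h)).
Proof. by move=> a h k; rewrite linearP (bbil_r Bb). Qed.

Definition bbil_const : R := projT1 (cid2 (bbil_bound Bb)).
Lemma bbil_const_ge0 : 0 <= bbil_const.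
Proof. by rewrite /bbil_const; case: cid2. Qed.
Lemma bbil_le x y : `|B x y| <= bbil_const * `|x| * `|y|.
Proof. by rewrite /bbil_const; case: cid2 => /=. Qed.

Fact bbil_pairl_le X (T : blin X U) y h :
  `|B (T h) y| <= bbil_const * `|T| * `|y| * `|h|.
Proof.
rewrite (le_trans (bbil_le _ _))// -!mulrA ler_wpM2l ?bbil_const_ge0//.
by rewrite [X in _ <= _ * X]mulrC mulrA ler_wpM2r// blin_le.
Qed.
Fact bbil_pairr_le X (T : blin X V) x h :
  `|B x (T h)| <= bbil_const * `|T| * `|x| * `|h|.
Proof.
rewrite (le_trans (bbil_le _ _))// -!mulrA ler_wpM2l ?bbil_const_ge0//.
by rewrite mulrCA ler_wpM2l// blin_le.
Qed.

Definition bbil_pairl X (T : blin X U) y : blin X W :=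
  mk_blin (bbil_pairl_linear T y) (bbil_pairl_le T y).
Definition bbil_pairr X (x : U) (T : blin X V) : blin X W :=
  mk_blin (bbil_pairr_linear T x) (bbil_pairr_le T x).

(** Each term of the product rule is itself bounded bilinear, with values in a space of operators
    and with the same constant. This stability closes the induction in [Ck_bbil]. *)
Lemma bbil_pairl_bbil X : bounded_bilinear (@bbil_pairl X).
Proof.
split.
- by move=> y a S T; apply: blinP => h /=; rewrite (bbil_l Bb).
- by move=> T a y z; apply: blinP => h /=; rewrite (bbil_r Bb).
- exists bbil_const; first exact: bbil_const_ge0.
  move=> T y; apply: blin_norm_le; last exact: bbil_pairl_le.
  by rewrite !mulr_ge0// bbil_const_ge0.
Qed.
Lemma bbil_pairr_bbil X : bounded_bilinear (@bbil_pairr X).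
Proof.
split.
- by move=> T a x y; apply: blinP => h /=; rewrite (bbil_l Bb).
- by move=> x a S T; apply: blinP => h /=; rewrite (bbil_r Bb).
- exists bbil_const; first exact: bbil_const_ge0.
  move=> x T; apply: blin_norm_le => [|h]; first by rewrite !mulr_ge0// bbil_const_ge0.
  by rewrite [_ * `|x| * `|T|]mulrAC; exact: bbil_pairr_le.
Qed.

Lemma is_diff_bbil X (f : X -> U) (g : X -> V) (F : blin X U) (G : blin X V) x :
  is_diff x f F -> is_diff x g G ->
  is_diff x (fun y => B (f y) (g y)) (bbil_pairl F (g x) + bbil_pairr (f x) G).
Proof.
move=> dF dG; set M := bbil_const; have M0 : 0 <= M := bbil_const_ge0.
apply: is_diff_of_le => e e0.
(* [K] collects the factors of the remainders of [f] and [g], [L] the factor of the quadratic term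
   [B (F h) (G h)]. Each group is allotted [e / 2]; the added 1 makes the divisors positive. *)
pose K := M * (`|g x| + `|G| + 1 + (`|f x| + `|F|)) + 1.
have K0 : 0 < K by rewrite ltr_wpDl// mulr_ge0// !addr_ge0.
pose L := M * `|F| * `|G| + 1.
have L0 : 0 < L by rewrite ltr_wpDl// !mulr_ge0.
pose e1 := Num.min 1 (e / 2 / K).
have e10 : 0 < e1 by rewrite lt_min ltr01 !divr_gt0.
near=> h.
have h1 : `|h| <= 1 by near: h; exact: nbhs0_le.
have h2 : `|h| <= e / 2 / L by near: h; apply: nbhs0_le; rewrite !divr_gt0.
have rf : `|f (h + x) - f x - F h| <= e1 * `|h| by near: h; exact: is_diff_le.
have sg : `|g (h + x) - g x - G h| <= e1 * `|h| by near: h; exact: is_diff_le.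
rewrite -/(B (f (h + x)) _).
set r := f (h + x) - f x - F h in rf; set s := g (h + x) - g x - G h in sg.
have fE : f (h + x) = r + (f x + F h) by rewrite /r -[_ - _ - _]addrA -opprD subrK.
have gE : g (h + x) = g x + G h + s.
  by rewrite /s -[_ - _ - _]addrA -opprD [RHS]addrC subrK.
have -> : B (f (h + x)) (g (h + x)) - B (f x) (g x) -
    (bbil_pairl F (g x) + bbil_pairr (f x) G) h =
    B r (g (h + x)) + B (f x + F h) s + B (F h) (G h).
  rewrite {1}fE bbilDl -!addrA; congr (_ + _).
  clearbody r s; rewrite {1}gE bbilDr [in LHS]bbilDr !bbilDl /=.
  set a := B (f x) (g x); set b := B (F h) (g x).
  set c := B (f x) (G h); set d := B (F h) (G h).
  have -> : a + b + (c + d) = (a + (b + c)) + d by rewrite !addrA.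
  rewrite -opprD; set p := a + (b + c); set k := _ + _ s.
  by rewrite [LHS]addrC -(addrA p) addKr addrC.
have gle : `|g (h + x)| <= `|g x| + `|G| + 1.
  rewrite gE (le_trans (ler_normD _ _))// lerD//.
    rewrite (le_trans (ler_normD _ _))// lerD// (le_trans (blin_le _ _))//.
    by rewrite ler_piMr.
  rewrite (le_trans sg)// -[1]mulr1 ler_pM ?ge_min ?lexx// ltW//.
have fle : `|f x + F h| <= `|f x| + `|F|.
  rewrite (le_trans (ler_normD _ _))// lerD// (le_trans (blin_le _ _))//.
  by rewrite ler_piMr.
have e1K : K * e1 <= e / 2.
  by rewrite mulrC -ler_pdivlMr// ge_min lexx orbT.
have Lh : L * `|h| <= e / 2 by rewrite mulrC -ler_pdivlMr.
have B1 : `|B r (g (h + x))| <= M * (`|g x| + `|G| + 1) * (e1 * `|h|).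
  rewrite (le_trans (bbil_le _ _))// mulrAC ler_pM ?mulr_ge0// ler_wpM2l//.
have B2 : `|B (f x + F h) s| <= M * (`|f x| + `|F|) * (e1 * `|h|).
  by rewrite (le_trans (bbil_le _ _))// ler_pM ?mulr_ge0// ler_wpM2l.
have B3 : `|B (F h) (G h)| <= M * `|F| * `|G| * `|h| * `|h|.
  rewrite (le_trans (bbil_le _ _))//.
  have -> : M * `|F| * `|G| * `|h| * `|h| = M * (`|F| * `|h|) * (`|G| * `|h|) by ring.
  by rewrite ler_pM ?mulr_ge0// ?blin_le// ler_wpM2l// blin_le.
rewrite (le_trans (ler_normD _ _))// [e in leRHS]splitr mulrDl lerD//.
  rewrite (le_trans (ler_normD _ _))// (le_trans (lerD B1 B2))//.
  rewrite -mulrDl -mulrDr mulrA ler_wpM2r// (le_trans _ e1K)// ler_wpM2r ?(ltW e10)//.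
  by rewrite /K lerDl.
rewrite (le_trans B3)// ler_wpM2r// (le_trans _ Lh)// ler_wpM2r//.
by rewrite /L lerDl.
Unshelve. all: by end_near. Qed.

End BilinearCalculus.

Lemma Ck_cst n V W (U : set V) (c : W) : is_Ck n U (fun=> c).
Proof.
elim: n W c => [|n IH] W c /=; first by move=> x _; exact: cvg_cst.
by exists (fun=> 0); split => [x _|]; [exact: is_diff_cst | exact: IH].
Qed.

Lemma Ck_id n V (U : set V) : is_Ck n U id.
Proof.
case: n => [|n] /=; first by move=> x _; exact: cvg_id.
have il : linear (id : V -> V) by [].
have ib (x : V) : `|id x| <= 1 * `|x| by rewrite mul1r.
by exists (fun=> mk_blin il ib); split => [x _|]; [exact: is_diff_id | exact: Ck_cst].
Qed.

Lemma Ck_pred n V W (U : set V) (f : V -> W) : is_Ck n.+1 U f -> is_Ck n U f.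
Proof.
elim: n W f => [|n IH] W f [Df [dD CD]] /=.
  by move=> x /dD[/differentiable_continuous].
by exists Df; split => //; exact: IH.
Qed.

Lemma Ck_add n V W (U : set V) (f g : V -> W) :
  is_Ck n U f -> is_Ck n U g -> is_Ck n U (fun x => f x + g x).
Proof.
elim: n W f g => [|n IH] W f g /=.
  by move=> fc gc x Ux; apply: cvgD; [exact: fc | exact: gc].
move=> [Df [dD CD]] [Dg [dDg CDg]]; exists (fun x => Df x + Dg x); split.
  by move=> x Ux; apply: is_diffD; [exact: dD | exact: dDg].
exact: IH.
Qed.

Lemma bbil_cvg V U' V' W (B : U' -> V' -> W) (Bb : bounded_bilinear B)
  (f : V -> U') (g : V -> V') (x : V) : {for x, continuous f} ->
  {for x, continuous g} -> {for x, continuous (fun y => B (f y) (g y))}.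
Proof.
set M := bbil_const Bb; have M0 : 0 <= M := bbil_const_ge0 Bb.
move=> /cvgrPdist_le fc /cvgrPdist_le gc; apply/cvgrPdist_le => e e0.
pose K := M * (`|g x| + (`|f x| + 1)) + 1.
have K0 : 0 < K by rewrite ltr_wpDl// mulr_ge0// !addr_ge0.
pose e1 := Num.min 1 (e / K).
have e10 : 0 < e1 by rewrite lt_min ltr01 divr_gt0.
near=> t.
have ft : `|f x - f t| <= e1 by near: t; exact: fc.
have gt : `|g x - g t| <= e1 by near: t; exact: gc.
have ftn : `|f t| <= `|f x| + 1.
  have := ler_normB (f x) (f x - f t); rewrite opprB addrC subrK.
  by move=> /le_trans; apply; rewrite lerD// (le_trans ft)// ge_min lexx.
have -> : B (f x) (g x) - B (f t) (g t) = B (f x - f t) (g x) + B (f t) (g x - g t).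
  by rewrite (bbilBl Bb) (bbilBr Bb) addrA subrK.
have B1 : `|B (f x - f t) (g x)| <= M * e1 * `|g x|.
  by rewrite (le_trans (bbil_le _ _ _))// ler_wpM2r// ler_wpM2l.
have B2 : `|B (f t) (g x - g t)| <= M * (`|f x| + 1) * e1.
  by rewrite (le_trans (bbil_le _ _ _))// ler_pM ?mulr_ge0// ler_wpM2l.
rewrite (le_trans (ler_normD _ _))// (le_trans (lerD B1 B2))//.
have -> : M * e1 * `|g x| + M * (`|f x| + 1) * e1 =
  M * (`|g x| + (`|f x| + 1)) * e1 by ring.
have : K * e1 <= e by rewrite mulrC -ler_pdivlMr// ge_min lexx orbT.
by apply: le_trans; rewrite ler_wpM2r ?(ltW e10)// /K lerDl.
Unshelve. all: by end_near. Qed.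

(** The induction runs over all target spaces and bilinear maps at once, because the derivative
    pairs [Df] with [g] and [f] with [Dg] through operator-valued maps. *)
Lemma Ck_bbil n V U' V' W (B : U' -> V' -> W) (U : set V) (f : V -> U')
  (g : V -> V') : bounded_bilinear B -> is_Ck n U f -> is_Ck n U g ->
  is_Ck n U (fun x => B (f x) (g x)).
Proof.
elim: n U' V' W B f g => [|n IH] U' V' W B f g Bb.
  by move=> fc gc x Ux; apply: (bbil_cvg Bb); [exact: fc | exact: gc].
move=> fC gC; have [Df [dD CD]] := fC; have [Dg [dDg CDg]] := gC.
exists (fun x => bbil_pairl Bb (Df x) (g x) + bbil_pairr Bb (f x) (Dg x)).
split=> [x Ux|]; first by apply: is_diff_bbil; [exact: dD | exact: dDg].
apply: Ck_add.
  by apply: IH (Ck_pred gC) => //; exact: bbil_pairl_bbil.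
by apply: IH (Ck_pred fC) _ => //; exact: bbil_pairr_bbil.
Qed.

Fact blin_app_bbil V W : bounded_bilinear (fun (L : blin V W) x => L x).
Proof.
split.
- by [].
- by move=> L; exact: blin_is_linear.
- by exists 1 => // L x; rewrite mul1r blin_le.
Qed.

Lemma Ck_blin n V W W' (U : set V) (L : blin W W') (f : V -> W) :
  is_Ck n U f -> is_Ck n U (fun x => L (f x)).
Proof. by apply: Ck_bbil (Ck_cst _ _ L); exact: blin_app_bbil. Qed.

End Calculus.

(** * Smoothness of product, adjoint, inverse and matrix entries *)

Section SmoothAlgebra.
Context {R : realType} {A : cstarAlgType R}.
Local Notation A1 := (Defs_realify__canonical__normed_module_NormedModule A).

Definition amul (x y : A1) : A1 := (x : A) * (y : A).

Lemma rscaleE (t : R) (x : A1) : t *: x = (t%:S : A) * (x : A) :> A.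
Proof. by rewrite rscE. Qed.

Lemma amul_bbil : bounded_bilinear amul.
Proof.
split.
- by move=> y a x x'; rewrite /amul rscaleE mulrDl -mulrA -rscaleE.
- by move=> x a y y'; rewrite /amul rscaleE mulrDr mulrA rscC -mulrA -rscaleE.
- by exists 1 => // x y; rewrite mul1r; exact: cnormM.
Qed.

Fact star_linear : linear (star : A1 -> A1).
Proof. by move=> a x y; rewrite starD rscaleE starM star_rsc rscC -rscaleE. Qed.
Fact star_le (x : A1) : `|star x : A1| <= 1 * `|x|.
Proof. by rewrite mul1r -[`|star x : A1|]/(cnorm (star x)) cnorm_star. Qed.
Definition star_blin : blin A1 A1 := mk_blin star_linear star_le.

Fact rsc_linear : linear (rsc : R -> A1).
Proof. by move=> a x y; rewrite rscD rscM -rscaleE. Qed.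
Fact rsc_le (t : R) : `|rsc t : A1| <= 1 * `|t|.
Proof. by rewrite mul1r -[`|rsc t : A1|]/(cnorm (rsc t)) cnorm_rsc. Qed.
Definition rsc_blin : blin R A1 := mk_blin rsc_linear rsc_le.

Fact entry_linear m n i j : linear (fun M : mx_realify A m n => M i j : A1).
Proof. by move=> a M N; rewrite !mxE. Qed.
Fact entry_le m n i j (M : mx_realify A m n) : `|M i j : A1| <= 1 * `|M|.
Proof. by rewrite mul1r; exact: le_mx_rnorm. Qed.
Definition entry_blin m n i j : blin (mx_realify A m n) A1 :=
  mk_blin (@entry_linear m n i j) (@entry_le m n i j).

Definition inj_mx m n (i : 'I_m) (j : 'I_n) (x : A1) : mx_realify A m n :=
  \matrix_(k, l) if (k == i) && (l == j) then x : A else 0.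
Fact inj_mx_linear m n i j : linear (@inj_mx m n i j).
Proof.
move=> a x y; apply/matrixP => k l; rewrite !mxE.
by case: ifP => // _; rewrite ?scaler0 ?addr0.
Qed.
Fact inj_mx_le m n i j (x : A1) : `|@inj_mx m n i j x| <= 1 * `|x|.
Proof.
rewrite mul1r; apply: mx_rnorm_le => // k l; rewrite mxE.
by case: ifP => // _; rewrite cnorm0 cnorm_ge0.
Qed.
Definition inj_mx_blin m n i j : blin A1 (mx_realify A m n) :=
  mk_blin (@inj_mx_linear m n i j) (@inj_mx_le m n i j).

(** Writing [- a h a] as nested products with [- 1] as a factor makes it convertible to the nested
    pairings that serve as derivative in [Ck_inv]. *)
Fact dinv_linear (a : A) : linear (fun h : A1 => (- 1 * a) * (h * a) : A1).
Proof.
move=> t x y; rewrite rscaleE [in RHS]rscaleE mulrDl mulrDr -[_%:S * _ * a]mulrA.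
by congr (_ + _); rewrite [LHS]mulrA rscC !mulrA.
Qed.
Fact dinv_le (a : A) (h : A1) :
  `|(- 1 * a) * (h * a) : A1| <= cnorm a * cnorm a * `|h|.
Proof.
rewrite (le_trans (cnormM _ _))// mulN1r cnormN -mulrA ler_wpM2l ?cnorm_ge0//.
by rewrite mulrC; exact: cnormM.
Qed.
Definition dinv_blin a : blin A1 A1 := mk_blin (dinv_linear a) (dinv_le a).

(** From [(h + a)^-1 = a^-1 - (h + a)^-1 h a^-1], the norm of the new inverse is at most that of
    [a^-1] plus half of itself. *)
Lemma cnorm_inv_near (a h : A) : a \is a GRing.unit ->
  cnorm h * cnorm a^-1 <= 2^-1 ->
  h + a \is a GRing.unit /\ cnorm (h + a)^-1 <= 2 * cnorm a^-1.
Proof.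
move=> au ha; have hu : h + a \is a GRing.unit.
  by apply: unit_near au _; rewrite addrK (le_lt_trans ha)// invf_lt1// ltr1n.
split=> //; have E : (h + a)^-1 = a^-1 - (h + a)^-1 * (h * a^-1).
  have -> : h * a^-1 = (h + a) * a^-1 - 1 by rewrite mulrDl divrr// addrK.
  by rewrite mulrBr mulr1 mulKr// opprB [RHS]addrC subrK.
have := cnormD a^-1 (- ((h + a)^-1 * (h * a^-1))); rewrite -E cnormN.
have := cnormM (h + a)^-1 (h * a^-1); have := cnormM h a^-1.
have := cnorm_ge0 (h + a)^-1; nra.
Qed.

Lemma is_diff_inv (a : A) : a \is a GRing.unit ->
  is_diff (a : A1) (fun x : A1 => (x : A)^-1 : A1) (dinv_blin a^-1).
Proof.
move=> au; apply: is_diff_of_le => e e0.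
set k := cnorm a^-1; have k0 : 0 <= k := cnorm_ge0 _.
(* The remainder is [(h + a)^-1 (h a^-1)^2], at most [2 k^3 |h|^2] once [|h| k <= 1/2]. *)
pose K := 2 * (k * k * k) + 1.
have K0 : 0 < K by rewrite ltr_wpDl// !mulr_ge0.
have k1 : 0 < 2^-1 / (k + 1) by rewrite divr_gt0 ?invr_gt0// ltr_wpDl.
near=> h.
have h1 : `|h| <= e / K.
  by near: h; exact: (near0_norm_le A1 (divr_gt0 e0 K0)).
have h2 : `|h| <= 2^-1 / (k + 1).
  by near: h; exact: (near0_norm_le A1 k1).
have [|hu hn] := @cnorm_inv_near a h au.
  have : `|h| * (k + 1) <= 2^-1 by rewrite -ler_pdivlMr// ltr_wpDl.
  have := normr_ge0 h; rewrite -/k -[cnorm h]/`|h|; nra.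
have E : (h + a : A)^-1 - a^-1 - (-1 * a^-1) * (h * a^-1) =
    (h + a)^-1 * (h * a^-1) * (h * a^-1).
  have hE : h * a^-1 = (h + a) * a^-1 - 1 by rewrite mulrDl divrr// addrK.
  rewrite {2 3}hE.
  have -> : (h + a)^-1 * ((h + a) * a^-1 - 1) * ((h + a) * a^-1 - 1) =
    ((h + a)^-1 * (h + a)) * a^-1 * ((h + a) * a^-1) - ((h + a)^-1 * (h + a)) * a^-1
    - ((h + a)^-1 * (h + a)) * a^-1 + (h + a)^-1.
    by non_commutative_ring.
  rewrite mulVr// mul1r [in LHS]hE; non_commutative_ring.
rewrite -[X in `|X|]/((h + a : A)^-1 - a^-1 - (-1 * a^-1) * (h * a^-1) : A1) E.
rewrite -[`|_|]/(cnorm _).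
have n1 := cnormM ((h + a)^-1 * (h * a^-1)) (h * a^-1).
have n2 := cnormM (h + a)^-1 (h * a^-1).
have n3 : cnorm (h * a^-1) <= `|h| * k := cnormM h a^-1.
have n4 := cnorm_ge0 (h * a^-1).
have n5 : cnorm (h * a^-1) * cnorm (h * a^-1) <= (`|h| * k) * (`|h| * k).
  by rewrite ler_pM.
have n6 : cnorm (h + a)^-1 * (cnorm (h * a^-1) * cnorm (h * a^-1)) <=
    (2 * k) * ((`|h| * k) * (`|h| * k)).
  by rewrite ler_pM ?mulr_ge0 ?cnorm_ge0.
rewrite (le_trans n1)//.
rewrite (le_trans (ler_wpM2r n4 n2))// -mulrA (le_trans n6)//.
have -> : 2 * k * (`|h| * k * (`|h| * k)) = (2 * (k * k * k)) * `|h| * `|h| by ring.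
rewrite ler_wpM2r//; have : K * `|h| <= e by rewrite mulrC -ler_pdivlMr.
by apply: le_trans; rewrite ler_wpM2r// /K lerDl.
Unshelve. all: by end_near. Qed.

Context {V : normedModType R}.
Implicit Types (U : set V) (f g : V -> A1).

(** The derivative is a product of [Df] and two copies of the inverse, to which the induction
    hypothesis applies one order lower. *)
Lemma Ck_inv n U f : (forall x, U x -> (f x : A) \is a GRing.unit) ->
  is_Ck n U f -> is_Ck n U (fun x => (f x : A)^-1 : A1).
Proof.
move=> fu; elim: n => [|n IH].
  move=> fc x Ux.
  have := is_diff_inv (fu _ Ux) => -[/differentiable_continuous ic _].
  by apply: continuous_comp; [exact: fc | exact: ic].
move=> fC; have := IH (Ck_pred fC) => iC; have [Df [dD CD]] := fC.
exists (fun x => bbil_pairr amul_bbil (amul (-1) (f x : A)^-1)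
  (bbil_pairl amul_bbil (Df x) (f x : A)^-1)); split=> [x Ux|].
  exact: is_diff_comp (dD _ Ux) (is_diff_inv (fu _ Ux)).
apply: (Ck_bbil (bbil_pairr_bbil amul_bbil V)).
  exact: (Ck_bbil amul_bbil (Ck_cst _ _ _)).
exact: (Ck_bbil (bbil_pairl_bbil amul_bbil V)).
Qed.

Lemma smooth_inv U f : (forall x, U x -> (f x : A) \is a GRing.unit) ->
  is_Cinfty U f -> is_Cinfty U (fun x => (f x : A)^-1 : A1).
Proof. by move=> fu fC n; exact: Ck_inv. Qed.

Lemma smooth_add U f g : is_Cinfty U f -> is_Cinfty U g ->
  is_Cinfty U (fun x => (f x : A) + g x : A1).
Proof. by move=> fC gC n; exact: Ck_add. Qed.

Lemma smooth_mul U f g : is_Cinfty U f -> is_Cinfty U g ->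
  is_Cinfty U (fun x => (f x : A) * g x : A1).
Proof. by move=> fC gC n; apply: (Ck_bbil amul_bbil). Qed.

Lemma smooth_cst U (c : A) : is_Cinfty U (fun=> c : A1).
Proof. by move=> n; exact: Ck_cst. Qed.

Lemma smooth_opp U f : is_Cinfty U f -> is_Cinfty U (fun x => - (f x : A) : A1).
Proof.
move=> fC; rewrite (_ : (fun x => _) = fun x => (- 1 : A) * f x : A1).
  exact: smooth_mul (smooth_cst _ _) fC.
by apply/funext => x; rewrite mulN1r.
Qed.

Lemma smooth_star U f : is_Cinfty U f -> is_Cinfty U (fun x => star (f x : A) : A1).
Proof. by move=> fC n; exact: (Ck_blin star_blin). Qed.

Lemma smooth_entry m n U (F : V -> mx_realify A m n) i j :
  is_Cinfty U F -> is_Cinfty U (fun x => F x i j : A1).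
Proof. by move=> fC k; exact: (Ck_blin (entry_blin i j)). Qed.

Lemma smooth_mx m n U (F : V -> mx_realify A m n) :
  (forall i j, is_Cinfty U (fun x => F x i j : A1)) -> is_Cinfty U F.
Proof.
move=> FC k.
have sumC (I : Type) (r : seq I) (G : I -> V -> mx_realify A m n) :
    (forall i, is_Ck k U (G i)) -> is_Ck k U (fun x => \sum_(i <- r) G i x).
  move=> GC; elim: r => [|i r IH].
    rewrite (_ : (fun x => _) = fun=> 0); first exact: Ck_cst.
    by apply/funext => x; rewrite big_nil.
  rewrite (_ : (fun x => _) = fun x => G i x + \sum_(i <- r) G i x).
    exact: Ck_add.
  by apply/funext => x; rewrite big_cons.
rewrite (_ : F = fun x => \sum_i \sum_j inj_mx_blin i j (F x i j)).
  apply: (sumC _ _ _) => i; apply: (sumC _ _ _) => j; apply: Ck_blin; exact: FC.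
apply/funext => x; apply/matrixP => i j.
rewrite summxE (bigD1 i)//= summxE (bigD1 j)//= mxE !eqxx /=.
rewrite big1 => [|l lj]; last by rewrite mxE eq_sym (negPf lj) andbF.
rewrite big1 => [|l li]; first by rewrite !addr0.
by rewrite summxE big1// => l' _; rewrite mxE eq_sym (negPf li).
Qed.

Lemma smooth_id U : is_Cinfty U id.
Proof. by move=> n; exact: Ck_id. Qed.

Lemma smooth_rsc (U : set R) : is_Cinfty U (fun t : R => t%:S : A1).
Proof. by move=> n; apply: (Ck_blin rsc_blin); exact: Ck_id. Qed.

End SmoothAlgebra.

(** * Submanifolds, tangent vectors and submersions *)

Section ManifoldTools.
Context {R : realType}.
Implicit Types (V W E : normedModType R).

Lemma is_diff_differentiable V W (f df : V -> W) x : is_diff x f df -> differentiable f x.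
Proof. by case. Qed.

Lemma smooth_continuous V W (U : set V) (f : V -> W) x :
  is_Cinfty U f -> U x -> {for x, continuous f}.
Proof. by move=> /(_ 0%N); exact. Qed.

Lemma open_preimage V W (U : set V) (f : V -> W) (O : set W) : open U ->
  is_Cinfty U f -> open O -> open [set x | U x /\ O (f x)].
Proof.
move=> oU fC oO; rewrite openE => x [Ux Ox]; rewrite /interior.
have nU : nbhs x U by apply: open_nbhs_nbhs.
have nO : nbhs x (f @^-1` O).
  by apply: (smooth_continuous fC Ux); apply: open_nbhs_nbhs.
exact: filterI nU nO.
Qed.

Lemma open_norm_lt V (r : R) : open [set x : V | `|x| < r].
Proof.
have := @open_comp V R^o (fun x => `|x|) [set t : R | t < r].
by apply; [move=> x _; exact: norm_continuous | exact: open_lt].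
Qed.

Lemma closed_subspace_ker V W (L : blin V W) : closed_subspace [set v | L v = 0].
Proof.
split=> [|a x y /= x0 y0|]; first exact: linear0.
  by rewrite linearP/= x0 y0 scaler0 addr0.
have := @closed_comp _ _ L [set 0] (fun x _ => @blin_continuous _ _ _ L x).
by apply; apply: accessible_closed_set1; exact: hausdorff_accessible.
Qed.

Lemma closed_subspaceI V (F G : set V) : closed_subspace F -> closed_subspace G ->
  closed_subspace (F `&` G).
Proof.
move=> [F0 FD Fc] [G0 GD Gc]; split=> //.
  by move=> a x y [Fx Gx] [Fy Gy]; split; [exact: FD | exact: GD].
exact: closedI.
Qed.

(** [F] is the range of [P] inside [T]: it is closed as the intersection of [T] with the kernel of
    [1 - P], and the kernel of [P] supplies the complement. *)
Lemma complemented_proj V (T F : set V) (P : blin V V) : closed_subspace T ->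
  (forall v, P (P v) = P v) -> (forall v, T v -> T (P v)) ->
  (forall v, F v <-> T v /\ P v = v) -> complemented_in T F.
Proof.
move=> Tc PP TP FE.
have il : linear (id : V -> V) by [].
have ib (x : V) : `|id x| <= 1 * `|x| by rewrite mul1r.
pose Q : blin V V := mk_blin il ib - P.
have QE v : Q v = v - P v by [].
have FE' : F = T `&` [set v | Q v = 0].
  apply/seteqP; split => [v /FE[Tv Pv]|v [Tv Qv]].
    by split => //; have := QE v; rewrite Pv subrr.
  by apply/FE; split => //; apply/esym/eqP; rewrite -subr_eq0 -QE; exact/eqP.
split.
- by rewrite FE'; apply: closed_subspaceI => //; exact: closed_subspace_ker.
- by move=> v /FE[].
exists (T `&` [set v | P v = 0]); split.
- by apply: closed_subspaceI => //; exact: closed_subspace_ker.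
- by move=> v [].
- apply/seteqP; split => v /=.
    by move=> [/FE[_ Pv] [_ P0]]; rewrite -Pv P0.
  by move=> ->; have [T0 _ _] := Tc; split; [apply/FE|]; split => //; exact: linear0.
- move=> v Tv; exists (P v), (v - P v).
  have [_ TD _] := Tc.
  split; last by rewrite addrC subrK.
    by apply/FE; split; [exact: TP | exact: PP].
  split; last by rewrite /= linearB/= PP subrr.
  by rewrite -scaleN1r addrC; apply: TD => //; exact: TP.
Qed.

Lemma closed_subspaceT V : closed_subspace (setT : set V).
Proof. by split => //; exact: closedT. Qed.

Lemma open_submanifold V (X : set V) : open X -> is_submanifold X.
Proof.
move=> oX x Xx; exists X, X, id, id, setT; split => //.
- split => //; split; exact: (fun n => Ck_id n _).
- have il : linear (id : V -> V) by [].
  have ib (y : V) : `|id y| <= 1 * `|y| by rewrite mul1r.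
  by apply: (@complemented_proj _ _ _ (mk_blin il ib)) => //; exact: closed_subspaceT.
Qed.

Lemma is_diff_curve V W (X : set V) (x v : V) (c : R -> V) (f : V -> W) (F : blin V W) :
  curve_through X x c -> is_derive (0 : R) (1 : R) c v -> is_diff x f F ->
  exists2 L : blin R W, is_diff (0 : R) (f \o c) L & L 1 = F v.
Proof.
move=> [c0 [I [oI I0 cC _]]] [_ cv] fF.
have [Dc [/(_ _ I0) dc _]] := cC 1%N.
have Dv : Dc 0 1 = v.
  by rewrite -cv deriveE; [case: dc => _ -> | case: dc].
rewrite -c0 in fF; have dfc := is_diff_comp dc fF.
have fcl : linear (F \o Dc 0) by move=> a s t /=; rewrite !linearP.
have fcb (t : R) : `|(F \o Dc 0) t| <= `|F| * `|Dc 0| * `|t|.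
  by rewrite (le_trans (blin_le _ _))// -mulrA ler_wpM2l// blin_le.
by exists (mk_blin fcl fcb) => //=; rewrite Dv.
Qed.

Lemma is_diff_is_derive V (f : R -> V) (L : R -> V) : is_diff (0 : R) f L ->
  is_derive (0 : R) (1 : R) f (L 1).
Proof.
move=> fL; have df := is_diff_differentiable fL.
by split; [exact: diff_derivable | rewrite deriveE//; case: fL => _ ->].
Qed.

(** For a map differentiable on the ambient space the relation defined by curves becomes the
    restriction of a linear map; the submersion conditions thereby turn into linear algebra. *)
Lemma tangent_mapE V W (X : set V) (f : V -> W) (F : blin V W) x v w :
  is_diff x f F ->
  tangent_map X f x v w <-> tangent_space X x v /\ F v = w.
Proof.
move=> fF; split.
  move=> [c [cX cv [_ cw]]]; split; first by exists c.
  have [L dL <-] := is_diff_curve cX cv fF.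
  by have [_ <-] := is_diff_is_derive dL.
move=> [[c [cX cv]] <-]; exists c; split=> //.
by have [L dL <-] := is_diff_curve cX cv fF; exact: is_diff_is_derive.
Qed.

Lemma is_diff_const_near W (f : R -> W) (L : blin R W) (I : set R) :
  open I -> I 0 -> (forall t, I t -> f t = f 0) -> is_diff (0 : R) f L -> L 1 = 0.
Proof.
move=> oI I0 fI fL; apply/eqP; rewrite -normr_le0; apply/ler_addgt0Pr => e e0.
rewrite add0r.
have nI : nbhs (0 : R) I by apply: open_nbhs_nbhs.
have nE : nbhs (0 : R) [set h | `|f (h + 0) - f 0 - L h| <= e * `|h|].
  exact: (is_diff_le fL e0).
have [d /= d0 dI] := proj1 (@nbhs_ballP R R^o 0 _) (filterI nI nE).
have d2 : 0 < d / 2 by rewrite divr_gt0.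
have [|Id] := dI (d / 2).
  by rewrite /ball /= sub0r normrN gtr0_norm// ltr_pdivrMr// ltr_pMr// ltr1n.
rewrite /= addr0 fI// subrr sub0r normrN => LI.
rewrite -(ler_pM2r d2); move: LI.
rewrite (gtr0_norm d2) -{1}[d / 2]mulr1 -[_ * 1]/(_ *: (1 : R)) linearZ normrZ.
by rewrite gtr0_norm// mulrC.
Qed.

(** Differentiates along curves an equation satisfied on [X]; every necessary condition on tangent
    vectors comes from here. *)
Lemma tangent_const V W (X : set V) (x v : V) (G : V -> W) (F : blin V W) :
  tangent_space X x v -> is_diff x G F -> (forall y, X y -> G y = G x) -> F v = 0.
Proof.
move=> [c [cX cv]] GF GX; have [L dL <-] := is_diff_curve cX cv GF.
have [c0 [I [oI I0 _ IX]]] := cX.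
apply: (is_diff_const_near oI I0) dL => t It /=.
by rewrite GX ?c0//; exact: IX.
Qed.

Lemma submersion_intro V W (X : set V) (Y : set W) (f : V -> W)
  (Df : V -> blin V W) : is_submanifold X -> is_submanifold Y ->
  is_smooth_map X Y f -> (forall x, X x -> is_diff x f (Df x)) ->
  (forall x w, X x -> tangent_space Y (f x) w ->
    exists2 v, tangent_space X x v & Df x v = w) ->
  (forall x, X x -> complemented_in (tangent_space X x)
    [set v | tangent_space X x v /\ Df x v = 0]) ->
  is_submersion X Y f.
Proof.
move=> Xm Ym fm fD fs fk; split=> // x Xx; split.
  move=> w /(fs _ _ Xx)[v Tv vw]; exists v.
  by apply/(tangent_mapE _ _ _ (fD _ Xx)).
rewrite (_ : [set v | _] = [set v | tangent_space X x v /\ Df x v = 0]).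
  exact: fk.
by apply/seteqP; split => v /=; rewrite (tangent_mapE _ _ _ (fD _ Xx)).
Qed.

Lemma is_diff_addl V W (f F : V -> W) (c : W) x : is_diff x f F ->
  is_diff x (fun y => c + f y) F.
Proof.
move=> fF; have := is_diffD (is_diff_cst c x) fF.
by rewrite add0r.
Qed.

Fact blin_comp_linear V W E (L : blin W E) (F : blin V W) : linear (fun v => L (F v)).
Proof. by move=> a x y; rewrite !linearP. Qed.
Fact blin_comp_le V W E (L : blin W E) (F : blin V W) v :
  `|L (F v)| <= `|L| * `|F| * `|v|.
Proof. by rewrite (le_trans (blin_le _ _))// -mulrA ler_wpM2l// blin_le. Qed.
Definition blin_comp V W E (L : blin W E) (F : blin V W) : blin V E :=
  mk_blin (blin_comp_linear L F) (blin_comp_le L F).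

End ManifoldTools.

(** * Algebra of the form: the disk, the hyperboloid and the reflections *)

Section KreinAlgebra.
Context {R : realType} {A : cstarAlgType R}.
Implicit Types (x y h n : 'cV[A]_2) (g eps : 'M[A]_2) (a z w : A).

Lemma rhoDE : rhoD = mx2 1 0 0 (- 1) :> 'M[A]_2.
Proof. by apply: mx2P; rewrite mx2E !mxE /= ?mulr1n ?mulr0n ?expr0 ?expr1. Qed.

Lemma one_mx2 : 1%:M = mx2 1 0 0 1 :> 'M[A]_2.
Proof. by apply: mx2P; rewrite mx2E mxE. Qed.

Lemma mx_star_rhoD : mx_star rhoD = rhoD :> 'M[A]_2.
Proof.
by rewrite rhoDE; apply: mx2P; rewrite mx_starE !mx2E ?starN ?star0 ?star1.
Qed.

Lemma rhoD2 : rhoD *m rhoD = 1%:M :> 'M[A]_2.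
Proof.
rewrite rhoDE one_mx2; apply: mx2P;
  by rewrite mul2E !mx2E ?(mulr0, mul0r, mulr1, addr0, add0r) ?mulrNN ?mulr1.
Qed.

Lemma thetaDE x y : mx_star x *m rhoD *m y = (thetaD x y)%:M.
Proof.
apply/matrixP => i j; rewrite !ord1 rhoDE !mul2E !mx_starE !mx2E mxE eqxx mulr1n.
by rewrite !mulr0 addr0 add0r mulr1 mulrN1 mulNr.
Qed.

Definition cvscale x a : 'cV[A]_2 := x *m a%:M.

Lemma cvscaleE x a i : cvscale x a i 0 = x i 0 * a.
Proof. by rewrite mxE big_ord1 mxE eqxx mulr1n. Qed.

Lemma thetaDl x y h : thetaD (x + y) h = thetaD x h + thetaD y h.
Proof. by rewrite /thetaD !mxE !starD; non_commutative_ring. Qed.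
Lemma thetaDr x y h : thetaD h (x + y) = thetaD h x + thetaD h y.
Proof. by rewrite /thetaD !mxE; non_commutative_ring. Qed.
Lemma thetaD_scaler x y a : thetaD x (cvscale y a) = thetaD x y * a.
Proof. by rewrite /thetaD !cvscaleE; non_commutative_ring. Qed.
Lemma thetaD_scalel x y a : thetaD (cvscale x a) y = star a * thetaD x y.
Proof. by rewrite /thetaD !cvscaleE !starM; non_commutative_ring. Qed.
Lemma star_thetaD x y : star (thetaD x y) = thetaD y x.
Proof. by rewrite /thetaD starB !starM !starK. Qed.

(** This is [theta(x, x) = 1] divided on both sides by the first entry. The right-hand side is
    bounded below, which puts [phi_hat x] in the disk, and its inverse is the [x_1 x_1^*] of
    [disk_param]. *)
Lemma KD_sub1 x : KD x ->
  1 - star (phi_hat x) * phi_hat x = star (x 0 0)^-1 * (x 0 0)^-1.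
Proof.
move=> [xx xu]; have := xx; rewrite /thetaD => tE.
rewrite /phi_hat starM.
have -> : star (x 0 0)^-1 * star (x 1 0) * (x 1 0 * (x 0 0)^-1) =
   star (x 0 0)^-1 * (star (x 0 0) * x 0 0 - 1) * (x 0 0)^-1.
  by rewrite -tE; non_commutative_ring.
rewrite mulrBr mulr1 mulrBl mulrA -starM divrr// star1 mul1r divrr//.
by rewrite opprB addrC subrK.
Qed.

Lemma disk_phi_hat x : KD x -> disk (phi_hat x).
Proof.
move=> Kx; have [_ xu] := Kx.
have [|d d0 pd] := @pos_starM_unit _ _ (x 0 0)^-1; first by rewrite unitrV.
by apply: (cnorm_lt1 d0); rewrite KD_sub1.
Qed.

Lemma disk_sub1_unit z : disk z -> 1 - star z * z \is a GRing.unit.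
Proof.
move=> z1; apply: neumann.
by rewrite cnorm_starM -(expr1n _ 2) ltr_pXn2r// ?nnegrE ?cnorm_ge0.
Qed.

Lemma phi_hat_surj z : disk z -> exists x, KD x /\ phi_hat x = z.
Proof.
move=> z1; have qu := disk_sub1_unit z1.
have [c [cs cc _]] := pos_sqrt (pos_sub1_starM (ltW z1)).
have cu : c \is a GRing.unit.
  by move: qu; rewrite -cc unitrM_comm// => /andP[].
(* The factor [c^-1], with [c] the root of [1 - z^* z], normalizes the column with entries [1] and
   [z]. *)
exists (cv2 c^-1 (z * c^-1)); rewrite /phi_hat !cv2E; split; last first.
  by rewrite -mulrA divrr ?unitrV// mulr1.
split; rewrite /thetaD /= ?cv2E ?unitrV//.
rewrite starM starV// cs.
have -> : c^-1 * c^-1 - c^-1 * star z * (z * c^-1) = c^-1 * (1 - star z * z) * c^-1.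
  by non_commutative_ring.
by rewrite -cc mulrA mulVr// mul1r divrr.
Qed.

(* [2 p_x - 1] as a function of [z = phi_hat x], through
   [x_1 x_1^* = (1 - z^* z)^-1] and [x_2 = z x_1]. *)
Definition disk_param z : 'M[A]_2 :=
  let q := (1 - star z * z)^-1 in
  mx2 (q + q - 1) (- (q * star z + q * star z))
    (z * q + z * q) (- (1 + (z * q * star z + z * q * star z))).

Lemma phi_tildeE x : KD x -> phi_tilde x = disk_param (phi_hat x).
Proof.
move=> Kx; have [_ xu] := Kx; set z := phi_hat x.
have qE : (1 - star z * z)^-1 = x 0 0 * star (x 0 0).
  rewrite KD_sub1// invrM ?unitrV ?star_unit ?unitrV//.
  by rewrite invrK -starV ?unitrV// invrK.
have x1 : x 1 0 = z * x 0 0 by rewrite /z /phi_hat mulrVK.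
rewrite /phi_tilde /Defs.proj /disk_param qE.
have P i j : (x *m mx_star x) i j = x i 0 * star (x j 0).
  by rewrite mxE big_ord1 mx_starE.
rewrite mulr2n one_mx2 rhoDE.
apply: mx2P; rewrite !mx2E [LHS]mxE [(_ + _ : 'M_2) _ _]mxE [(- _ : 'M_2) _ _]mxE;
  by rewrite mul2E !mx2E !P ?x1 ?starM; non_commutative_ring.
Qed.

Lemma PhiDE z : disk z -> PhiD z = disk_param z.
Proof.
move=> /phi_hat_surj[x [Kx xz]]; rewrite /PhiD.
case: xgetP => [y _ [Ky yz]|/(_ x)]; first by rewrite phi_tildeE// yz.
by case.
Qed.

Lemma PhiD_phi_hat x : KD x -> PhiD (phi_hat x) = phi_tilde x.
Proof. by move=> Kx; rewrite PhiDE ?phi_tildeE//; exact: disk_phi_hat. Qed.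

Lemma idem_involution (B : nzRingType) (p : B) : p * p = p ->
  (p *+ 2 - 1) * (p *+ 2 - 1) = 1.
Proof.
move=> pp; rewrite mulr2n.
have -> : (p + p - 1) * (p + p - 1) =
  (p * p + p * p + p * p + p * p) - (p + p + p + p) + 1 by non_commutative_ring.
by rewrite pp subrr add0r.
Qed.

Lemma projK x : KD x -> Defs.proj x *m Defs.proj x = Defs.proj x.
Proof.
move=> [xx _]; rewrite /Defs.proj.
have -> : x *m mx_star x *m rhoD *m (x *m mx_star x *m rhoD) =
  x *m (mx_star x *m rhoD *m x) *m (mx_star x *m rhoD) by rewrite !mulmxA.
by rewrite thetaDE xx mulmx1 mulmxA.
Qed.

Lemma mx_star_proj x : rhoD *m Defs.proj x = mx_star (rhoD *m Defs.proj x).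
Proof. by rewrite /Defs.proj !mx_starM mx_starK mx_star_rhoD !mulmxA. Qed.

(** Orthogonality to [x] means [n 0 0 = star z * n 1 0], which makes [- thetaD n n] a congruence of
    [1 - z * star z]. *)
Lemma neg_theta_pos x n : KD x -> thetaD x n = 0 -> pos (- thetaD n n).
Proof.
move=> Kx xn; have [_ xu] := Kx; set z := phi_hat x.
have x1 : x 1 0 = z * x 0 0 by rewrite /z /phi_hat mulrVK.
have n0 : n 0 0 = star z * n 1 0.
  apply: (mulrI (star_unit xu)); apply/eqP; rewrite -subr_eq0 mulrA -starM -x1.
  exact/eqP.
have -> : - thetaD n n = star (n 1 0) * (1 - z * star z) * n 1 0.
  by rewrite /thetaD n0 starM starK; non_commutative_ring.
apply: pos_conj; rewrite -{1}[z]starK; apply: pos_sub1_starM.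
by rewrite cnorm_star ltW//; exact: disk_phi_hat.
Qed.

(** [phi_tilde x] is the reflection that fixes [x A] and reverses its orthogonal complement; so [h]
    is split as [x a] plus an orthogonal column, on which the sign of [thetaD] changes. *)
Lemma qform_rhoD_phi_tilde x h : KD x -> let a := thetaD x h in
  qform (rhoD *m phi_tilde x) h =
  star a * a - thetaD (h - cvscale x a) (h - cvscale x a).
Proof.
move=> [xx _] a.
have -> : rhoD *m phi_tilde x = rhoD *m x *m mx_star x *m rhoD +
    rhoD *m x *m mx_star x *m rhoD - rhoD.
  by rewrite /phi_tilde /Defs.proj mulr2n mulmxBr mulmxDr mulmx1 !mulmxA.
have E : qform (rhoD *m x *m mx_star x *m rhoD) h = star a * a.
  rewrite /qform.
  have -> : mx_star h *m (rhoD *m x *m mx_star x *m rhoD) *m h =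
    (mx_star h *m rhoD *m x) *m (mx_star x *m rhoD *m h) by rewrite !mulmxA.
  by rewrite !thetaDE -scalar_mxM mxE eqxx mulr1n star_thetaD.
have E2 : qform (- rhoD) h = - thetaD h h.
  by rewrite /qform mulmxN mulNmx thetaDE !mxE eqxx mulr1n.
rewrite !qformD E E2 -[- cvscale x a](_ : cvscale x (- a) = _).
  rewrite thetaDl !thetaDr !thetaD_scaler !thetaD_scalel xx -/a.
  by rewrite -(star_thetaD x h) -/a starN; non_commutative_ring.
by apply: cv2P; rewrite !mxE !big_ord1 !mxE eqxx !mulr1n mulrN.
Qed.

Lemma QrhoD_phi_tilde x : KD x -> QrhoD (phi_tilde x).
Proof.
move=> Kx; have [xx _] := Kx.
have ee : phi_tilde x *m phi_tilde x = 1%:M.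
  exact: (@idem_involution 'M[A]_2 _ (projK Kx)).
split=> //; apply/Gl2_posP.
have ms : mx_star (rhoD *m phi_tilde x) = rhoD *m phi_tilde x.
  rewrite /phi_tilde mulr2n mulmxBr mulmx1 mulmxDr mx_starD mx_starN mx_starD.
  by rewrite -mx_star_proj mx_star_rhoD.
(* Both [rhoD] and [phi_tilde x] are involutions, so the inverse is their product in the other
   order, and positivity alone yields the lower bound. *)
split=> //; apply: (@mpos_inverse_gap _ _ _ (phi_tilde x *m rhoD)); last first.
  split; last by rewrite mulmxA -(mulmxA (phi_tilde x)) rhoD2 mulmx1.
  by rewrite mulmxA -(mulmxA rhoD) ee mulmx1 rhoD2.
split=> // h; rewrite qform_rhoD_phi_tilde//; set a := thetaD x h.
apply: posD; first exact: pos_starM.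
apply: (neg_theta_pos Kx).
rewrite -[- cvscale x a](_ : cvscale x (- a) = _).
  by rewrite thetaDr thetaD_scaler xx mul1r subrr.
by apply: cv2P; rewrite !mxE !big_ord1 !mxE eqxx !mulr1n mulrN.
Qed.

(** For [eps = 2 p_x - 1] the factors are [2 x_2 x_1^*] and the inverse of [2 x_1 x_1^*], with
    product [x_2 x_1^-1]. *)
Definition disk_coord eps : A := eps 1 0 * (1 + eps 0 0)^-1.

Lemma disk_paramK z : disk z -> disk_coord (disk_param z) = z.
Proof.
move=> z1; rewrite /disk_coord /disk_param !mx2E.
set q := (1 - star z * z)^-1; have qu : q \is a GRing.unit.
  by rewrite unitrV disk_sub1_unit.
have -> : 1 + (q + q - 1) = 2%:S * q.
  by rewrite [2]mulr2n rscD rsc1; non_commutative_ring.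
have -> : z * q + z * q = z * (2%:S * q).
  by rewrite [2]mulr2n rscD rsc1; non_commutative_ring.
by rewrite mulrK// unitrMl// rsc_unit ?pnatr_eq0.
Qed.

Lemma QrhoD_entries eps : QrhoD eps ->
  [/\ star (eps 0 0) = eps 0 0, star (eps 1 1) = eps 1 1,
      eps 0 1 = - star (eps 1 0) &
      exists2 d, 0 < d & pos (eps 0 0 - d%:S) /\ pos (- eps 1 1 - d%:S)].
Proof.
move=> [_ /Gl2_posP[ms [d d0 pd]]].
set m := rhoD *m eps in ms pd.
have m00 : m 0 0 = eps 0 0.
  by rewrite /m rhoDE mul2E !mx2E mul1r mul0r addr0.
have m01 : m 0 1 = eps 0 1.
  by rewrite /m rhoDE mul2E !mx2E mul1r mul0r addr0.
have m10 : m 1 0 = - eps 1 0.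
  by rewrite /m rhoDE mul2E !mx2E mulN1r mul0r add0r.
have m11 : m 1 1 = - eps 1 1.
  by rewrite /m rhoDE mul2E !mx2E mulN1r mul0r add0r.
have S i j : star (m j i) = m i j by rewrite -[in RHS]ms mx_starE.
split.
- by rewrite -m00 S.
- by apply: oppr_inj; rewrite -starN -m11 S.
- by rewrite -m01 -S m10 starN.
- by exists d => //; have := mpos_gap_diag pd; rewrite m00 m11.
Qed.

(** Positivity enters through the diagonal: [s = 1 + eps 0 0] is positive and invertible, and
    [1 - eps 1 1] is invertible. The rest follows from the entries of [eps^2 = 1] and the adjoint
    relations. *)
Lemma QrhoD_param eps : QrhoD eps ->
  [/\ 1 + eps 0 0 \is a GRing.unit, disk (disk_coord eps) &
      eps = disk_param (disk_coord eps)].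
Proof.
move=> Qe; have [s00 s11 e01 [d d0 [p0 p1]]] := QrhoD_entries Qe.
have [ee _] := Qe.
have E00 : eps 0 0 * eps 0 0 - star (eps 1 0) * eps 1 0 = 1.
  have : (eps *m eps) 0 0 = 1 by rewrite ee mxE.
  by rewrite mul2E e01 mulNr.
have E10 : eps 1 0 * eps 0 0 + eps 1 1 * eps 1 0 = 0.
  have : (eps *m eps) 1 0 = 0 by rewrite ee mxE.
  by rewrite mul2E.
have E11 : - (eps 1 0 * star (eps 1 0)) + eps 1 1 * eps 1 1 = 1.
  have : (eps *m eps) 1 1 = 1 by rewrite ee mxE.
  by rewrite mul2E e01 mulrN.
set a := eps 0 0 in s00 p0 E00 E10 *; set b := eps 1 0 in e01 E00 E10 E11 *.
set c := eps 1 1 in s11 p1 E10 E11 *.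
pose s := 1 + a; have ss : star s = s by rewrite starD star1 s00.
have ps : pos (s - 1%:S).
  have -> : s - 1%:S = (a - d%:S) + d%:S by rewrite /s rsc1; non_commutative_ring.
  by apply: posD => //; apply: pos_rsc; exact: ltW.
have su : s \is a GRing.unit := pos_unit ltr01 ps.
have uu : 1 - c \is a GRing.unit.
  apply: (pos_unit ltr01).
  have -> : 1 - c - 1%:S = (- c - d%:S) + d%:S by rewrite rsc1; non_commutative_ring.
  by apply: posD => //; apply: pos_rsc; exact: ltW.
set z := disk_coord eps.
have bE : b = z * s by rewrite /z /disk_coord mulrVK.
(* Here [b^* b = a^2 - 1 = s (s - 2)]; both [cnorm z < 1] and [2 q = s] are read off this
   identity. *)
have zz : star z * z = 1 - (s^-1 + s^-1).
  rewrite /z /disk_coord -/a -/b -/s starM starV// ss.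
  have -> : s^-1 * star b * (b * s^-1) = s^-1 * (a * a - 1) * s^-1.
    by rewrite -E00; non_commutative_ring.
  have -> : a * a - 1 = s * (s - (1 + 1)) by rewrite /s; non_commutative_ring.
  rewrite mulrA mulVr// mul1r mulrBl divrr//; non_commutative_ring.
have psV : pos s^-1.
  have -> : s^-1 = star s^-1 * s * s^-1 by rewrite starV// ss mulVr// mul1r.
  apply: pos_conj; have -> : s = (s - 1%:S) + 1%:S by rewrite subrK.
  by apply: posD => //; exact: pos_rsc.
have z1 : disk z.
  have [|d' d'0 pd'] := pos_unit_gap psV; first by rewrite unitrV.
  apply: (cnorm_lt1 d'0); rewrite zz.
  have -> : 1 - (1 - (s^-1 + s^-1)) - d'%:S = (s^-1 - d'%:S) + s^-1.
    by non_commutative_ring.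
  exact: posD.
split=> //; rewrite /disk_param.
have qu := disk_sub1_unit z1; set q := (1 - star z * z)^-1.
have qs : q + q = s.
  apply: (mulrI qu); rewrite mulrDr divrr// zz.
  have -> : (1 - (1 - (s^-1 + s^-1))) * s = s^-1 * s + s^-1 * s.
    by non_commutative_ring.
  by rewrite mulVr.
have za : z * a = - (c * z).
  apply: (mulIr su); apply/eqP; rewrite mulNr -subr_eq0 opprK.
  have -> : z * a * s + c * z * s = z * s * a + c * (z * s).
    by rewrite /s; non_commutative_ring.
  by rewrite -bE E10.
have az : a * star z = - (star z * c).
  by rewrite -s00 -[c]s11 -!starM za starN.
apply: mx2P; rewrite !mx2E.
- by rewrite qs /s addrC addKr.
- by rewrite -mulrDl qs e01 bE starM ss.
- by rewrite -mulrDr qs.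
(* Multiplied by the invertible [1 - c], the claim becomes the lower right entry of [eps^2 = 1]. *)
- rewrite -/c -mulrDl -mulrDr qs; apply: (mulIr uu); apply/eqP.
  rewrite -subr_eq0 mulNr opprK.
  have -> : c * (1 - c) + (1 + z * s * star z) * (1 - c) =
    1 - c * c + z * s * (star z - star z * c) by non_commutative_ring.
  rewrite -az; have -> : star z + a * star z = s * star z.
    by rewrite /s; non_commutative_ring.
  have -> : 1 - c * c = - (z * s * (s * star z)).
    by rewrite -{1}E11 addrK bE starM ss.
  by rewrite addNr.
Qed.

Lemma QrhoD_disk_param z : disk z -> QrhoD (disk_param z).
Proof.
by move=> /phi_hat_surj[x [Kx <-]]; rewrite -phi_tildeE//; exact: QrhoD_phi_tilde.
Qed.

End KreinAlgebra.

(** * The action of the unitary group of the form *)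

Section Equivariance.
Context {R : realType} {A : cstarAlgType R}.
Implicit Types (x y : 'cV[A]_2) (g : 'M[A]_2) (z : A).

Lemma UthetaD_rhoD g : UthetaD g -> mx_star g *m rhoD *m g = rhoD.
Proof.
move=> [_ gt].
have E x y : (mx_star x *m (mx_star g *m rhoD *m g) *m y) 0 0 =
    (mx_star x *m rhoD *m y) 0 0.
  have -> : mx_star x *m (mx_star g *m rhoD *m g) *m y =
      mx_star (g *m x) *m rhoD *m (g *m y) by rewrite mx_starM !mulmxA.
  by rewrite !thetaDE gt.
have H (M : 'M[A]_2) i j : (mx_star (cv2 (i == 0)%:R (i != 0)%:R) *m M *m
    cv2 (j == 0)%:R (j != 0)%:R) 0 0 = M i j.
  rewrite !mul2E !mx_starE !cv2E; move: i j; do 2!apply: ord2P;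
  by rewrite /= ?star0 ?star1 ?(mulr0, mul0r, mulr1, mul1r, addr0, add0r).
by apply/matrixP => i j; rewrite -H E H.
Qed.

Lemma UthetaD_inv g : UthetaD g -> mx_inverse g (rhoD *m mx_star g *m rhoD).
Proof.
move=> Ug; have gr := UthetaD_rhoD Ug; have [[w [gw wg]] _] := Ug.
have vg : rhoD *m mx_star g *m rhoD *m g = 1%:M.
  by rewrite -!mulmxA (mulmxA (mx_star g)) gr rhoD2.
have -> : rhoD *m mx_star g *m rhoD = w.
  by rewrite -[LHS]mulmx1 -gw mulmxA vg mul1mx.
by [].
Qed.

Lemma inv2E g w : mx_inverse g w -> inv2 g = w.
Proof.
move=> [gw wg]; rewrite /inv2; case: xgetP => [v _ [gv vg]|/(_ w)]; last by case.
by rewrite -[LHS]mulmx1 -gw mulmxA vg mul1mx.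
Qed.

Lemma unit_of_starM (w : A) : star w * w \is a GRing.unit ->
  w * star w \is a GRing.unit -> w \is a GRing.unit.
Proof.
move=> wl wr; apply/unitrP; exists ((star w * w)^-1 * star w).
have l : (star w * w)^-1 * star w * w = 1 by rewrite -mulrA mulVr.
split=> //.
have r : w * (star w * (w * star w)^-1) = 1 by rewrite mulrA divrr.
have <- : star w * (w * star w)^-1 = (star w * w)^-1 * star w.
  by rewrite -[LHS]mul1r -l -[LHS]mulrA r mulr1.
exact: r.
Qed.

(** The upper left entries of [g^* rhoD g = rhoD] and [g rhoD g^* = rhoD] bound both products of
    [g 0 0] with its adjoint below by 1, so [g 0 0] is invertible. The second also makes
    [w = (g 0 0)^-1 g 0 1] of norm less than 1, and [neumann] applies to [1 + w z]. *)
Lemma UthetaD_pivot g z : UthetaD g -> disk z ->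
  g 0 0 + g 0 1 * z \is a GRing.unit.
Proof.
move=> Ug z1; have gr := UthetaD_rhoD Ug; have [gw _] := UthetaD_inv Ug.
have rg : g *m rhoD *m mx_star g = rhoD.
  have : g *m (rhoD *m mx_star g *m rhoD) *m rhoD = rhoD by rewrite gw mul1mx.
  by rewrite -!mulmxA rhoD2 mulmx1 !mulmxA.
have E1 : star (g 0 0) * g 0 0 = 1 + star (g 1 0) * g 1 0.
  have : (mx_star g *m rhoD *m g) 0 0 = 1 by rewrite gr rhoDE mx2E.
  rewrite rhoDE !mul2E !mx_starE !mx2E.
  rewrite !(mulr0, mulr1, addr0, add0r, mulrN1) => <-; non_commutative_ring.
have E2 : g 0 0 * star (g 0 0) = 1 + g 0 1 * star (g 0 1).
  have : (g *m rhoD *m mx_star g) 0 0 = 1 by rewrite rg rhoDE mx2E.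
  rewrite rhoDE !mul2E !mx_starE !mx2E.
  rewrite !(mulr0, mulr1, addr0, add0r, mulrN1) => <-; non_commutative_ring.
have P (w : A) : 1 + star w * w \is a GRing.unit.
  apply: (pos_unit ltr01); rewrite rsc1 addrAC subrr add0r; exact: pos_starM.
have gu : g 0 0 \is a GRing.unit.
  apply: unit_of_starM; first by rewrite E1.
  by rewrite E2 -{1}[g 0 1]starK.
set w := (g 0 0)^-1 * g 0 1.
have w1 : cnorm w < 1.
  rewrite -cnorm_star.
  have [|d d0 pd] := @pos_starM_unit _ _ (star (g 0 0)^-1).
    by rewrite star_unit ?unitrV.
  apply: (cnorm_lt1 d0); move: pd; congr (pos (_ - _)).
  rewrite !starK /w starM starV//.
  have -> : (g 0 0)^-1 * g 0 1 * (star (g 0 1) * (star (g 0 0))^-1) =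
    (g 0 0)^-1 * (g 0 0 * star (g 0 0) - 1) * (star (g 0 0))^-1.
    by rewrite E2; non_commutative_ring.
  rewrite mulrBr mulr1 mulrA mulVr// mul1r mulrBl divrr ?star_unit//.
  by rewrite opprB addrC subrK.
have -> : g 0 0 + g 0 1 * z = g 0 0 * (1 - - (w * z)).
  by rewrite opprK mulrDr mulr1 /w !mulrA divrr// mul1r.
rewrite unitrMl ?neumann// cnormN (le_lt_trans (cnormM _ _))//.
by rewrite -[1]mulr1 ltr_pM ?cnorm_ge0.
Qed.

Lemma KD_mul g x : UthetaD g -> KD x -> KD (g *m x).
Proof.
move=> Ug Kx; have [xx xu] := Kx; split; first by rewrite (proj2 Ug).
have -> : (g *m x) 0 0 = (g 0 0 + g 0 1 * phi_hat x) * x 0 0.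
  by rewrite mul2E mulrDl /phi_hat -!mulrA mulVr// mulr1.
by rewrite /= unitrMl//; apply: UthetaD_pivot => //; exact: disk_phi_hat.
Qed.

Lemma phi_hat_mul g x : UthetaD g -> KD x ->
  phi_hat (g *m x) = mobius g (phi_hat x).
Proof.
move=> Ug Kx; have [xx xu] := Kx.
have gu := UthetaD_pivot Ug (disk_phi_hat Kx).
have E i : (g *m x) i 0 = (g i 0 + g i 1 * phi_hat x) * x 0 0.
  by rewrite mul2E mulrDl /phi_hat -!mulrA mulVr// mulr1.
by rewrite {1}/phi_hat !E invrM// mulrA mulrK.
Qed.

Lemma phi_tilde_mul g x : UthetaD g ->
  phi_tilde (g *m x) = conj2 g (phi_tilde x).
Proof.
move=> Ug; have gV := UthetaD_inv Ug; rewrite /conj2 (inv2E gV).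
set w := rhoD *m mx_star g *m rhoD in gV *; have [gw _] := gV.
(* Hence [x^* g^* rhoD = x^* rhoD g^-1], so that the projection attached to [g x] is the conjugate
   of that of [x]. *)
have gr : mx_star g *m rhoD = rhoD *m w by rewrite /w !mulmxA rhoD2 mul1mx.
rewrite /phi_tilde /Defs.proj mulmxBr mulmxBl mulmx1 gw !mulr2n mulmxDr mulmxDl.
congr (_ + _ - _); rewrite mx_starM -!mulmxA gr //.
Qed.

Lemma PhiD_mobius g z : UthetaD g -> disk z ->
  PhiD (mobius g z) = conj2 g (PhiD z).
Proof.
move=> Ug /phi_hat_surj[x [Kx <-]].
by rewrite -phi_hat_mul// !PhiD_phi_hat ?phi_tilde_mul//; exact: KD_mul.
Qed.

End Equivariance.

(** * Open domains and smooth maps assembled from entries *)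

Section SmoothMaps.
Context {R : realType} {A : cstarAlgType R}.
Local Notation A1 := (Defs_realify__canonical__normed_module_NormedModule A).
Local Notation A2 := (Defs_mx_realify__canonical__normed_module_NormedModule A 2 1).
Local Notation M2 := (Defs_mx_realify__canonical__normed_module_NormedModule A 2 2).

Lemma open_unit : open [set a : A1 | (a : A) \is a GRing.unit].
Proof.
rewrite openE => a /= au; apply: (proj2 (@nbhs_normP R A1 a _)).
have k0 : 0 < cnorm (a : A)^-1 + 1 by rewrite ltr_wpDl ?cnorm_ge0.
exists (cnorm (a : A)^-1 + 1)^-1; first by rewrite /= invr_gt0.
move=> b /= ab; apply: (unit_near au).
have : cnorm ((b : A) - a) * (cnorm (a : A)^-1 + 1) < 1.
  rewrite -ltr_pdivlMr// div1r; apply: le_lt_trans ab.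
  by rewrite cnormB.
have := cnorm_ge0 ((b : A) - a); nra.
Qed.

Lemma open_disk : open (@disk R A : set A1).
Proof.
exact: (@open_norm_lt R A1 1).
Qed.

Context {V : normedModType R}.
Implicit Types (U : set V).

Lemma smooth_subset (W : normedModType R) (U U' : set V) (f : V -> W) :
  U' `<=` U -> is_Cinfty U f -> is_Cinfty U' f.
Proof.
move=> UU fC n; have := fC n; elim: n W f {fC} => [|n IH] W f /=.
  by move=> fc x /UU; exact: fc.
by move=> [Df [dD CD]]; exists Df; split=> [x /UU|]; [exact: dD | exact: IH].
Qed.

Lemma smooth_cv2 U (f g : V -> A1) : is_Cinfty U f -> is_Cinfty U g ->
  is_Cinfty U (fun x => cv2 (f x) (g x) : A2).
Proof.
move=> fC gC; apply: smooth_mx => i j; rewrite (ord1 j); move: i; apply: ord2P.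
  by rewrite (_ : (fun x => _) = f)//; apply/funext => x; rewrite mxE.
by rewrite (_ : (fun x => _) = g)//; apply/funext => x; rewrite mxE.
Qed.

Lemma smooth_mx2 U (f g h k : V -> A1) : is_Cinfty U f -> is_Cinfty U g ->
  is_Cinfty U h -> is_Cinfty U k ->
  is_Cinfty U (fun x => mx2 (f x) (g x) (h x) (k x) : M2).
Proof.
move=> fC gC hC kC; apply: smooth_mx; do 2!apply: ord2P.
- by rewrite (_ : (fun x => _) = f)//; apply/funext => x; rewrite mxE.
- by rewrite (_ : (fun x => _) = g)//; apply/funext => x; rewrite mxE.
- by rewrite (_ : (fun x => _) = h)//; apply/funext => x; rewrite mxE.
- by rewrite (_ : (fun x => _) = k)//; apply/funext => x; rewrite mxE.
Qed.

Lemma smooth_sub U (f g : V -> A1) : is_Cinfty U f -> is_Cinfty U g ->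
  is_Cinfty U (fun x => (f x : A) - g x : A1).
Proof. by move=> fC gC; apply: smooth_add => //; exact: smooth_opp. Qed.

Lemma smooth_disk_param U (f : V -> A1) : (forall x, U x -> disk (f x : A)) ->
  is_Cinfty U f -> is_Cinfty U (fun x => disk_param (f x : A) : M2).
Proof.
move=> fD fC.
have qC : is_Cinfty U (fun x => (1 - star (f x : A) * (f x : A))^-1 : A1).
  apply: (smooth_inv (f := fun x => 1 - star (f x : A) * (f x : A) : A1)) => [x /fD|].
    exact: disk_sub1_unit.
  by apply: smooth_sub; [exact: smooth_cst|apply: smooth_mul => //; exact: smooth_star].
rewrite /disk_param /=.
have sC := smooth_star fC.
apply: smooth_mx2.
- by apply: smooth_sub; [exact: smooth_add | exact: smooth_cst].
- by apply: smooth_opp; apply: smooth_add; exact: smooth_mul.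
- by apply: smooth_add; exact: smooth_mul.
- apply: smooth_opp; apply: smooth_add; first exact: smooth_cst.
  by apply: smooth_add; do 2?apply: smooth_mul.
Qed.

End SmoothMaps.

(** * Bounded bilinear maps on columns and matrices *)

Section Bilinear.
Context {R : realType} {A : cstarAlgType R}.
Local Notation A1 := (Defs_realify__canonical__normed_module_NormedModule A).
Local Notation A2 := (Defs_mx_realify__canonical__normed_module_NormedModule A 2 1).
Local Notation M2 := (Defs_mx_realify__canonical__normed_module_NormedModule A 2 2).

Lemma mx_rscaleE m n (t : R) (M : mx_realify A m n) i j :
  (t *: M) i j = t%:S * (M i j : A).
Proof. by rewrite mxE rscE. Qed.

Lemma cv_rscale (t : R) (x : A2) : t *: x = cvscale x t%:S :> 'cV[A]_2.
Proof. by apply/matrixP => i j; rewrite ord1 cvscaleE mx_rscaleE rscC. Qed.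

Lemma le_entry m n (M : mx_realify A m n) i j : cnorm (M i j : A) <= `|M|.
Proof. exact: le_mx_rnorm. Qed.

Lemma thetaD_bbil : bounded_bilinear (fun x y : A2 => thetaD x y : A1).
Proof.
split.
- by move=> y a x x'; rewrite cv_rscale thetaDl thetaD_scalel star_rsc -rscaleE.
- by move=> x a y y'; rewrite cv_rscale thetaDr thetaD_scaler rscC -rscaleE.
- exists 2 => // x y; rewrite /thetaD.
  rewrite (le_trans (cnormD _ _))// cnormN.
  rewrite (le_trans (lerD (cnormM _ _) (cnormM _ _)))// !cnorm_star.
  rewrite -mulrA [2]mulr2n mulrDl mul1r.
  by rewrite lerD// ler_pM ?cnorm_ge0 ?le_entry.
Qed.

Lemma cvscale_bbil : bounded_bilinear (fun (x : A2) (a : A1) => cvscale x a : A2).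
Proof.
split.
- move=> a t x y; apply/matrixP => i j; rewrite (ord1 j) !mxE !big_ord1 !mxE eqxx mulr1n.
  by rewrite mulrDl -scalerAl.
- move=> x t a b; apply/matrixP => i j; rewrite (ord1 j) !mxE !big_ord1 !mxE eqxx !mulr1n.
  by rewrite mulrDr rscaleE mulrA rscC -mulrA rscE.
- exists 1 => // x a; rewrite mul1r; apply: mx_rnorm_le; first by rewrite mulr_ge0.
  move=> i j; rewrite (ord1 j) cvscaleE (le_trans (cnormM _ _))//.
  by rewrite ler_wpM2r ?le_entry// cnorm_ge0.
Qed.

(** The polarization of [p_x], only real bilinear because of the adjoint on [y]. *)
Definition krein_outer (x y : 'cV[A]_2) : 'M[A]_2 := x *m mx_star y *m rhoD.

Lemma krein_outerE x y i j :
  krein_outer x y i j = x i 0 * star (y j 0) * (if j == 0 then 1 else - 1).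
Proof.
rewrite /krein_outer rhoDE mul2E !mxE !big_ord1 !mx_starE.
by move: j; apply: ord2P; rewrite /= ?(mulr0, mulr1, addr0, add0r).
Qed.

Lemma krein_outer_bbil : bounded_bilinear (fun x y : A2 => krein_outer x y : M2).
Proof.
split.
- move=> y a x x'; apply/matrixP => i j.
  rewrite [RHS]mxE mx_rscaleE !krein_outerE [in LHS]mxE mx_rscaleE.
  by non_commutative_ring.
- move=> x a y y'; apply/matrixP => i j.
  rewrite [RHS]mxE mx_rscaleE !krein_outerE [(_ + _ : 'cV_2) _ _]mxE mx_rscaleE.
  rewrite starD starM star_rsc rscC mulrDr mulrDl [x i 0 * (_ * _)]mulrA rscC.
  by rewrite !mulrA.
- exists 1 => // x y; rewrite mul1r; apply: mx_rnorm_le; first by rewrite mulr_ge0.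
  move=> i j; rewrite krein_outerE (le_trans (cnormM _ _))//.
  have -> : cnorm (if j == 0 then 1 else -1 : A) = 1.
    by case: ifP; rewrite ?cnormN cnorm1.
  rewrite mulr1 (le_trans (cnormM _ _))// cnorm_star.
  by rewrite ler_pM ?cnorm_ge0 ?le_entry.
Qed.

Lemma mulmx2_bbil : bounded_bilinear (fun a b : M2 => (a : 'M[A]_2) *m b : M2).
Proof.
split.
- move=> b t a a'; apply/matrixP => i j.
  rewrite [RHS]mxE mx_rscaleE !mul2E ![(_ + _ : 'M_2) _ _]mxE !mx_rscaleE.
  by non_commutative_ring.
- move=> a t b b'; apply/matrixP => i j.
  rewrite [RHS]mxE mx_rscaleE !mul2E ![(_ + _ : 'M_2) _ _]mxE !mx_rscaleE.
  rewrite !mulrDr ![a i _ * (_%:S * _)]mulrA !rscC !mulrA; non_commutative_ring.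
- exists 2 => // a b; apply: mx_rnorm_le; first by rewrite !mulr_ge0.
  move=> i j; rewrite mul2E (le_trans (cnormD _ _))//.
  rewrite (le_trans (lerD (cnormM _ _) (cnormM _ _)))//.
  rewrite -mulrA [2]mulr2n mulrDl mul1r.
  by rewrite lerD// ler_pM ?cnorm_ge0 ?le_entry.
Qed.

End Bilinear.

(** * Charts of the reflections and of the hyperboloid *)

Section Charts.
Context {R : realType} {A : cstarAlgType R}.
Local Notation A1 := (Defs_realify__canonical__normed_module_NormedModule A).
Local Notation A2 := (Defs_mx_realify__canonical__normed_module_NormedModule A 2 1).
Local Notation M2 := (Defs_mx_realify__canonical__normed_module_NormedModule A 2 2).
Local Notation K := (@KD R A : set A2).
Local Notation Q := (@QrhoD R A : set M2).
Local Notation D := (@disk R A : set A1).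

Fact id_blin_le (V : normedModType R) (x : V) : `|id x| <= 1 * `|x|.
Proof. by rewrite mul1r. Qed.
Fact id_blin_linear (V : normedModType R) : linear (id : V -> V).
Proof. by []. Qed.
Definition id_blin (V : normedModType R) : blin V V :=
  mk_blin (@id_blin_linear V) (@id_blin_le V).

Definition Q_chart_proj : blin M2 M2 :=
  blin_comp (inj_mx_blin 1 0) (entry_blin 1 0).

Lemma Q_chart_projE (v : 'M[A]_2) : Q_chart_proj v = mx2 0 0 (v 1 0) 0.
Proof. by apply: mx2P; rewrite mx2E mxE. Qed.

(* [Q] is the graph of three entries of [disk_param] over the coordinate
   [disk_coord]; subtracting them straightens it. *)
Lemma Q_submanifold : is_submanifold Q.
Proof.
move=> eps0 Qe0.
have eC (U : set M2) i j : is_Cinfty U (fun e : M2 => e i j : A1).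
  by apply: smooth_entry; exact: smooth_id.
pose U1 : set M2 := [set e : M2 | setT e /\ (1 + e 0 0 : A) \is a GRing.unit].
have s1C (U : set M2) : is_Cinfty U (fun e : M2 => 1 + e 0 0 : A1).
  by apply: smooth_add => //; exact: smooth_cst.
have oU1 : open U1 := open_preimage openT (s1C setT) open_unit.
have zC : is_Cinfty U1 (fun e : M2 => disk_coord e : A1).
  apply: smooth_mul => //.
  by apply: (smooth_inv (f := fun e : M2 => 1 + e 0 0 : A1)) => [e []|].
pose U : set M2 := [set e : M2 | U1 e /\ D (disk_coord e)].
have oU : open U := open_preimage oU1 zC open_disk.
pose psi (e : M2) : M2 := let p := disk_param (disk_coord e) in
  mx2 (e 0 0 - p 0 0) (e 0 1 - p 0 1) (disk_coord e) (e 1 1 - p 1 1).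
pose psi' (v : M2) : M2 := let p := disk_param (v 1 0) in
  mx2 (v 0 0 + p 0 0) (v 0 1 + p 0 1) (v 1 0 * (1 + (v 0 0 + p 0 0))) (v 1 1 + p 1 1).
pose V1 : set M2 := [set v : M2 | setT v /\ D (v 1 0)].
have oV1 : open V1 := open_preimage openT (eC setT 1 0) open_disk.
have pC i j : is_Cinfty V1 (fun v : M2 => disk_param (v 1 0 : A) i j : A1).
  by apply: smooth_entry; apply: smooth_disk_param => // v [].
have tC : is_Cinfty V1 (fun v : M2 => 1 + (v 0 0 + disk_param (v 1 0 : A) 0 0) : A1).
  by apply: smooth_add; [exact: smooth_cst|apply: smooth_add].
pose V : set M2 := [set v : M2 | V1 v /\
   (1 + (v 0 0 + disk_param (v 1 0 : A) 0 0)) \is a GRing.unit].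
have oV : open V := open_preimage oV1 tC open_unit.
exists U, V, psi, psi', [set v : M2 | setT v /\ Q_chart_proj v = v]; split.
- by have [] := QrhoD_param Qe0.
- split=> //.
  + move=> e [[_ su] De].
    have zE : psi e 1 0 = disk_coord e by rewrite mx2E.
    rewrite /psi' /V /V1 /= zE; rewrite /psi; move: (disk_param _) => p.
    rewrite !mx2E !subrK; split=> //.
    by apply: mx2P; rewrite !mx2E ?mulrVK.
  + move=> v [[_ Dv] tu].
    have zE : disk_coord (psi' v) = v 1 0.
      rewrite /disk_coord /psi' /=; move: tu; move: (disk_param _) => p tu.
      by rewrite !mx2E mulrK.
    split.
      split; last by rewrite zE.
      split=> //; move: tu; rewrite /psi' /=.
      by move: (disk_param _) => p tu; rewrite !mx2E.
    rewrite /psi zE /psi'; move: (disk_param _) => p.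
    by apply: mx2P; rewrite !mx2E ?addrK.
  + split.
      have pU i j : is_Cinfty U (fun e : M2 => disk_param (disk_coord e) i j : A1).
        apply: smooth_entry; apply: smooth_disk_param => [e []//|].
        by apply: smooth_subset zC => e [].
      apply: smooth_mx2; try apply: smooth_sub => //.
      by apply: smooth_subset zC => e [].
    have pV i j : is_Cinfty V (fun v : M2 => disk_param (v 1 0 : A) i j : A1).
      by apply: smooth_subset (pC i j) => e [].
    apply: smooth_mx2; try (apply: smooth_add => //).
    by apply: smooth_mul => //; apply: smooth_subset tC => e [].
- apply: (@complemented_proj _ _ _ _ Q_chart_proj) => //.
  by move=> v; rewrite (Q_chart_projE v) Q_chart_projE mx2E.
- move=> e [[_ su] De]; split.
    move=> /QrhoD_param[_ _ eE]; split=> //; rewrite (Q_chart_projE (psi e)).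
    by rewrite /psi -eE; apply: mx2P; rewrite !mx2E ?subrr.
  move=> [_]; rewrite (Q_chart_projE (psi e)) => pE.
  suff -> : e = disk_param (disk_coord e) by exact: QrhoD_disk_param.
  have E i j : psi e i j = mx2 0 0 (psi e 1 0) 0 i j by rewrite pE.
  have e00 : e 0 0 = disk_param (disk_coord e) 0 0.
    by apply/eqP; rewrite -subr_eq0; have := E 0 0; rewrite !mx2E => ->.
  apply: mx2P => //.
  + by apply/eqP; rewrite -subr_eq0; have := E 0 1; rewrite !mx2E => ->.
  + have -> : e 1 0 = disk_coord e * (1 + e 0 0) by rewrite /disk_coord mulrVK.
    rewrite e00 /disk_param !mx2E; non_commutative_ring.
  + by apply/eqP; rewrite -subr_eq0; have := E 1 1; rewrite !mx2E => ->.
Qed.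

(** The first entry is projected onto its skew part, so that the model space of [KD] is the skew
    elements times [A]. *)
Definition K_chart_proj : blin A2 A2 :=
  blin_comp (inj_mx_blin 0 0)
    (blin_comp (2^-1 *: (id_blin A1 - star_blin)) (entry_blin 0 0)) +
  blin_comp (inj_mx_blin 1 0) (entry_blin 1 0).

Lemma K_chart_projE (v : 'cV[A]_2) :
  K_chart_proj v = cv2 ((2^-1)%:S * (v 0 0 - star (v 0 0))) (v 1 0).
Proof.
by apply: cv2P; rewrite cv2E !mxE /= ?addr0 ?add0r// -[LHS]rscE.
Qed.

Lemma half_sub (a : A) : (2^-1)%:S * (a + a) = a.
Proof.
have h : 2^-1 + 2^-1 = 1 :> R by lra.
by rewrite mulrDr -mulrDl -rscD h rsc1 mul1r.
Qed.

Lemma half_skewP (a : A) : (2^-1)%:S * (a - star a) = a <-> a + star a = 0.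
Proof.
split=> [E|E].
  have -> : star a = - a.
    by rewrite -[in LHS]E -[in RHS]E starM starB starK star_rsc rscC -mulrN opprB.
  by rewrite subrr.
have -> : star a = - a by apply/eqP; rewrite -addr_eq0 addrC E.
by rewrite opprK half_sub.
Qed.

Lemma double_inj (a b : A) : a + a = b + b -> a = b.
Proof. by move=> ab; rewrite -[LHS]half_sub ab half_sub. Qed.

Lemma double_unit (a : A) : a \is a GRing.unit -> a + a \is a GRing.unit.
Proof.
move=> au; have -> : a + a = 2%:S * a by rewrite [2]mulr2n rscD rsc1 mulrDl mul1r.
by rewrite unitrMl// rsc_unit ?pnatr_eq0.
Qed.

(* Polarization: [theta(x, x) - theta(x0, x0)] is the real part of
   [theta(x + x0, x - x0)]; dividing by the first entry [y] of [x + x0] turns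
   [KD] into the linear condition that [al] be skew. *)
Lemma K_chart_id (x x0 : 'cV[A]_2) : let y := x0 0 0 + x 0 0 in
  y \is a GRing.unit ->
  let be := (x 1 0 + x0 1 0) * y^-1 in
  let e := x0 0 0 - star be * x0 1 0 in
  let al := 1 - star be * be - (e * y^-1 + e * y^-1) in
  star y * (al + star al) * y =
  (thetaD x x - thetaD x0 x0) + (thetaD x x - thetaD x0 x0).
Proof.
move=> y yu be e al.
have by_ : be * y = x 1 0 + x0 1 0 by rewrite mulrVK.
have yb : star y * star be = star (x 1 0) + star (x0 1 0).
  by rewrite -starM by_ starD.
have E : star y * al * y = star y * y - (star y * star be) * (be * y)
    - (star y * x0 0 0 - (star y * star be) * x0 1 0)
    - (star y * x0 0 0 - (star y * star be) * x0 1 0).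
  rewrite /al -[in RHS](mulrVK yu (star y * x0 0 0 - _)).
  by rewrite /e; non_commutative_ring.
have -> : star y * (al + star al) * y = star y * al * y + star (star y * al * y).
  by rewrite !starM starK; non_commutative_ring.
rewrite E by_ yb !(starD, starN, starM, starK) /y /thetaD ?starD.
non_commutative_ring.
Qed.

(** The chart sends [x] to the pair [al], [be] of [K_chart_id]. Here [be] is the quotient of the
    entries of [x + x0], and [al] encodes the first entry [y] of [x + x0] rationally, so that the
    inverse is explicit too. *)
Lemma K_submanifold : is_submanifold K.
Proof.
move=> x0 [x0x0 cu].
set c := x0 0 0 in cu; set d := x0 1 0.
have xC (U : set A2) i : is_Cinfty U (fun x : A2 => x i 0 : A1).
  by apply: smooth_entry; exact: smooth_id.
have cC (U : set A2) (a : A) : is_Cinfty U (fun x : A2 => a : A1).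
  exact: smooth_cst.
pose be (x : A2) : A := (x 1 0 + d) * (c + x 0 0)^-1.
pose e (b : A) : A := c - star b * d.
have eC (U : set A2) (f : A2 -> A1) :
    is_Cinfty U f -> is_Cinfty U (fun x => e (f x) : A1).
  move=> fC; apply: smooth_sub => //; apply: smooth_mul => //.
  exact: smooth_star.
pose U1 : set A2 := [set x : A2 | setT x /\ (x 0 0 : A) \is a GRing.unit].
have oU1 : open U1 := open_preimage openT (xC setT 0) open_unit.
have yC (U : set A2) : is_Cinfty U (fun x : A2 => c + x 0 0 : A1).
  exact: smooth_add.
pose U2 : set A2 := [set x : A2 | U1 x /\ (c + x 0 0 : A) \is a GRing.unit].
have oU2 : open U2 := open_preimage oU1 (yC U1) open_unit.
have yVC (U : set A2) : U `<=` U2 -> is_Cinfty U (fun x : A2 => (c + x 0 0)^-1 : A1).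
  by move=> UU; apply: (smooth_inv (f := fun x : A2 => c + x 0 0 : A1)) => // x /UU[].
have beC (U : set A2) : U `<=` U2 -> is_Cinfty U (fun x : A2 => be x : A1).
  move=> UU; apply: smooth_mul; last exact: yVC.
  exact: smooth_add.
pose U : set A2 := [set x : A2 | U2 x /\ e (be x) \is a GRing.unit].
have oU : open U := open_preimage oU2 (eC _ _ (beC _ (@subset_refl _ U2))) open_unit.
have UU2 : U `<=` U2 by move=> x [].
pose psi (x : A2) : A2 := let b := be x in let ey := e b * (c + x 0 0)^-1 in
  cv2 (1 - star b * b - (ey + ey)) b.
(* The relation [1 - b^* b - al = 2 e y^-1] determines [y] as [2 s^-1 e]; then [x + x0] has entries
   [y] and [b y]. *)
pose s (v : A2) : A := 1 - star (v 1 0) * v 1 0 - v 0 0.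
pose y (v : A2) : A := (s v)^-1 * e (v 1 0) + (s v)^-1 * e (v 1 0).
pose psi' (v : A2) : A2 := cv2 (y v - c) (v 1 0 * y v - d).
pose V1 : set A2 := [set v : A2 | setT v /\ e (v 1 0) \is a GRing.unit].
have oV1 : open V1 := open_preimage openT (eC _ _ (xC setT 1)) open_unit.
have sC (V : set A2) : is_Cinfty V (fun v : A2 => s v : A1).
  apply: smooth_sub => //; apply: smooth_sub => //; apply: smooth_mul => //.
  exact: smooth_star.
pose V2 : set A2 := [set v : A2 | V1 v /\ s v \is a GRing.unit].
have oV2 : open V2 := open_preimage oV1 (sC V1) open_unit.
have yC' (V : set A2) : V `<=` V2 -> is_Cinfty V (fun v : A2 => y v : A1).
  move=> VV; have sV : is_Cinfty V (fun v : A2 => (s v)^-1 : A1).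
    by apply: (smooth_inv (f := fun v : A2 => s v : A1)) => // x /VV[].
  by apply: smooth_add; apply: smooth_mul => //; exact: eC.
pose V : set A2 := [set v : A2 | V2 v /\ y v - c \is a GRing.unit].
have oV : open V.
  apply: (open_preimage oV2 _ open_unit).
  by apply: smooth_sub => //; exact: yC'.
have VV2 : V `<=` V2 by move=> x [].
have twoc : x0 \in U.
  rewrite inE; split; [split; [by split|]|].
    exact: double_unit.
  have -> : be x0 = d * c^-1.
    apply: (mulIr (double_unit cu)).
    rewrite mulrVK ?double_unit// mulrDr mulrVK//.
  (* At the centre [e] is the adjoint of [c^-1], by [theta(x0, x0) = 1]; hence [x0] lies in the
     domain of the chart. *)
  have -> : e (d * c^-1) = star c^-1 * (star c * c - star d * d).
    rewrite /e starM mulrBr [star c^-1 * (star c * c)]mulrA.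
    by rewrite -[star c^-1 * star c]starM divrr// star1 mul1r mulrA.
  by rewrite [_ - _]x0x0 mulr1 star_unit ?unitrV.
exists U, V, psi, psi', [set v : A2 | setT v /\ K_chart_proj v = v]; split.
- exact: set_mem twoc.
- split=> //.
  + move=> x [[[_ xu] yu] eu].
    have psi0 : psi x 0 0 = 1 - star (be x) * be x -
        (e (be x) * (c + x 0 0)^-1 + e (be x) * (c + x 0 0)^-1) by rewrite cv2E.
    have psi1 : psi x 1 0 = be x by rewrite cv2E.
    have sE : s (psi x) = e (be x) * (c + x 0 0)^-1 + e (be x) * (c + x 0 0)^-1.
      by rewrite /s psi1 psi0 opprB addrC subrK.
    have su : e (be x) * (c + x 0 0)^-1 \is a GRing.unit by rewrite unitrMl ?unitrV.
    have yE : y (psi x) = c + x 0 0.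
      apply: (mulrI (double_unit su)); rewrite -sE /y psi1 mulrDr.
      rewrite mulVKr ?sE ?double_unit// mulrDl mulrVK//.
    split.
      split; last by rewrite yE addrAC subrr add0r.
      by split; [split; rewrite ?psi1 | rewrite sE double_unit].
    apply: cv2P; rewrite cv2E yE; first by rewrite addrAC subrr add0r.
    by rewrite psi1 mulrVK// addrK.
  + move=> v [[[_ eu] su] yu].
    have yyu : y v \is a GRing.unit.
      by apply: double_unit; rewrite unitrMl ?unitrV.
    have p0 : c + psi' v 0 0 = y v by rewrite cv2E addrC subrK.
    have beE : be (psi' v) = v 1 0 by rewrite /be p0 cv2E subrK mulrK.
    have eyE : e (v 1 0) * (y v)^-1 + e (v 1 0) * (y v)^-1 = s v.
      apply: (mulIr yyu); rewrite mulrDl mulrVK// /y mulrDr.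
      by rewrite mulVKr.
    split.
      by split; [split; [split; rewrite ?cv2E|rewrite p0]|rewrite beE].
    apply: cv2P; rewrite cv2E beE// p0 eyE /s opprB addrC subrK//.
  + split.
      apply: smooth_cv2; last exact: beC.
      have bU := beC _ UU2; have yU := yVC _ UU2.
      apply: smooth_sub.
        by apply: smooth_sub => //; apply: smooth_mul => //; exact: smooth_star.
      by apply: smooth_add; apply: smooth_mul => //; exact: eC.
    have yV := yC' _ VV2.
    by apply: smooth_cv2; apply: smooth_sub => //; exact: smooth_mul.
- apply: (@complemented_proj _ _ _ _ K_chart_proj) => //.
  move=> v; rewrite (K_chart_projE v) K_chart_projE !cv2E; set b := _ * (v 0 0 - _).
  have -> : star b = - b by rewrite starM star_rsc rscC starB starK -mulrN opprB.
  by rewrite opprK half_sub.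
- move=> x [[[_ xu] yu] eu].
  have al : K_chart_proj (psi x) = psi x <-> psi x 0 0 + star (psi x 0 0) = 0.
    rewrite (K_chart_projE (psi x)) -half_skewP; split=> [H|H].
      by have := congr1 (fun w : 'cV[A]_2 => w 0 0) H; rewrite cv2E.
    by apply: cv2P; rewrite cv2E.
  have psi0 : psi x 0 0 = 1 - star (be x) * be x -
        (e (be x) * (c + x 0 0)^-1 + e (be x) * (c + x 0 0)^-1) by rewrite cv2E.
  have E : star (c + x 0 0) * (psi x 0 0 + star (psi x 0 0)) * (c + x 0 0) =
      (thetaD x x - 1) + (thetaD x x - 1).
    by have := @K_chart_id x x0 yu; rewrite /= x0x0 psi0.
  split=> [[xx _]|[_ /al]]; last first.
    move=> H; split => //; move: E; rewrite H mulr0 mul0r => /esym E.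
    apply/eqP; rewrite -subr_eq0; apply/eqP; apply: double_inj.
    by rewrite addr0; exact: E.
  split=> //; apply/al; apply: (mulrI (star_unit yu)); apply: (mulIr yu).
  by rewrite mulr0 mul0r E xx subrr addr0.
Qed.

End Charts.

(** * The tangent space of the hyperboloid; the submersion onto the disk *)

Section Submersions.
Context {R : realType} {A : cstarAlgType R}.
Local Notation A1 := (Defs_realify__canonical__normed_module_NormedModule A).
Local Notation A2 := (Defs_mx_realify__canonical__normed_module_NormedModule A 2 1).
Local Notation M2 := (Defs_mx_realify__canonical__normed_module_NormedModule A 2 2).
Local Notation K := (@KD R A : set A2).
Local Notation Q := (@QrhoD R A : set M2).
Local Notation D := (@disk R A : set A1).

Lemma is_diff_id_blin (V : normedModType R) (x : V) : is_diff x id (id_blin V).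
Proof. exact: is_diff_id. Qed.

(** The derivative of [y -> theta(y, y)] at [x], that is, twice the real part of [theta(x, v)]. *)
Definition re_theta (x : A2) : blin A2 A1 :=
  bbil_pairl thetaD_bbil (id_blin A2) x + bbil_pairr thetaD_bbil x (id_blin A2).

Lemma re_thetaE (x v : A2) : re_theta x v = thetaD v x + thetaD x v :> A.
Proof. by []. Qed.

(* With [v = x k + n], [k] skew and [n] orthogonal to [x], the curve is the Cayley
   transform [2 (x + t n / 2) u^-1 - x], [u = 1 - t k / 2 + t^2 theta(n, n) / 4]:
   it stays in [K] because [u + u^* = theta(2 x + t n, 2 x + t n) / 2]. *)
Lemma re_theta_curve (x v : A2) : K x -> re_theta x v = 0 -> tangent_space K x v.
Proof.
move=> [xx xu] xv.
pose k := thetaD x v; pose n : 'cV[A]_2 := v - cvscale x k; pose g := thetaD n n.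
have kk : star k = - k.
  by rewrite /k star_thetaD; apply/eqP; rewrite -addr_eq0; apply/eqP.
have nE : n = v + cvscale x (- k).
  by apply: cv2P; rewrite !mxE !big_ord1 !mxE eqxx !mulr1n mulrN.
clearbody n.
have xn : thetaD x n = 0.
  by rewrite nE thetaDr thetaD_scaler xx mul1r subrr.
have nx : thetaD n x = 0 by rewrite -star_thetaD xn star0.
have gs : star g = g by rewrite star_thetaD.
(* The constants are fixed by the velocity [n - 2 x k' = n + x k = v] at 0, and by
   [4 g' = theta(n, n)], which keeps the curve in [K]. *)
pose k' : A := - ((2^-1)%:S * k); pose g' : A := (4^-1)%:S * g.
pose u (t : R) : A := 1 + t%:S * (k' + t%:S * g').
pose f (t : R) : A2 := cvscale n t%:S.
pose c (t : R) : A2 := - x + cvscale (x + x + f t) (u t)^-1.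
have uC (I : set R) : is_Cinfty I (fun t => u t : A1).
  apply: smooth_add; first exact: smooth_cst.
  apply: smooth_mul; first exact: smooth_rsc.
  apply: smooth_add; first exact: smooth_cst.
  by apply: smooth_mul; [exact: smooth_rsc | exact: smooth_cst].
pose I1 : set R := [set t : R | setT t /\ u t \is a GRing.unit].
have oI1 : open I1 := open_preimage openT (uC setT) open_unit.
have cE t i : c t i 0 = - x i 0 + (x i 0 + x i 0 + n i 0 * t%:S) * (u t)^-1.
  rewrite [LHS]mxE cvscaleE [X in X + _]mxE; congr (_ + _ * _).
  by rewrite [LHS]mxE [X in X + _]mxE cvscaleE.
have cC (I : set R) i : I `<=` I1 -> is_Cinfty I (fun t => c t i 0 : A1).
  move=> II; rewrite (_ : (fun t => _) = fun t =>
    - x i 0 + (x i 0 + x i 0 + n i 0 * t%:S) * (u t)^-1 : A1).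
    apply: smooth_add; first exact: smooth_cst.
    apply: smooth_mul; last first.
      by apply: (smooth_inv (f := fun t => u t : A1)) => // t /II[].
    apply: smooth_add; first exact: smooth_cst.
    by apply: smooth_mul; [exact: smooth_cst | exact: smooth_rsc].
  by apply/funext => t; rewrite cE.
pose I : set R := [set t : R | I1 t /\ (c t 0 0 : A) \is a GRing.unit].
have oI : open I := open_preimage oI1 (cC _ 0 (@subset_refl _ I1)) open_unit.
have u0 : u 0 = 1 by rewrite /u rsc0 mul0r addr0.
have c0 : c 0 = x.
  by apply: cv2P; rewrite cE u0 invr1 mulr1 rsc0 mulr0 addr0 addKr.
have k's : star k' = - k'.
  by rewrite /k' starN starM star_rsc rscC kk mulrN.
have g's : star g' = g' by rewrite /g' starM star_rsc rscC gs.
have g4 : g' + g' + (g' + g') = g.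
  have h : 4^-1 + 4^-1 + (4^-1 + 4^-1) = 1 :> R by lra.
  by rewrite /g' -!mulrDl -!rscD h rsc1 mul1r.
have us t : star (u t) = 1 + t%:S * (- k' + t%:S * g').
  by rewrite /u starD star1 starM star_rsc rscC starD k's starM star_rsc rscC g's.
have cK t : I t -> K (c t).
  move=> [[_ ut] ct]; split=> //.
  pose b : 'cV[A]_2 := x + x + f t.
  have xb : thetaD x b = 1 + 1.
    by rewrite !thetaDr thetaD_scaler xx xn mul0r addr0.
  have bx : thetaD b x = 1 + 1 by rewrite -star_thetaD xb starD star1.
  have bb : thetaD b b = (u t + star (u t)) + (u t + star (u t)).
    have bn : thetaD b n = t%:S * g.
      by rewrite !thetaDl thetaD_scalel xn star_rsc !add0r.
    rewrite {2}/b !thetaDr thetaD_scaler bx bn rscC us /u -g4.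
    by non_commutative_ring.
  have cb : c t = cvscale b (u t)^-1 + cvscale x (- 1).
    rewrite /c addrC; congr (_ + _).
    by apply: cv2P; rewrite cvscaleE mulrN1 mxE.
  rewrite cb thetaDl !thetaDr !thetaD_scalel !thetaD_scaler xx xb bx bb.
  rewrite starN star1; set w := (u t)^-1.
  have uw : u t * w = 1 by rewrite divrr.
  have wu : star w * star (u t) = 1 by rewrite -starM uw star1.
  (* The congruence of [theta(b, b) = 2 (u + star u)] by [w = u^-1] is [2 w + 2 star w], which the
     mixed terms cancel. *)
  have -> : star w * ((u t + star (u t) + (u t + star (u t))) * w) =
     star w * (u t * w) + star w * (u t * w) + star w * star (u t) * w
     + star w * star (u t) * w by non_commutative_ring.
  by rewrite uw wu; non_commutative_ring.
exists c; split.
  split=> //; exists I; split=> //.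
    split; last by rewrite c0.
    by split=> //; rewrite /= u0 unitr1.
  by apply: smooth_mx => i j; rewrite (ord1 j); apply: (cC I i) => t [].
have du : is_diff (0 : R) (fun t => u t : A1)
    (bbil_pairl amul_bbil (rsc_blin (A := A)) (k' + 0%:S * g') +
     bbil_pairr amul_bbil 0%:S (bbil_pairl amul_bbil (rsc_blin (A := A)) g' +
        bbil_pairr amul_bbil 0%:S 0)).
  apply: is_diff_addl; apply: (is_diff_bbil amul_bbil (f := fun t : R => t%:S : A1)).
    exact: (is_diff_blin (rsc_blin (A := A))).
  apply: is_diff_addl; apply: (is_diff_bbil amul_bbil (f := fun t : R => t%:S : A1)).
    exact: (is_diff_blin (rsc_blin (A := A))).
set U' := _ + _ in du.
have u0u : u 0 \is a GRing.unit by rewrite u0 unitr1.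
have dw : is_diff (0 : R) (fun t => (u t)^-1 : A1) (blin_comp (dinv_blin (u 0)^-1) U').
  exact: is_diff_comp du (is_diff_inv u0u).
have df : is_diff (0 : R) (fun t => x + x + f t : A2)
    (bbil_pairr cvscale_bbil n (rsc_blin (A := A))).
  apply: is_diff_addl.
  exact: (is_diff_blin (bbil_pairr cvscale_bbil n (rsc_blin (A := A)))).
have := is_diff_is_derive (is_diff_addl (- x) (is_diff_bbil cvscale_bbil df dw)).
congr is_derive.
have U1 : U' 1 = k' :> A.
  rewrite -[LHS]/(1%:S * (k' + 0%:S * g') + 0%:S * (1%:S * g' + 0%:S * 0) : A).
  by rewrite rsc0 rsc1 !mul0r !addr0 mul1r.
rewrite -[LHS]/(cvscale (cvscale n 1%:S) (u 0)^-1 +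
  cvscale (x + x + f 0) (- 1 * (u 0)^-1 * (U' 1 * (u 0)^-1)) : 'cV[A]_2).
rewrite U1 u0 invr1 !mulr1 mulN1r /k' opprK.
have vE i : v i 0 = n i 0 + x i 0 * k.
  by rewrite nE [(_ + _ : 'cV_2) _ _]mxE cvscaleE mulrN subrK.
have E i : (cvscale (cvscale n 1%:S) 1 + cvscale (x + x + f 0) ((2^-1)%:S * k) :
    'cV[A]_2) i 0 = v i 0.
  rewrite mxE !cvscaleE rsc1 !mulr1 vE [X in _ + X * _]mxE [X in _ + (X + _) * _]mxE.
  by rewrite cvscaleE rsc0 mulr0 addr0 mulrA rscC half_sub.
by apply: cv2P; exact: E.
Qed.

Lemma tangent_KD (x v : A2) : K x -> tangent_space K x v <-> re_theta x v = 0.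
Proof.
move=> Kx; split; last exact: re_theta_curve.
move=> Tv; apply: (tangent_const Tv (G := fun y : A2 => thetaD y y : A1)).
  by apply: (is_diff_bbil thetaD_bbil); exact: is_diff_id_blin.
by move=> y [yy _]; rewrite yy (proj1 Kx).
Qed.

Lemma tangent_KD_set (x : A2) : K x ->
  tangent_space K x = [set v | re_theta x v = 0].
Proof. by move=> Kx; apply/seteqP; split=> v /(tangent_KD _ Kx). Qed.

(** The orthogonal projection onto [x A] for the form; on tangent vectors [theta(x, v)] is skew, so
    its values there are the vertical directions [x k]. *)
Definition vertical_proj (x : A2) : blin A2 A2 :=
  bbil_pairr cvscale_bbil x (bbil_pairr thetaD_bbil x (id_blin A2)).

Lemma vertical_complemented (x : A2) (F : set A2) : K x ->
  (forall v, re_theta x v = 0 -> F v <-> vertical_proj x v = v) ->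
  complemented_in (tangent_space K x) [set v | tangent_space K x v /\ F v].
Proof.
move=> Kx FE; have [xx _] := Kx; rewrite tangent_KD_set//.
have vE v : vertical_proj x v = cvscale x (thetaD x v) by [].
apply: (complemented_proj (P := vertical_proj x)).
- exact: closed_subspace_ker.
- by move=> v; rewrite (vE v) (vE (cvscale x _)) thetaD_scaler xx mul1r.
- move=> v v0; suff : re_theta x (vertical_proj x v) = 0 by []; rewrite (vE v) re_thetaE.
  by rewrite thetaD_scalel thetaD_scaler xx mul1r mulr1 star_thetaD.
- by move=> v; split=> -[Tv /(FE _ Tv)].
Qed.

Definition dphi_hat (x : A2) : blin A2 A1 :=
  bbil_pairl amul_bbil (entry_blin 1 0) ((x 0 0 : A)^-1) +
  bbil_pairr amul_bbil (x 1 0) (blin_comp (dinv_blin (x 0 0 : A)^-1) (entry_blin 0 0)).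

Lemma dphi_hatE (x v : A2) : dphi_hat x v =
  v 1 0 * (x 0 0)^-1 + x 1 0 * (- 1 * (x 0 0)^-1 * (v 0 0 * (x 0 0)^-1)) :> A.
Proof. by []. Qed.

Lemma is_diff_phi_hat (x : A2) : K x ->
  is_diff x (fun y : A2 => phi_hat y : A1) (dphi_hat x).
Proof.
move=> [_ xu].
have d0 : is_diff x (fun y : A2 => (y 0 0 : A)^-1 : A1)
    (blin_comp (dinv_blin (x 0 0 : A)^-1) (entry_blin 0 0)).
  exact: is_diff_comp (is_diff_blin (entry_blin 0 0) x) (is_diff_inv xu).
exact: (is_diff_bbil amul_bbil (is_diff_blin (entry_blin 1 0) x) d0).
Qed.

Lemma phi_hat_smooth_map : is_smooth_map K D (fun y : A2 => phi_hat y : A1).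
Proof.
split=> [x|x Kx]; first exact: disk_phi_hat.
have xC (U : set A2) i : is_Cinfty U (fun x : A2 => x i 0 : A1).
  by apply: smooth_entry; exact: smooth_id.
exists [set y : A2 | setT y /\ (y 0 0 : A) \is a GRing.unit],
  (fun y : A2 => phi_hat y : A1).
split=> //.
- exact: open_preimage openT (xC setT 0) open_unit.
- by split=> //; case: Kx.
- apply: smooth_mul => //.
  by apply: (smooth_inv (f := fun y : A2 => y 0 0 : A1)) => // y [].
Qed.

Lemma phi_hat_submersion : is_submersion K D (fun y : A2 => phi_hat y : A1).
Proof.
apply: (@submersion_intro R A2 A1 K D (fun y : A2 => phi_hat y : A1) dphi_hat).
- exact: K_submanifold.
- exact: open_submanifold open_disk.
- exact: phi_hat_smooth_map.
- exact: is_diff_phi_hat.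
- move=> x w Kx _; have [xx xu] := Kx.
  have x1 : x 1 0 = phi_hat x * x 0 0 by rewrite /phi_hat mulrVK.
  (* The lift is normalized by [theta(x, v) = 0]. The derivative prescribes [v_2 = z v_1 + w x_1],
     and since [x_1^* - x_2^* z = x_1^-1], orthogonality forces this value of [v_1]. *)
  pose b : A := x 0 0 * star (x 1 0) * w * x 0 0.
  exists (cv2 b (phi_hat x * b + w * x 0 0)).
    apply/(tangent_KD _ Kx); rewrite re_thetaE.
    have xv : thetaD x (cv2 b (phi_hat x * b + w * x 0 0)) = 0.
      rewrite /thetaD !cv2E.
      have -> : star (x 0 0) * b - star (x 1 0) * (phi_hat x * b + w * x 0 0) =
        (star (x 0 0) * x 0 0 - star (x 1 0) * (phi_hat x * x 0 0) - 1) *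
           star (x 1 0) * w * x 0 0 by rewrite /b; non_commutative_ring.
      by rewrite -x1 [X in X - 1]xx subrr !mul0r.
    by rewrite -star_thetaD xv star0 addr0.
  rewrite dphi_hatE !cv2E mulN1r mulNr mulrN mulrDl mulrK//.
  by rewrite /phi_hat !mulrA addrAC subrr add0r.
- move=> x Kx.
  apply: (vertical_complemented (F := [set v | dphi_hat x v = 0]) Kx) => v xv.
  have [xx xu] := Kx; set z := phi_hat x.
  have x1 : x 1 0 = z * x 0 0 by rewrite /z /phi_hat mulrVK.
  have vE : vertical_proj x v = cvscale x (thetaD x v) by [].
  have dE : dphi_hat x v = (v 1 0 - z * v 0 0) * (x 0 0)^-1 :> A.
    by rewrite dphi_hatE /z /phi_hat; non_commutative_ring.
  rewrite vE; split=> [|vv].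
    move=> d0; have {}d0 : dphi_hat x v = 0 by [].
    have v1 : v 1 0 = z * v 0 0.
      apply/eqP; rewrite -subr_eq0; apply/eqP.
      by apply: (@mulIr _ (x 0 0)^-1); rewrite ?unitrV// mul0r -dE.
    have tE : thetaD x v = (star (x 0 0) - star (x 1 0) * z) * v 0 0.
      by rewrite /thetaD v1; non_commutative_ring.
    have i1 : (star (x 0 0) - star (x 1 0) * z) * x 0 0 = 1.
      by rewrite mulrBl -mulrA -x1.
    have i2 : star (x 0 0) - star (x 1 0) * z = (x 0 0)^-1.
      by rewrite -[RHS]mul1r -i1 mulrK.
    apply: cv2P; rewrite cvscaleE tE i2; first by rewrite mulVKr.
    by rewrite x1 -mulrA mulVKr.
  suff : dphi_hat x v = 0 by [].
  by rewrite dE -vv !cvscaleE x1 mulrA subrr mul0r.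
Qed.

End Submersions.

(** * The submersion onto the reflections and the diffeomorphism from the disk *)

Section Diffeomorphism.
Context {R : realType} {A : cstarAlgType R}.
Local Notation A1 := (Defs_realify__canonical__normed_module_NormedModule A).
Local Notation A2 := (Defs_mx_realify__canonical__normed_module_NormedModule A 2 1).
Local Notation M2 := (Defs_mx_realify__canonical__normed_module_NormedModule A 2 2).
Local Notation K := (@KD R A : set A2).
Local Notation Q := (@QrhoD R A : set M2).
Local Notation D := (@disk R A : set A1).

Definition dphi_tilde (x : A2) : blin A2 M2 :=
  let L := bbil_pairl krein_outer_bbil (id_blin A2) x +
           bbil_pairr krein_outer_bbil x (id_blin A2) in L + L.

Lemma dphi_tildeE (x v : A2) : dphi_tilde x v =
  (krein_outer v x + krein_outer x v) + (krein_outer v x + krein_outer x v)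
  :> 'M[A]_2.
Proof. by []. Qed.

Lemma is_diff_phi_tilde (x : A2) :
  is_diff x (fun y : A2 => phi_tilde y : M2) (dphi_tilde x).
Proof.
have d1 := is_diff_bbil krein_outer_bbil (is_diff_id_blin x) (is_diff_id_blin x).
have := is_diff_addl (- (1%:M : 'M[A]_2) : M2) (is_diffD d1 d1).
congr is_diff_def; apply/funext => y /=.
by rewrite /phi_tilde mulr2n addrC.
Qed.

Lemma phi_tilde_smooth_map : is_smooth_map K Q (fun y : A2 => phi_tilde y : M2).
Proof.
split=> [x|x Kx]; first exact: QrhoD_phi_tilde.
have [_ /(_ x Kx)[U [f [oU Ux fC fE]]]] := @phi_hat_smooth_map R A.
have fD : D (f x) by rewrite fE//; exact: disk_phi_hat.
exists [set y : A2 | U y /\ D (f y)], (fun y : A2 => disk_param (f y : A) : M2).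
split.
- exact: open_preimage oU fC open_disk.
- by [].
- by apply: smooth_disk_param => [y []//|]; apply: smooth_subset fC => y [].
- by move=> y [Uy _] Ky; rewrite fE// phi_tildeE.
Qed.

(** The conditions come from differentiating [eps^2 = 1] and, entry by entry, the self-adjointness
    of [rhoD eps]. The lift in [phi_tilde_tangent_surj] uses nothing else about [w]. *)
Lemma tangent_QrhoD (e w : M2) : Q e -> tangent_space Q e w ->
  (w : 'M[A]_2) *m e + (e : 'M[A]_2) *m w = 0 /\
  mx_star (w : 'M[A]_2) *m rhoD = rhoD *m w.
Proof.
move=> Qe Tw; split.
  have dG := is_diff_bbil mulmx2_bbil (is_diff_id_blin e) (is_diff_id_blin e).
  apply: (tangent_const Tw dG) => y [yy _].
  by rewrite -[LHS]/((y : 'M[A]_2) *m y) yy -(proj1 Qe).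
have real i : star (w i i) = w i i.
  apply/esym/eqP; rewrite -subr_eq0; apply/eqP.
  pose L : blin M2 A1 := entry_blin i i - blin_comp star_blin (entry_blin i i).
  apply: (tangent_const (F := L) Tw (is_diff_blin L e)) => y Qy.
  have r z : Q z -> star (z i i) = z i i.
    by move=> /QrhoD_entries[z0 z1 _ _]; move: i {L}; exact: ord2P.
  rewrite /= -[LHS]/((y i i : A) - star (y i i)) -[RHS]/((e i i : A) - star (e i i)).
  by rewrite !r// !subrr.
have off : w 0 1 = - star (w 1 0).
  apply/eqP; rewrite -addr_eq0; apply/eqP.
  pose L : blin M2 A1 := entry_blin 0 1 + blin_comp star_blin (entry_blin 1 0).
  apply: (tangent_const (F := L) Tw (is_diff_blin L e)) => y Qy.
  have r z : Q z -> (z 0 1 : A) + star (z 1 0) = 0.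
    by move=> /QrhoD_entries[_ _ -> _]; rewrite addNr.
  by rewrite -[LHS]/((y 0 1 : A) + star (y 1 0)) -[RHS]/((e 0 1 : A) + star (e 1 0)) !r.
rewrite rhoDE; apply: mx2P; rewrite !mul2E !mx_starE !mx2E.
- by rewrite real mulr1 mulr0 mul1r mul0r.
- by rewrite off mulr0 mulrN1 mul1r mul0r add0r addr0.
- by rewrite off mulr1 mulr0 mul0r mulN1r starN starK addr0 add0r.
- by rewrite real mulr0 mulrN1 mul0r mulN1r.
Qed.

Lemma mx_double_inj m n (M N : 'M[A]_(m, n)) : M + M = N + N -> M = N.
Proof.
move=> MN; apply/matrixP => i j; apply: double_inj.
by have := congr1 (fun L : 'M[A]_(m, n) => L i j) MN; rewrite !mxE.
Qed.

Lemma anticomm_reflection (B : nzRingType) (p w : B) :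
  w * p + p * w + (w * p + p * w) - (w + w) = w * (p + p - 1) + (p + p - 1) * w.
Proof. by non_commutative_ring. Qed.

(** The hypothesis says that [w] is off-diagonal with respect to [p]: multiplying it by [p] on both
    sides gives [2 p w p = p w p]. *)
Lemma idem_offdiag (B : nzRingType) (p w : B) : p * p = p ->
  w * p + p * w = w -> p * w * p = 0.
Proof.
move=> pp pw; apply: (addrI (p * w * p)); rewrite addr0 -{3}pw.
have -> : p * (w * p + p * w) * p = p * w * (p * p) + (p * p) * w * p.
  by non_commutative_ring.
by rewrite pp.
Qed.

(** The lift is [w x / 2]. Differentiating [eps^2 = 1] gives [w p + p w = w]; hence [p w p = 0],
    which makes [w x] orthogonal to [x], and the derivative at [w x] is [2 (w p + p w) = 2 w]. *)
Lemma phi_tilde_tangent_surj : forall (x : A2) (w : M2), K x ->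
  tangent_space Q (phi_tilde x : M2) w ->
  exists2 v, tangent_space K x v & dphi_tilde x v = w.
Proof.
move=> x w Kx Tw; have xxE : (thetaD x x)%:M = 1%:M :> 'M[A]_1 by rewrite (proj1 Kx).
have [ew wr] := tangent_QrhoD (QrhoD_phi_tilde Kx) Tw.
pose p : 'M[A]_2 := krein_outer x x.
have ep : phi_tilde x = p + p - 1%:M by rewrite /phi_tilde mulr2n.
have pw : (w : 'M[A]_2) *m p + p *m w = w.
  apply: mx_double_inj; apply/eqP; rewrite -subr_eq0; apply/eqP.
  rewrite -[RHS]ew ep; apply: (@anticomm_reflection 'M[A]_2 p w).
pose u : 'cV[A]_2 := (w : 'M[A]_2) *m x.
have xu : thetaD x u = 0.
  have -> : thetaD x u = (mx_star x *m rhoD *m u) 0 0.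
    by rewrite thetaDE mxE eqxx mulr1n.
  have pwp : p *m w *m p = 0 := @idem_offdiag 'M[A]_2 _ _ (projK Kx) pw.
  have -> : mx_star x *m rhoD *m u = mx_star x *m rhoD *m (p *m w *m p) *m x.
    have px : p *m x = x.
      rewrite -[RHS]mulmx1 -[1%:M]xxE -thetaDE !mulmxA //.
    have xp : mx_star x *m rhoD *m p = mx_star x *m rhoD.
      by rewrite -[RHS]mul1mx -xxE -thetaDE !mulmxA.
    rewrite (mulmxA _ (p *m w) p) (mulmxA _ p w) xp -[RHS]mulmxA px.
    by rewrite /u mulmxA.
  by rewrite pwp mulmx0 mul0mx mxE.
have DF : dphi_tilde x (u : A2) = w + w.
  rewrite dphi_tildeE.
  have -> : krein_outer u x = (w : 'M[A]_2) *m p by rewrite /krein_outer /u !mulmxA.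
  have -> : krein_outer x u = p *m w.
    by rewrite /krein_outer /p /krein_outer /u mx_starM -!mulmxA wr.
  by rewrite pw.
exists (2^-1 *: (u : A2)).
  apply/(tangent_KD _ Kx); rewrite linearZ/=.
  rewrite -[X in _ *: X]/(re_theta x (u : A2)) re_thetaE xu.
  by rewrite -(star_thetaD x u) xu star0 addr0 scaler0.
rewrite linearZ/= -[X in _ *: X]/(dphi_tilde x (u : A2)) DF.
by rewrite scalerDr -scalerDl (_ : 2^-1 + 2^-1 = 1 :> R) ?scale1r//; lra.
Qed.

Lemma phi_tilde_submersion : is_submersion K Q (fun y : A2 => phi_tilde y : M2).
Proof.
apply: (submersion_intro K_submanifold Q_submanifold phi_tilde_smooth_map
  (fun x _ => is_diff_phi_tilde x) phi_tilde_tangent_surj) => x Kx.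
apply: (vertical_complemented (F := [set v | dphi_tilde x v = 0]) Kx) => v xv.
have [xx xu] := Kx.
have vE : vertical_proj x v = cvscale x (thetaD x v) by [].
have vx : thetaD v x = - thetaD x v.
  by apply/eqP; rewrite -addr_eq0; apply/eqP.
rewrite vE; split=> [|vv].
  move=> d0; have {}d0 : dphi_tilde x v = 0 by [].
  have kv : krein_outer v x + krein_outer x v = 0.
    by apply: mx_double_inj; rewrite addr0; exact: d0.
  (* Applied to [x], the vanishing derivative reads [v + x theta(v, x) = 0], which is
     [v = x theta(x, v)]. *)
  have : (krein_outer v x + krein_outer x v) *m x = 0 by rewrite kv mul0mx.
  rewrite mulmxDl /krein_outer.
  have -> : v *m mx_star x *m rhoD *m x = v *m (mx_star x *m rhoD *m x).
    by rewrite !mulmxA.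
  have -> : x *m mx_star v *m rhoD *m x = x *m (mx_star v *m rhoD *m x).
    by rewrite !mulmxA.
  rewrite !thetaDE xx mulmx1 vx raddfN mulmxN => /eqP; rewrite subr_eq0 => /eqP.
  by move=> vE'; exact: (esym vE').
suff : dphi_tilde x v = 0 by [].
have kv : krein_outer v x + krein_outer x v = 0.
  apply/matrixP => i j; rewrite [LHS]mxE [RHS]mxE !krein_outerE -vv !cvscaleE.
  rewrite starM star_thetaD vx; non_commutative_ring.
by rewrite dphi_tildeE kv addr0.
Qed.

Lemma PhiD_diffeomorphism : is_diffeomorphism D Q (fun z : A1 => PhiD z : M2).
Proof.
split.
- exact: open_submanifold open_disk.
- exact: Q_submanifold.
- split=> [z Dz|z Dz]; first by rewrite PhiDE//; exact: QrhoD_disk_param.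
  exists D, (fun z : A1 => disk_param z : M2); split=> //.
  + exact: open_disk.
  + by apply: (smooth_disk_param (f := id)) => //; exact: smooth_id.
  + by move=> y Dy _; rewrite PhiDE.
exists (fun e : M2 => disk_coord e : A1); split.
- split=> [e /QrhoD_param[]//|e Qe].
  have eC (U : set M2) i j : is_Cinfty U (fun e : M2 => e i j : A1).
    by apply: smooth_entry; exact: smooth_id.
  have s1C (U : set M2) : is_Cinfty U (fun e : M2 => 1 + e 0 0 : A1).
    by apply: smooth_add => //; exact: smooth_cst.
  exists [set e : M2 | setT e /\ (1 + e 0 0 : A) \is a GRing.unit],
    (fun e : M2 => disk_coord e : A1); split=> //.
  + exact: open_preimage openT (s1C setT) open_unit.
  + by split=> //; have [] := QrhoD_param Qe.
  + apply: smooth_mul => //.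
    by apply: (smooth_inv (f := fun e : M2 => 1 + e 0 0 : A1)) => // y [].
- by move=> z Dz; rewrite PhiDE// disk_paramK.
- by move=> e Qe; have [_ De eE] := QrhoD_param Qe; rewrite PhiDE.
Qed.

End Diffeomorphism.

Theorem theorem7p3 (R : realType) (A : cstarAlgType R) :
  let A1 : normedModType R := realify A in
  let A2 : normedModType R := mx_realify A 2 1 in
  let M2 : normedModType R := mx_realify A 2 2 in
  let D : set A1 := @disk R A in
  let K : set A2 := @KD R A in
  let Q : set M2 := @QrhoD R A in
  let fhat : A2 -> A1 := @phi_hat R A in
  let ftilde : A2 -> M2 := @phi_tilde R A in
  let Phi : A1 -> M2 := @PhiD R A in
  (forall z, D z -> exists x, K x /\ fhat x = z) /\
  (forall x, K x -> Phi (fhat x) = ftilde x) /\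
  is_submersion K D fhat /\
  is_submersion K Q ftilde /\
  is_diffeomorphism D Q Phi /\
  (forall g : 'M[A]_2, UthetaD g ->
    [/\ forall x : 'cV[A]_2, KD x -> phi_hat (g *m x) = mobius g (phi_hat x),
        forall x : 'cV[A]_2, KD x -> phi_tilde (g *m x) = conj2 g (phi_tilde x) &
        forall z : A, disk z -> PhiD (mobius g z) = conj2 g (PhiD z)]).
Proof.
move=> A1 A2 M2 D K Q fhat ftilde Phi.
split; first exact: phi_hat_surj.
split; first exact: PhiD_phi_hat.
split; first exact: phi_hat_submersion.
split; first exact: phi_tilde_submersion.
split; first exact: PhiD_diffeomorphism.
move=> g Ug; split.
- by move=> x; exact: phi_hat_mul.
- by move=> x _; exact: phi_tilde_mul.
- by move=> z; exact: PhiD_mobius.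
Qed.
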